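(* Let $(X,d,\mathfrak{m})$ be a metric measure space satisfying one of the following: (a) $(X,d,\mathfrak{m})$ is an essentially non-branching $MCP(K,N)$-space for some $K\in\mathbb{R}$, $N\in(1,\infty)$; (b) $(X,d,\mathfrak{m})$ is essentially non-branching and qualitatively non-degenerate. Suppose that there exists a point $x\in X$ for which $\mathrm{Tan}(X,x)=\{(\mathbb{R},0)\}$. Then $X$ is a one-dimensional manifold, possibly with boundary.
   Context: Standing conventions. A metric measure space $(X,d,\mathfrak{m})$ is a complete, locally compact and separable length space $(X,d)$ (hence geodesic) equipped with a locally finite Borel measure $\mathfrak{m}$ with $\operatorname{spt}\mathfrak{m}=X$. $B(x,r)$ denotes the open ball. $\mathrm{Geo}(X)$ is the space of constant speed, length minimising geodesics $\gamma:[0,1]\to X$, with the supremum distance; $e_t:\mathrm{Geo}(X)\to X$, $e_t(\gamma)=\gamma_t$. $\mathcal{P}(X)$ is the set of Borel probability measures on $X$; $\mathcal{P}_2(X)$ is the set of those with finite second moment; $\mathcal{P}_2^{ac}(X)$ is the set of $\mu\in\mathcal{P}_2(X)$ absolutely continuous with respect to $\mathfrak{m}$. For $\mu_0,\mu_1\in\mathcal{P}_2(X)$, $\mathrm{Opt}(\mu_0,\mu_1)$ is the set of minimisers of $\int d^2(x,y)\,d\sigma(x,y)$ among all $\sigma\in\mathcal{P}(X\times X)$ with first marginal $\mu_0$ and second marginal $\mu_1$, and $\mathrm{OptGeo}(\mu_0,\mu_1)$ is the set of $\pi\in\mathcal{P}(\mathrm{Geo}(X))$ with $(e_0,e_1)_\#\pi\in\mathrm{Opt}(\mu_0,\mu_1)$.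 Distortion coefficients. For $K\in\mathbb{R}$, $N\in(1,\infty)$, $t\in[0,1]$, $\theta\ge0$, put $\tau_{K,N}^{(t)}(\theta)=t^{1/N}\big(\sigma_{K,N-1}^{(t)}(\theta)\big)^{(N-1)/N}$, where $\sigma_{K,N-1}^{(t)}(\theta)$ equals $+\infty$ if $K\theta^2\ge(N-1)\pi^2$; $\frac{\sin(t\theta\sqrt{K/(N-1)})}{\sin(\theta\sqrt{K/(N-1)})}$ if $0<K\theta^2<(N-1)\pi^2$; $t$ if $K\theta^2=0$; $\frac{\sinh(t\theta\sqrt{-K/(N-1)})}{\sinh(\theta\sqrt{-K/(N-1)})}$ if $K\theta^2<0$. $MCP(K,N)$: for every $o\in X$ and every Borel set $A\subset X$ with $0<\mathfrak{m}(A)<\infty$ and $\mu_0:=\mathfrak{m}|_A/\mathfrak{m}(A)\in\mathcal{P}_2(X)$ (and $A\subset B(o,\pi\sqrt{(N-1)/K})$ if $K>0$) there is $\pi\in\mathrm{OptGeo}(\mu_0,\delta_o)$ such that for all $t\in[0,1]$, $\frac{1}{\mathfrak{m}(A)}\mathfrak{m}\ge(e_t)_\#\big(\tau_{K,N}^{(1-t)}(d(\gamma_0,\gamma_1))^N\,\pi(d\gamma)\big)$. Essentially non-branching: for all $\mu_0,\mu_1\in\mathcal{P}_2^{ac}(X)$, every $\pi\in\mathrm{OptGeo}(\mu_0,\mu_1)$ is concentrated on a Borel set $\Gamma\subset\mathrm{Geo}(X)$ that is non-branching, i.e. if $\gamma^1,\gamma^2\in\Gamma$ and $\gamma^1|_{[0,t]}=\gamma^2|_{[0,t]}$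 for some $t\in(0,1)$, then $\gamma^1=\gamma^2$. Qualitatively non-degenerate: for every $x_0\in X$ and $R>0$ there is a function $f:(0,1)\to(0,\infty)$ with $\limsup_{t\to0}f(t)>\frac12$ such that $\mathfrak{m}(A_{t,x})\ge f(t)\,\mathfrak{m}(A)$ for all Borel $A\subset B(x_0,R)$, $x\in B(x_0,R)$ and $t\in(0,1)$, where $A_{t,x}=\{\gamma_t:\gamma\in\mathrm{Geo}(X),\gamma_0\in A,\gamma_1=x\}$. Gromov–Hausdorff tangents. A map $f:(Y,d_Y)\to(Z,d_Z)$ is a $(1,\varepsilon)$-quasi-isometry if $|d_Z(f(y),f(y'))-d_Y(y,y')|\le\varepsilon$ for all $y,y'\in Y$ and the image of $f$ is $\varepsilon$-dense in $Z$. A sequence $(X_i,d_i,x_i)$ of pointed, complete, separable, locally compact geodesic spaces converges to such a space $(X_\infty,d_\infty,x_\infty)$ in the pointed Gromov–Hausdorff sense if for all $R>0$ there are $\varepsilon_i\to0$ and $(1,\varepsilon_i)$-quasi-isometries $f_i:\bar B(x_i,R)\to\bar B(x_\infty,R)$ with $f_i(x_i)=x_\infty$. $\mathrm{Tan}(X,x)$ is the set of (pointed isometry classes of) pointed spaces $(Y,d_Y,y)$ for which there is a sequence $\lambda_i\to\infty$ with $(X,\lambda_i d,x)\to(Y,d_Y,y)$ in this sense. $\mathrm{Tan}(X,x)=\{(\mathbb{R},0)\}$ means that, up to pointed isometry, $(\mathbb{R},|\cdot|,0)$ is the unique element of $\mathrm{Tan}(X,x)$. *)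

(* Defs.v *)
From HB Require Import structures.
From mathcomp Require Import all_boot all_order all_algebra.
From mathcomp Require Import all_classical all_reals all_analysis.

Set Implicit Arguments.
Unset Strict Implicit.
Unset Printing Implicit Defensive.
Import Order.TTheory GRing.Theory Num.Theory.
Import numFieldNormedType.Exports.
Local Open Scope classical_set_scope.
Local Open Scope ring_scope.

(* The library's measurable spaces are pointed, so a metric space that is to
   carry a Borel sigma-algebra needs a distinguished point; it plays no role. *)
#[short(type="pmetricType")]
HB.structure Definition PointedMetric (R : numDomainType) :=
  {T of Metric R T & Pointed T}.

Notation borel T := (g_sigma_algebraType (@open T)).

(* The library gives products both structures, but not their join. *)
HB.instance Definition _ (S T : ptopologicalType) := Pointed.on (S * T)%type.

Lemma continuous_borel (S T : ptopologicalType) (f : S -> T) :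
  continuous f -> measurable_fun [set: borel S] (f : borel S -> borel T).
Proof.
move=> /continuousP cf; apply: (measurability (@open T : set (set (borel T)))) => //.
move=> _ [B oB <-]; rewrite setTI.
by apply: sub_sigma_algebra; exact: cf.
Qed.

Section metric_spaces.
Context {R : realType}.

Definition complete_space (X : metricType R) :=
  forall F : set_system X, ProperFilter F -> cauchy F -> exists l : X, F --> l.

Definition separable_space (X : metricType R) :=
  exists2 D : set X, countable D & dense D.

Definition curve_length (X : metricType R) (c : R -> X) : \bar R :=
  ereal_sup [set (\sum_(0 <= i < size s)
                    mdist (c (nth 0 (0 :: s) i)) (c (nth 0 s i)))%:E
            | s in [set s | itv_partition 0 1 s]].

Definition length_space (X : metricType R) :=
  forall p q : X,
    (mdist p q)%:E =
    ereal_inf [set curve_length c | c in [set c : R -> X |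
      [/\ {within `[0, 1], continuous c}, c 0 = p & c 1 = q]]].

End metric_spaces.

Section geodesics.
Context {R : realType} (X : metricType R).

Record Geo := MkGeo {
  geo_fun :> {i01 R} -> X ;
  geo_speed : forall s t : {i01 R},
    mdist (geo_fun s) (geo_fun t) =
    `|t%:num - s%:num| * mdist (geo_fun 0%:i01) (geo_fun 1%:i01) }.

HB.instance Definition _ := gen_eqMixin Geo.
HB.instance Definition _ := gen_choiceMixin Geo.

Lemma geo_ext (g h : Geo) : (forall t, g t = h t) -> g = h.
Proof.
case: g h => [g gP] [h hP] /= /funext gh; case: _ / gh in hP *.
by congr MkGeo; exact: Prop_irrelevance.
Qed.

Definition geo_dist (g h : Geo) : R :=
  sup [set mdist (g t) (h t) | t in [set: {i01 R}]].

Lemma geo_dist_ub (g h : Geo) :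
  has_ubound [set mdist (g t) (h t) | t in [set: {i01 R}]].
Proof.
exists (mdist (g 0%:i01) (g 1%:i01) + mdist (g 0%:i01) (h 0%:i01)
        + mdist (h 0%:i01) (h 1%:i01)) => _ [t _ <-].
have bnd (k : Geo) : mdist (k 0%:i01) (k t) <= mdist (k 0%:i01) (k 1%:i01).
  rewrite geo_speed subr0 ler_piMl ?mdist_ge0//.
  by rewrite ger0_norm.
rewrite (le_trans (metric_triangle _ (h 0%:i01) _))// lerD ?bnd//.
rewrite (le_trans (metric_triangle _ (g 0%:i01) _))// lerD// metric_sym.
exact: bnd.
Qed.

Lemma le_geo_dist (g h : Geo) t : mdist (g t) (h t) <= geo_dist g h.
Proof. by apply: ub_le_sup; [exact: geo_dist_ub | exists t]. Qed.

Lemma geo_dist_le (g h : Geo) e :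
  (forall t, mdist (g t) (h t) <= e) -> geo_dist g h <= e.
Proof.
move=> le_e; apply: ge_sup; last by move=> _ [t _ <-].
by exists (mdist (g 0%:i01) (h 0%:i01)), 0%:i01.
Qed.

Lemma geo_distxx g : geo_dist g g = 0.
Proof.
apply/eqP; rewrite eq_le (le_trans (mdist_ge0 _ _) (le_geo_dist g g 0%:i01)).
by rewrite andbT geo_dist_le// => t; rewrite mdistxx.
Qed.

Lemma geo_dist_positivity g h : geo_dist g h = 0 -> g = h.
Proof.
move=> gh0; apply: geo_ext => t; apply: mdist_positivity.
by apply/eqP; rewrite eq_le mdist_ge0 -gh0 le_geo_dist.
Qed.

Lemma geo_dist_sym g h : geo_dist g h = geo_dist h g.
Proof.
by apply/eqP; rewrite eq_le !geo_dist_le// => t;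
  rewrite metric_sym le_geo_dist.
Qed.

Lemma geo_dist_triangle h g k : geo_dist g k <= geo_dist g h + geo_dist h k.
Proof.
apply: geo_dist_le => t; rewrite (le_trans (metric_triangle _ (h t) _))//.
by rewrite lerD ?le_geo_dist.
Qed.

HB.instance Definition _ := isMetric.Build R Geo
  geo_distxx geo_dist_positivity geo_dist_sym geo_dist_triangle.

Definition geodesic_space := forall p q : X,
  exists g : Geo, g 0%:i01 = p /\ g 1%:i01 = q.

End geodesics.

Section evaluation.
Context {R : realType} {X : pmetricType R}.

Lemma geo_cst_speed (p : X) (s t : {i01 R}) :
  mdist p p = `|t%:num - s%:num| * mdist p p.
Proof. by rewrite mdistxx mulr0. Qed.

HB.instance Definition _ :=
  isPointed.Build (Geo X) (MkGeo (geo_cst_speed point)).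

Definition ev (t : {i01 R}) : borel (Geo X) -> borel X := fun g => g t.

Definition ev01 : borel (Geo X) -> borel (X * X)%type :=
  fun g => (g 0%:i01, g 1%:i01).

Lemma ev_continuous t : continuous (fun g : Geo X => g t).
Proof.
move=> g A /nbhs_ballP[e e0 gA]; apply/nbhs_ballP; exists e => // h.
rewrite ballEmdist /= => gh; apply: gA; rewrite ballEmdist /=.
exact: le_lt_trans (le_geo_dist g h t) gh.
Qed.

Lemma ev_measurable t : measurable_fun [set: borel (Geo X)] (ev t).
Proof. apply: continuous_borel; exact: ev_continuous. Qed.

Lemma ev01_measurable : measurable_fun [set: borel (Geo X)] ev01.
Proof.
apply: (@continuous_borel (Geo X) (X * X)%type) => g.
exact: (@cvg_pair _ _ _ (nbhs g) (nbhs (g 0%:i01)) (nbhs (g 1%:i01))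
  _ _ _ _ _ (@ev_continuous _ g) (@ev_continuous _ g)).
Qed.

HB.instance Definition _ t := isMeasurableFun.Build _ _ _ _ (ev t)
  (ev_measurable t).
HB.instance Definition _ := isMeasurableFun.Build _ _ _ _ ev01 ev01_measurable.

End evaluation.

Section transport.
Context {R : realType} (X : pmetricType R).
Local Open Scope ereal_scope.

Definition P2 (mu : probability (borel X) R) :=
  exists o : X, \int[mu]_p ((mdist o p) ^+ 2)%:E < +oo.

Definition P2ac (m : {measure set (borel X) -> \bar R})
    (mu : probability (borel X) R) := P2 mu /\ mu `<< m.

Definition coupling (mu0 mu1 : probability (borel X) R)
    (s : probability (borel (X * X)%type) R) :=
  forall A : set (borel X), measurable A ->
    s (fst @^-1` A) = mu0 A /\ s (snd @^-1` A) = mu1 A.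

Definition cost (s : probability (borel (X * X)%type) R) : \bar R :=
  \int[s]_z ((mdist z.1 z.2) ^+ 2)%:E.

Definition Opt (mu0 mu1 : probability (borel X) R)
    : set (probability (borel (X * X)%type) R) :=
  [set s | coupling mu0 mu1 s /\
           forall s', coupling mu0 mu1 s' -> cost s <= cost s'].

Definition OptGeo (mu0 mu1 : probability (borel X) R)
    : set (probability (borel (Geo X)) R) :=
  [set P | Opt mu0 mu1 (distribution P ev01)].

End transport.

Section distortion.
Context {R : realType}.
Implicit Types K N t theta : R.

Definition sinh (u : R) : R := (expR u - expR (- u)) / 2.

(* The argument [N] here stands for the subscript [N - 1] of the literature. *)
Definition sigma K N t theta : \bar R :=
  if N * pi ^+ 2 <= K * theta ^+ 2 then +oo%E
  else if 0 < K * theta ^+ 2 then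
    (sin (t * theta * Num.sqrt (K / N)) / sin (theta * Num.sqrt (K / N)))%:E
  else if K * theta ^+ 2 == 0 then t%:E
  else (sinh (t * theta * Num.sqrt (- K / N))
          / sinh (theta * Num.sqrt (- K / N)))%:E.

Definition tau K N t theta : \bar R :=
  ((t `^ N^-1)%:E * (sigma K (N - 1) t theta `^ ((N - 1) / N)))%E.

End distortion.

Section conditions.
Context {R : realType} {X : pmetricType R}.
Variable m : {measure set (borel X) -> \bar R}.
Local Open Scope ereal_scope.

Definition metric_measure_space :=
  [/\ complete_space X, locally_compact [set: X], separable_space X &
      length_space X] /\
  (forall p : X, exists2 U : set X, open_nbhs p U & m U < +oo) /\
  (forall U : set X, open U -> U !=set0 -> 0 < m U).

(* [mnormalize (mrestr m mA) (dirac o)] is the normalised restriction of [m]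
   to [A]; [dirac o] only serves as a default when [m A] is [0] or infinite. *)
Definition MCP (K N : R) :=
  forall (o : X) (A : set (borel X)) (mA : measurable A),
    let mu0 : probability (borel X) R :=
      mnormalize (mrestr m mA) (dirac (o : borel X)) in
    0 < m A -> m A < +oo -> P2 mu0 ->
    ((0 < K)%R -> A `<=` ball o (pi * Num.sqrt ((N - 1) / K))%R) ->
    exists2 P, OptGeo mu0 (dirac (o : borel X)) P &
      forall (t : {i01 R}) (B : set (borel X)), measurable B ->
        pushforward (fun G : set (borel (Geo X)) =>
            \int[P]_(g in G)
              tau K N (1 - t%:num)%R (mdist (g 0%:i01) (g 1%:i01))%R `^ N)
          (ev t) B
        <= (fine (m A))^-1%:E * m B.

Definition nonbranching (G : set (Geo X)) :=
  forall g h : Geo X, G g -> G h ->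
    (exists t : {i01 R}, (0 < t%:num < 1)%R /\
       forall s : {i01 R}, (s%:num <= t%:num)%R -> g s = h s) ->
    g = h.

Definition essentially_nonbranching :=
  forall mu0 mu1 : probability (borel X) R, P2ac m mu0 -> P2ac m mu1 ->
    forall P, OptGeo mu0 mu1 P ->
      exists G : set (borel (Geo X)),
        [/\ measurable G, P (~` G) = 0 & nonbranching G].

Definition interpolation (A : set X) (p : X) (t : {i01 R}) : set X :=
  [set g t | g in [set g : Geo X | A (g 0%:i01)%R /\ (g 1%:i01)%R = p]].

(* [interpolation A p t] is Suslin but in general not Borel, so its measure is
   that for the completion of [m], i.e. its outer measure. *)
Definition qualitatively_nondegenerate :=
  forall (x0 : X) (r : R), (0 < r)%R ->
    exists f : R -> R,
      [/\ forall t, (0 < t < 1)%R -> (0 < f t)%R,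
          (2^-1)%:E < limf_esup (fun t => (f t)%:E) (0%R^'+) &
          forall (A : set (borel X)) (p : X) (t : {i01 R}),
            measurable A -> A `<=` ball x0 r -> ball x0 r p ->
            (0 < t%:num < 1)%R ->
            (f t%:num)%:E * m A
              <= mu_ext m (interpolation A p t : set (borel X))].

End conditions.

Definition rescale (R : realType) (l : {posnum R}) (X : metricType R) : Type :=
  X.

Section rescale.
Context {R : realType} (l : {posnum R}) (X : metricType R).
Local Notation rescale := (rescale l X).

Definition rescale_dist (p q : rescale) : R := l%:num * @mdist R X p q.

Lemma rescale_distxx p : rescale_dist p p = 0.
Proof. by rewrite /rescale_dist mdistxx mulr0. Qed.

Lemma rescale_dist_positivity p q : rescale_dist p q = 0 -> p = q.
Proof.
by move/eqP; rewrite mulf_eq0 gt_eqF//= => /eqP; exact: mdist_positivity.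
Qed.

Lemma rescale_dist_sym p q : rescale_dist p q = rescale_dist q p.
Proof. by rewrite /rescale_dist metric_sym. Qed.

Lemma rescale_dist_triangle q p z :
  rescale_dist p z <= rescale_dist p q + rescale_dist q z.
Proof. by rewrite -mulrDr ler_pM2l// metric_triangle. Qed.

HB.instance Definition _ := Choice.on rescale.
HB.instance Definition _ := isMetric.Build R rescale rescale_distxx
  rescale_dist_positivity rescale_dist_sym rescale_dist_triangle.

End rescale.

Section gromov_hausdorff.
Context {R : realType}.

Definition cball (X : metricType R) (p : X) (r : R) : set X :=
  [set q | mdist p q <= r].

Definition quasi_isometry (e : R) (Y Z : metricType R)
    (A : set Y) (B : set Z) (f : Y -> Z) :=
  [/\ set_fun A B f,
      forall p q, A p -> A q -> `|mdist (f p) (f q) - mdist p q| <= e &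
      forall z, B z -> exists2 p, A p & mdist (f p) z <= e].

Definition pGH_cvg (Y : nat -> metricType R) (y : forall i, Y i)
    (Z : metricType R) (z : Z) :=
  forall r : R, 0 < r ->
    exists2 e : nat -> R, e @ \oo --> 0 &
      forall i, exists2 f : Y i -> Z,
        quasi_isometry (e i) (cball (y i) r) (cball z r) f & f (y i) = z.

Definition tangent (X : metricType R) (x : X) (Y : metricType R) (y : Y) : Prop :=
  [/\ complete_space Y, separable_space Y, locally_compact [set: Y] &
      geodesic_space Y] /\
  exists2 l : nat -> {posnum R}, (fun i => (l i)%:num : R) @ \oo --> +oo &
    @pGH_cvg (fun i => rescale (l i) X : metricType R) (fun=> x) Y y.

Definition pointed_isometric (Y Z : metricType R) (y : Y) (z : Z) :=
  exists f : Y -> Z,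
    [/\ forall p q, mdist (f p) (f q) = mdist p q,
        forall q, exists p, f p = q & f y = z].

Definition tangent_is_line (X : metricType R) (x : X) :=
  tangent x (0 : R^o) /\
  forall (Y : metricType R) (y : Y), tangent x y ->
    pointed_isometric y (0 : R^o).

End gromov_hausdorff.

Definition homeomorphic (S T : topologicalType) :=
  exists (f : S -> T) (g : T -> S),
    [/\ continuous f, continuous g, cancel f g & cancel g f].

(* The boundary may be empty: the charts take values in relatively open
   subsets of the half-line, which need not contain the endpoint. *)
Definition manifold1_with_boundary (R : realType) (X : topologicalType) :=
  [/\ hausdorff_space X, @second_countable X &
      forall p : X, exists2 U : set X, open_nbhs p U &
        exists2 V : set R, open V &
          homeomorphic (set_type U) (set_type (V `&` [set r | 0 <= r]))].

(* Main.v *)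
(* By Hopf-Rinow the space is proper and geodesic, and both hypotheses give:
   moving a set halfway towards a nearby point shrinks its measure by at most
   a constant factor.

   Say that [a] cuts [v] from [p] if all geodesics from [v] to [p] pass through
   [a]. If [a] cuts every point of a ball [V] from [p1] and from [p2], and
   [d a p1 = d a p2], then [p1 = p2]. Otherwise move [V] almost all the way to
   [p1] and to [p2], obtaining disjoint sets of positive measure, and couple [V]
   with both of them by a map depending on [d a v] only and decreasing in it.
   As [d v z = d a v + d a z], this coupling is optimal, and its geodesics can be
   selected so that the two families agree until they reach [a]; averaging them
   gives an optimal plan between absolutely continuous measures that branches.

   At [x] the measure is doubling, so rescalings subconverge and the hypothesis
   on tangents says that small balls around [x] are almost isometric to
   intervals at every scale. A geodesic joining the two sides of such a ball
   passes within a small fraction of its radius from [x]; if it missed [x], at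
   the scale of its distance to [x] it would have to turn back. Hence [x] cuts
   one side from the other, so there is one point at each distance on each side
   and a ball around [x] is isometric to an interval.

   If a ball around [y] is isometric to an interval and [p] is near [y], then a
   point [a] of this interval cuts a ball next to [y] from all points near [p].
   So [d a] is injective near [p], hence an isometry onto an interval, which has
   [p] as an end only if no geodesic from [y] extends beyond [p]. Steps of
   uniform size along geodesics from [x] reach every point. *)
Require Import Defs.
From HB Require Import structures.
From mathcomp Require Import all_boot all_order all_algebra.
From mathcomp Require Import all_classical all_reals all_analysis.
From mathcomp Require Import measurable_realfun ring lra.
Set Implicit Arguments.
Unset Strict Implicit.
Unset Printing Implicit Defensive.
Import Order.TTheory GRing.Theory Num.Theory.
Import numFieldNormedType.Exports.
Local Open Scope classical_set_scope.
Local Open Scope ring_scope.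

(** * Borel sections *)

(** The cut-point argument needs one probability space on which a point of [V] and its two targets
    are chosen together and measurably. The optimal coupling prescribes only how the levels [d a v]
    and [d a z] correspond, so the space consists of a level and an independent uniform variable:
    each of the three sets is disintegrated over its level, and the uniform variable picks the point
    inside the level set through a conditional quantile. Moving towards [p] changes the level by a
    decreasing affine map; non-degeneracy, applied to sets of levels, then says that levels which
    are null for a target are null for [V], and this keeps all marginals absolutely continuous. The
    measurable choices, of a point in a level set and of a branching pair of geodesics with given
    ends, have one source: a compact metric space is a continuous image of the Cantor space, so its
    points have real codes, and the least code in the fibres of a continuous map is Borel. Tangents
    are produced as ultralimits, where one fixed ultrafilter provides all limits at once. *)

Section cantor_code.
Context {R : realType}.

(** Digits [0] and [1] in base 3: unlike in base 2, a digit [1] outweighs all the later digits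
    together, so a sum determines its digits. *)
Definition ternary_sum (x : cantor_space) (n : nat) : R :=
  \sum_(0 <= i < n) (x i)%:R / 3 ^+ i.

Lemma ternary_sum_nd x n : ternary_sum x n <= ternary_sum x n.+1.
Proof.
by rewrite /ternary_sum big_nat_recr//= lerDl divr_ge0// exprn_ge0.
Qed.

Lemma ternary_sum_le x n m : (n <= m)%N ->
  ternary_sum x n <= ternary_sum x m.
Proof. by apply: (homo_leq le_refl le_trans); exact: ternary_sum_nd. Qed.

(** [3 / 2 / 3 ^+ n] is the geometric series from rank [n] on, so the partial sum plus this bound is
    nonincreasing in [n]. *)
Lemma ternary_sum_tail x n m :
  ternary_sum x m <= ternary_sum x n + 3 / 2 / 3 ^+ n.
Proof.
have nx k : ternary_sum x k.+1 + 3 / 2 / 3 ^+ k.+1 <=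
    ternary_sum x k + 3 / 2 / 3 ^+ k.
  rewrite /ternary_sum big_nat_recr//= -addrA lerD2l exprS.
  have h : 0 < (3 ^+ k)^-1 :> R by rewrite invr_gt0 exprn_gt0.
  rewrite invfM.
  by case: (x k) => /=; set y := _^-1 in h *; lra.
have mon k : (n <= k)%N -> ternary_sum x k + 3 / 2 / 3 ^+ k <=
    ternary_sum x n + 3 / 2 / 3 ^+ n.
  move=> nk; rewrite -(subnK nk); elim: (k - n)%N => // j; rewrite addSn.
  exact: le_trans.
have [mn|nm] := leqP m n.
  by rewrite (le_trans (ternary_sum_le x mn))// lerDl !divr_ge0// exprn_ge0.
by rewrite (le_trans _ (mon _ (ltnW nm)))// lerDl !divr_ge0// exprn_ge0.
Qed.

Definition cantor_code (x : cantor_space) : R := sup (range (ternary_sum x)).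

Let has_sup_code x : has_sup (range (ternary_sum x)).
Proof.
split; first by exists (ternary_sum x 0), 0%N.
by exists (ternary_sum x 0 + 3 / 2 / 3 ^+ 0) => _ [m _ <-]; exact: ternary_sum_tail.
Qed.

Lemma cantor_code_ge x n : ternary_sum x n <= cantor_code x.
Proof. by apply: ub_le_sup; [exact: (has_sup_code x).2|exists n]. Qed.

Lemma cantor_code_le x n : cantor_code x <= ternary_sum x n + 3 / 2 / 3 ^+ n.
Proof.
apply: ge_sup; first exact: (has_sup_code x).1.
by move=> _ [m _ <-]; exact: ternary_sum_tail.
Qed.

Lemma ternary_sum_eq (x y : cantor_space) n :
  (forall i, (i < n)%N -> x i = y i) -> ternary_sum x n = ternary_sum y n.
Proof.
by move=> xy; apply: eq_big_nat => i /andP[_ /xy ->].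
Qed.

(** At the first index [n] where two sequences differ, the digit [1] contributes [1 / 3 ^+ n], while
    the whole tail left to the other sequence is at most half of that. *)
Lemma cantor_code_inj : injective cantor_code.
Proof.
suff key (x y : cantor_space) n : (forall i, (i < n)%N -> x i = y i) ->
    x n -> ~~ y n -> cantor_code y < cantor_code x.
  move=> x y cxy; apply/funext => n; elim/ltn_ind: n => n ih.
  case xn : (x n); case yn : (y n) => //.
  - by have := key x y n ih; rewrite xn yn cxy ltxx => /(_ isT isT).
  - have := key y x n (fun i lin => esym (ih i lin)).
    by rewrite xn yn cxy ltxx => /(_ isT isT).
move=> xy xn yn; have := cantor_code_ge x n.+1; have := cantor_code_le y n.+1.
rewrite /ternary_sum !big_nat_recr//= xn (negbTE yn) exprS.
have := ternary_sum_eq xy; rewrite /ternary_sum => ->.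
have h : 0 < (3 ^+ n)^-1 :> R by rewrite invr_gt0 exprn_gt0.
by rewrite invfM mul0r addr0; set s := \sum_(_ <= _ < _) _;
  set z := _^-1 in h *; move=> /=; lra.
Qed.

Lemma cantor_code_continuous : continuous cantor_code.
Proof.
move=> x; apply/cvgrPdist_lt => e e0.
have [n ne] : exists n : nat, 3 / 2 / 3 ^+ n < e.
  have [n ne] : exists n : nat, 3 / 2 / e < n%:R.
    by exists (Num.truncn (3 / 2 / e)).+1; rewrite truncnS_gt.
  exists n; rewrite ltr_pdivrMr ?exprn_gt0//.
  rewrite ltr_pdivrMr// in ne; rewrite (lt_trans ne)// mulrC ltr_pM2l//.
  rewrite -natrX ltr_nat; exact: ltn_expl.
have : \forall y \near x, forall i, (i < n)%N -> x i = y i.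
  elim: n {ne} => [|n ih]; first exact: filterE.
  have cn : \forall y \near x, x n = y n.
    have := @proj_continuous nat (fun _ => bool) n x [set x n] (discrete_set1 _).
    by apply: filterS => y.
  near=> y => i; rewrite ltnS leq_eqVlt => /orP[/eqP ->|].
    by near: y; exact: cn.
  by move: i; near: y; exact: ih.
apply: filterS => y /ternary_sum_eq xy.
have := cantor_code_ge x n; have := cantor_code_le x n.
have := cantor_code_ge y n; have := cantor_code_le y n.
by rewrite xy ltr_norml; move=> /= *; apply/andP; split; lra.
Unshelve. all: by end_near. Qed.

End cantor_code.

Lemma ultra_fmap (S T : Type) (f : S -> T) (F : set_system S) :
  UltraFilter F -> UltraFilter (f @ F).
Proof.
move=> FU; split => [|G PG FG]; first exact: fmap_proper_filter.
apply/seteqP; split => // A GA.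
have [//|FA] := in_ultra_setVsetC (f @^-1` A) FU.
exfalso; apply: (@filter_not_empty _ G _).
by rewrite -(setICr A); apply: filterI => //; exact: FG.
Qed.

Section borel_codes.
Context {R : realType}.

Lemma closed_borel (T : ptopologicalType) (F : set T) :
  closed F -> measurable (F : set (borel T)).
Proof.
by move=> cF; rewrite -[F]setCK; apply: measurableC;
  apply: sub_sigma_algebra; exact: closed_openC.
Qed.

Lemma compact_Rmeasurable (C : set R) : compact C -> measurable C.
Proof.
exact: compact_measurable.
Qed.

(** A continuous surjection from the Cantor space onto [K] is composed with the inverse of
    [cantor_code], and extended by a constant outside the set [C] of codes. Since the Cantor space
    is compact, closed conditions on [k r] cut out compact sets of codes; all measurability below
    rests on this. *)
Lemma borel_parametrization (T : pseudoPMetricType R) (K : set T) :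
  hausdorff_space T -> compact K -> K !=set0 ->
  exists (C : set R) (k : R -> T),
    [/\ (forall r, K (k r)) /\ C `<=` `[0, 2],
        forall s, compact (k @` (C `&` [set r | r <= s])),
        forall F : set T, closed F -> compact (C `&` k @^-1` F),
        k @` C = K &
        measurable_fun [set: R] (k : R -> borel T)].
Proof.
move=> hT cK [p0 Kp0].
(* [cantor_surj] maps onto a whole space, so [K] is made a space of its own, and compactness is
   transferred to it along ultrafilters. *)
pose pK : K := exist _ p0 (mem_set Kp0).
pose KT : pseudoPMetricType R := HB.pack (set_type K) (isPointed.Build (set_type K) pK).
have vc : continuous (set_val : KT -> T) := @initial_continuous K T set_val.
have cKT : compact [set: KT].
  rewrite compact_ultra => F FU _.
  have := cK; rewrite compact_ultra => /(_ (set_val @ F) (ultra_fmap _ FU)) [].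
    have FK : F (set_val @^-1` K).
      by apply: filterE => -[q qK] /=; apply/set_mem.
    exact: FK.
  move=> q [Kq Fq]; exists (exist _ q (mem_set Kq)); split => //.
  move=> A /= [_ [[B oB <-] Bq] BA].
  by apply: filterS BA _; apply: Fq; apply: open_nbhs_nbhs.
have hKT : hausdorff_space KT.
  move=> p q pq; apply: val_inj; apply: hT => A B Ap Bq.
  have [z [Az Bz]] := pq _ _ (vc _ _ Ap) (vc _ _ Bq).
  by exists (set_val z).
have [f cf] := cantor_surj cKT hKT.
pose g x := set_val (f x) : T.
have cg : continuous g by move=> x; apply: continuous_comp; [exact: cf|exact: vc].
have gK x : K (g x) by rewrite /g; apply/set_mem; exact: valP.
have gsurj v : K v -> exists x, g x = v.
  move=> Kv; have [x _ fx] := @surj _ _ _ _ f (exist _ v (mem_set Kv)) I.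
  by exists x; rewrite /g fx.
pose e : cantor_space -> R := cantor_code.
have ce : continuous e by exact: cantor_code_continuous.
pose C := range e.
pose k r := if pselect (exists x, e x = r) is left ex then g (projT1 (cid ex)) else p0.
have ke x : k (e x) = g x.
  rewrite /k; case: pselect => [ex|]; last by case; exists x.
  by case: cid => y /= /cantor_code_inj ->.
have cpt (A : set cantor_space) : closed A -> compact A.
  by move=> cA; apply: (subclosed_compact cA cantor_space_compact).
have kCF (F : set T) : closed F -> compact (C `&` k @^-1` F).
  move=> cF.
  have -> : C `&` k @^-1` F = e @` (g @^-1` F).
    apply/seteqP; split => [_ [[x _ <-]]|_ [x Fx <-]].
      by rewrite /preimage /= ke => ?; exists x.
    by split; [exists x|rewrite /preimage /= ke].
  apply: continuous_compact; first exact: continuous_subspaceT.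
  by apply: cpt; apply: closed_comp => // ? _; exact: cg.
exists C, k; split => //.
- split; first by move=> r; rewrite /k; case: pselect.
  move=> _ [x _ <-]; rewrite /= in_itv /=; have := @cantor_code_le R x 0.
  have := @cantor_code_ge R x 0; rewrite /ternary_sum big_geq// => h1 h2.
  by apply/andP; split => //; apply: le_trans h2 _; rewrite expr0; lra.
- move=> s.
  have -> : k @` (C `&` [set r | r <= s]) = g @` (e @^-1` [set r | r <= s]).
    apply/seteqP; split => [_ [_ [[x _ <-] xs] <-]|_ [x xs <-]].
      by rewrite ke; exists x.
    by exists (e x); [split => //; exists x|rewrite ke].
  apply: continuous_compact; first exact: continuous_subspaceT.
  by apply: cpt; apply: closed_comp => [? _|]; [exact: ce|exact: closed_le].
- apply/seteqP; split => [_ [_ [x _ <-] <-]|v /gsurj[x <-]].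
    by rewrite ke.
  by exists (e x); [exists x|rewrite ke].
- apply: (measurability (@open T : set (set (borel T)))) => //.
  move=> _ [B oB <-]; rewrite setTI -[_ @^-1` _]setCK; apply: measurableC.
  (* Outside [C] the value is constantly [p0], so the complement of [C] is taken entirely or not at
     all. *)
  have -> : ~` (k @^-1` B) = (C `&` k @^-1` (~` B)) `|` (~` C `&` [set _ | ~ B p0]).
    apply/seteqP; split => r /=.
      move=> nB; have [Cr|nC] := pselect (C r); [by left|right; split => //].
      move: nB; rewrite /k; case: pselect => // -[x xr].
      by exfalso; apply: nC; exists x.
    move=> [[]//|[nC nB]]; rewrite /k; case: pselect => // -[x xr].
    by exfalso; apply: nC; exists x.
  have mC : measurable C.
    apply: compact_Rmeasurable.
    by have := kCF _ closedT; rewrite preimage_setT setIT.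
  apply: measurableU.
    by apply: compact_Rmeasurable; apply: kCF; exact: open_closedC.
  apply: measurableI; first exact: measurableC.
  have [b|b] := pselect (B p0).
    by rewrite (_ : [set _ | _] = set0)//; apply/seteqP; split.
  by rewrite (_ : [set _ | _] = setT)//; apply/seteqP; split.
Qed.

(* The section sends [l] to the least code of a point of the fibre over [l];
   sublevel sets are images of compact sets. *)
Lemma borel_section (T : pseudoPMetricType R) (K : set T) :
  hausdorff_space T -> compact K -> K !=set0 ->
  exists2 k : R -> T,
    (forall r, K (k r)) /\ measurable_fun [set: R] (k : R -> borel T) &
    forall (L : ptopologicalType) (g : T -> L), hausdorff_space L ->
      continuous g ->
      exists2 c : L -> R, measurable_fun [set: borel L] (c : borel L -> R) &
        (forall l, 0 <= c l <= 2) /\ forall l, (g @` K) l -> g (k (c l)) = l.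
Proof.
move=> hT cK K0; have [C [k [[kK C02] kle kCF kC mk]]] := borel_parametrization hT cK K0.
exists k => // L g hL cg.
pose fib l := C `&` k @^-1` (g @^-1` [set l]).
have cfib l : compact (fib l).
  apply: kCF; apply: closed_comp; first by move=> ? _; exact: cg.
  exact/accessible_closed_set1/hausdorff_accessible.
have minfib l : (g @` K) l -> exists2 r, fib l r & forall s, fib l s -> r <= s.
  move=> [v]; rewrite -kC => -[r Cr <-] gl.
  have [||c /set_mem cf cm] := @compact_EVT_min _ _ id (fib l) _ (cfib l).
  - by exists r.
  - by apply: continuous_subspaceT => ?; exact: cvg_id.
  by exists c => // s fs; apply: cm; exact: mem_set.
pose c l := if pselect ((g @` K) l) is left gl
  then projT1 (cid2 (minfib l gl)) else 0.
exists c; last first.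
  split=> l; last first.
    by move=> gl; rewrite /c; case: pselect => // gl'; case: cid2 => r /= [].
  rewrite /c; case: pselect => [gl|_]; last by apply/andP; split; lra.
  by case: cid2 => r /= [/C02 + _] _; rewrite /= in_itv.
apply: (measurability _ (RGenOInfty.measurableE R)) => //.
move=> _ [_ [s ->] <-]; rewrite setTI -[_ @^-1` _]setCK; apply: measurableC.
(* The least code over [l] is at most [s] exactly when some code over [l] is; the second set
   accounts for the default value [0] outside the image. *)
have -> : ~` (c @^-1` `]s, +oo[) =
   (g @` (k @` (C `&` [set r | r <= s]))) `|` (~` (g @` K) `&` [set _ | 0 <= s]).
  apply/seteqP; split => l /=; rewrite in_itv /= andbT.
    move/negP; rewrite -leNgt /c; case: pselect => [gl|ngl].
      case: cid2 => r /= [Cr grl] _ rs; left.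
      by exists (k r) => //; exists r.
    by move=> s0; right.
  move=> [[_ [r [Cr rs] <-] grl]|[ngl s0]].
    apply/negP; rewrite -leNgt /c; case: pselect => [gl|ngl]; last first.
      by exfalso; apply: ngl; exists (k r).
    case: cid2 => r' /= _ le_r'; apply: le_trans rs; exact: le_r'.
  by apply/negP; rewrite -leNgt /c; case: pselect.
have cgm (A : set T) : compact A -> measurable (g @` A : set (borel L)).
  move=> cA; apply: closed_borel; apply: compact_closed => //.
  by apply: continuous_compact => //; exact: continuous_subspaceT.
apply: measurableU; first by apply: cgm; exact: kle.
apply: measurableI; first by apply: measurableC; exact: cgm.
have [b|b] := boolP (0 <= s).
  by rewrite (_ : [set _ | _] = setT)//; apply/seteqP; split.
by rewrite (_ : [set _ | _] = set0)//; apply/seteqP; split.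
Qed.

End borel_codes.

(** * Disintegration over a real-valued map *)

Section disintegration.
Context d (T : measurableType d) (R : realType).
Local Open Scope ereal_scope.

Lemma negligible_bigcup_count (I : countType) (m : {measure set T -> \bar R})
    (P : set I) (F : I -> set T) :
  (forall i, P i -> m.-negligible (F i)) -> m.-negligible (\bigcup_(i in P) F i).
Proof.
move=> nF; pose G n := if unpickle n is Some i then
  (if `[< P i >] then F i else set0) else set0.
apply: (@negligibleS _ _ _ _ (\bigcup_n G n)).
  move=> x [i Pi Fx]; exists (pickle i) => //; rewrite /G pickleK.
  by case: asboolP.
apply: negligible_bigcup => n; rewrite /G.
case: unpickle => [i|]; last exact: negligible_set0.
by case: asboolP => [/nF//|_]; exact: negligible_set0.
Qed.

(** On the set where [g < f] the difference is positive and its integral is at most [0], so it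
    vanishes almost everywhere there. *)
Lemma le_density (k : {finite_measure set T -> \bar R}) (f g : T -> \bar R) :
  k.-integrable setT f -> k.-integrable setT g ->
  (forall A, measurable A -> \int[k]_(x in A) f x <= \int[k]_(x in A) g x) ->
  k [set x | g x < f x] = 0.
Proof.
move=> intf intg fg; set E := [set x | _].
have mf := measurable_int _ intf; have mg := measurable_int _ intg.
have mE : measurable E.
  by have := measurable_lte measurableT mg mf; rewrite setTI.
have iE h : k.-integrable setT h -> k.-integrable E h by apply: integrableS.
have gf0 x : E x -> 0 <= f x - g x by rewrite /E /= => gf; rewrite ltW// sube_gt0.
have : ae_eq k E (f \- g) (cst 0).
  apply/ae_eq_integral_abs => //.
    by apply: measurable_funTS; exact: emeasurable_funB.
  rewrite (eq_integral (fun x => f x - g x)); last first.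
    by move=> x; rewrite inE => Ex; rewrite gee0_abs// gf0.
  apply/eqP; rewrite eq_le integral_ge0// andbT.
  rewrite integralB//; [|exact: iE|exact: iE].
  by rewrite sube_le0 fg.
case=> N [mN N0 EN]; apply/eqP; rewrite eq_le measure_ge0 andbT -N0.
rewrite le_measure ?inE// => x Ex; apply: EN => /= /(_ Ex) fg0.
by move: Ex; rewrite /E /= -sube_gt0 fg0 ltxx.
Qed.

Variables (b : probability (T * measurableTypeR R)%type R).

(** As a measure in [J] this lies below the first marginal of [b], and its density is the
    conditional probability of [A] given the first coordinate. *)
Definition slab (A : set (measurableTypeR R)) & measurable A :=
  fun J : set T => b (J `*` A).

Section slab_measure.
Variables (A : set (measurableTypeR R)) (mA : measurable A).

Let slab0 : slab mA set0 = 0. Proof. by rewrite /slab set0X measure0. Qed.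

Let slab_ge0 J : 0 <= slab mA J. Proof. exact: measure_ge0. Qed.

Let slab_sigma_additive : semi_sigma_additive (slab mA).
Proof.
move=> F mF tF mUF; rewrite /slab.
rewrite (_ : _ `*` A = \bigcup_n (F n `*` A)); last first.
  apply/seteqP; split => [[x r] /= [[n _ Fn] Ar]|[x r] /= [n _ [Fn Ar]]].
    by exists n.
  by split=> //; exists n.
apply: measure_semi_sigma_additive.
- by move=> n; exact: measurableX.
- apply/trivIsetP => i j _ _ ij; move/trivIsetP : tF => /(_ i j I I ij) ij0.
  by rewrite -setXI ij0 set0X.
- by apply: bigcup_measurable => n _; exact: measurableX.
Qed.

HB.instance Definition _ := isMeasure.Build _ _ _ (slab mA)
  slab0 slab_ge0 slab_sigma_additive.

Let slab_fin : fin_num_fun (slab mA).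
Proof. by move=> J mJ; apply: fin_num_measure; exact: measurableX. Qed.

HB.instance Definition _ := Measure_isFinite.Build _ _ _ (slab mA) slab_fin.

End slab_measure.

Variable k : probability T R.
Hypothesis kE : forall J, measurable J -> k J = b (J `*` setT).

(** Radon-Nikodym densities for rays with rational ends. Each bound and each monotonicity relation
    holds almost everywhere; there are countably many, so one null set [N] collects all exceptions,
    and replacing the densities by [0] on [N] makes the relations hold everywhere. *)
Lemma conditional_cdf : exists H : rat -> T -> R,
  [/\ forall s, measurable_fun setT (H s),
      forall s x, (0 <= H s x <= 1)%R,
      forall s t x, (s <= t)%R -> (H s x <= H t x)%R &
      forall s J, measurable J ->
        \int[k]_(x in J) (H s x)%:E = b (J `*` [set r | (r <= ratr s)%R])].
Proof.
pose ray (s : rat) : set (measurableTypeR R) := [set r | (r <= ratr s)%R].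
have mray s : measurable (ray s).
  rewrite (_ : ray s = `]-oo, ratr s]%classic); first exact: measurable_itv.
  by apply/seteqP; split => x /=; rewrite in_itv.
pose bs s : {finite_measure set T -> \bar R} := slab (mray s).
have bsk s : charge_of_finite_measure (bs s) `<< k.
  apply/null_content_dominatesP => J mJ; rewrite /= kE// => bJ; apply/eqP.
  rewrite eq_le measure_ge0 andbT -bJ /= /slab.
  by apply: le_measure; rewrite ?inE; [exact: measurableX..|move=> z []].
pose h s := Radon_Nikodym (charge_of_finite_measure (bs s)) k.
have hI s : k.-integrable setT (h s) by apply: Radon_Nikodym_integrable; exact: bsk.
have hE s J : measurable J -> \int[k]_(x in J) h s x = b (J `*` ray s).
  by move=> mJ; rewrite /h -(Radon_Nikodym_integral (bsk s) mJ); reflexivity.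
have hfin s x : h s x \is a fin_num by apply: Radon_Nikodym_fin_num; exact: bsk.
have mh s : measurable_fun setT (h s) by exact: measurable_int (hI s).
have cI (c : R) : k.-integrable setT (cst c%:E).
  by apply: finite_measure_integrable_cst.
pose N := \bigcup_s ([set x | h s x < 0] `|` [set x | 1 < h s x] `|`
  \bigcup_(t in [set t : rat | (s <= t)%R]) [set x | h t x < h s x]).
have mlt f g : measurable_fun setT f -> measurable_fun setT g ->
    measurable [set x : T | f x < g x :> \bar R].
  by move=> mf mg; have := measurable_lte measurableT mf mg; rewrite setTI.
have mNt s : measurable
    (\bigcup_(t in [set t : rat | (s <= t)%R]) [set x | h t x < h s x]).
  by rewrite bigcup_mkcond; apply: bigcupT_measurable_rat => t; case: ifPn => // _; exact: mlt.
have mN : measurable N.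
  apply: bigcupT_measurable_rat => s; apply: measurableU => //.
  by apply: measurableU; apply: mlt => //; exact: measurable_cst.
have neg0 f g : k.-integrable setT f -> k.-integrable setT g ->
    (forall A, measurable A -> \int[k]_(x in A) f x <= \int[k]_(x in A) g x) ->
    k.-negligible [set x | g x < f x].
  move=> intf intg fg; apply/negligibleP; last exact: le_density.
  by apply: mlt; [exact: measurable_int intg|exact: measurable_int intf].
have kN : k N = 0.
  apply/negligibleP => //; apply: negligible_bigcup_count => s _.
  apply: negligibleU; [apply: negligibleU|].
  - apply: (neg0 (cst 0) (h s)); [exact: (cI 0%R)|exact: hI|move=> A mA].
    by rewrite hE// integral0 measure_ge0.
  - apply: (neg0 (h s) (cst 1)); [exact: hI|exact: (cI 1%R)|move=> A mA].
    rewrite hE// integral_cst// mul1e.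
    apply: (@le_trans _ _ (b (A `*` setT))); last by rewrite -kE.
    by apply: le_measure; rewrite ?inE; [exact: measurableX..|move=> z []].
  - apply: negligible_bigcup_count => t st; apply: neg0 => // A mA.
    rewrite !hE//; apply: le_measure; rewrite ?inE; [exact: measurableX..|].
    move=> z [Az /= /le_trans zs]; split => //; apply: zs.
    by rewrite ler_rat.
pose H s x := if x \in N then 0%R else fine (h s x).
have mH s : measurable_fun setT (H s).
  apply: measurable_fun_ifT => //.
    apply: (measurable_fun_bool true).
    rewrite setTI (_ : _ @^-1` _ = N)//.
    by apply/seteqP; split => x; [move/set_mem|move/mem_set].
  exact: measurableT_comp.
exists H; split => //.
- move=> s x; rewrite /H; case: ifPn => [_|]; first by rewrite lexx ler01.
  rewrite notin_setE => nN; rewrite fine_ge0 /=; last first.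
    by rewrite leNgt; apply/negP => h0; apply: nN; exists s => //; left; left.
  rewrite -lee_fin fineK// leNgt; apply/negP => h1.
  by apply: nN; exists s => //; left; right.
- move=> s t x st; rewrite /H; case: ifPn => //; rewrite notin_setE => nN.
  rewrite fine_le// leNgt; apply/negP => ts; apply: nN; exists s => //; right.
  by exists t.
- move=> s J mJ; rewrite -hE//; apply: ae_eq_integral => //.
  + by apply: measurable_funTS; exact: measurableT_comp.
  + exact: measurable_funTS.
  + exists N; split => // x /= /not_implyP[_].
    by rewrite /H; case: ifPn => [/set_mem//|_]; rewrite fineK.
Qed.
End disintegration.

Lemma image_probability d d' (S : measurableType d) (T : measurableType d')
    (R : realType) (P : probability S R) (f : S -> T) :
  measurable_fun setT f ->
  exists Q : probability T R, forall A, Q A = P (f @^-1` A).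
Proof.
move=> mf; pose F : {mfun S >-> T} := HB.pack f (isMeasurableFun.Build _ _ _ _ f mf).
by exists (distribution P F).
Qed.

Section conditional_quantile.
Context d (T : measurableType d) (R : realType).
Local Open Scope ereal_scope.

Local Notation U := (uniform_prob (@ltr01 R) : probability (measurableTypeR R) R).

Lemma uniform_prob_ray (h : R) : (0 <= h <= 1)%R ->
  U [set x | (x <= h)%R] = h%:E.
Proof.
move=> /andP[h0 h1]; rewrite /= /uniform_prob integral_uniform_pdf.
rewrite (_ : _ `&` _ = `[0%R, h]%classic); last first.
  apply/seteqP; split => x /=; rewrite !in_itv /=; first by move=> [-> /andP[->]].
  by move=> /andP[-> xh]; split => //; rewrite (le_trans xh h1).
rewrite (eq_integral (cst 1)); last first.
  move=> x; rewrite inE /= in_itv /= /uniform_pdf => /andP[-> xh].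
  by rewrite (le_trans xh h1) subr0 invr1.
rewrite integral_cst//= mul1e lebesgue_measure_itv /= lte_fin.
case: ltP => h0'; first by rewrite sube0.
by congr EFin; apply/eqP; rewrite eq_le h0 h0'.
Qed.

(** The rays generate the sets [B] of the second factor. A rectangle over [J] and [B] is then the
    intersection of the strip over [setT] and [B] with the union of the sets over [J] and the rays
    ending at [n]. *)
Lemma prod_ray_generated :
  @measurable _ (T * measurableTypeR R)%type = <<s [set J `*` `]-oo, t[%classic |
    J in @measurable _ T & t in [set: R]] >>.
Proof.
set G := [set _ | _ in _ & _ in _].
rewrite eqEsubset; split; last first.
  apply: smallest_sub; first exact: sigma_algebra_measurable.
  by move=> _ [J mJ [t _ <-]]; exact: measurableX.
have GG : sigma_algebra setT <<s G >> by exact: smallest_sigma_algebra.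
have TB (B : set (measurableTypeR R)) : measurable B -> <<s G >> (setT `*` B).
  rewrite RGenInftyO.measurableE => mB.
  suff : <<s (@RGenInftyO.G R) >> `<=` [set B | <<s G >> (setT `*` B)] by apply.
  apply: smallest_sub; last first.
    by move=> _ [t ->]; apply: sub_sigma_algebra; exists setT => //; exists t.
  have [G0 GD GU] := GG; split => /=.
  - by rewrite setX0.
  - move=> B' GB'; rewrite setTD (_ : _ `*` _ = setT `\` (setT `*` B')).
      exact: GD.
    by apply/seteqP; split => -[x y] /=; [move=> [_ ?]; split=> // -[]|move=> [_ H]; split=> // ?; apply: H].
  - move=> F GF; rewrite (_ : _ `*` _ = \bigcup_n (setT `*` F n)); first exact: GU.
    by apply/seteqP; split => -[x y] /=; [move=> [_ [n _ ?]]; exists n|move=> [n _ [_ ?]]; split=> //; exists n].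
rewrite measurable_prod_measurableType; apply: smallest_sub => // _ [J mJ [B mB <-]].
rewrite (_ : _ `*` _ = (setT `*` B) `&` (\bigcup_n (J `*` `]-oo, (n%:R : R)[%classic))); last first.
  apply/seteqP; split => -[x y] /=.
    move=> [Jx By]; split => //; exists (Num.truncn `|y|).+1 => //.
    split => //=; rewrite in_itv /=.
    by rewrite (le_lt_trans (ler_norm y))// truncnS_gt.
  by move=> [[_ By] [n _ [Jx _]]].
pose M : measurableType _ := g_sigma_algebraType G.
apply: (@measurableI _ M); first exact: TB.
apply: (@bigcupT_measurable _ M) => n; apply: sub_sigma_algebra.
by exists J => //; exists n%:R.
Qed.

Variables (b : probability (T * measurableTypeR R)%type R) (k : probability T R).
Hypothesis kE : forall J, measurable J -> k J = b (J `*` setT).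

(** Inverse transform sampling with a parameter: for a uniform [u], the least [s] with [u <= H s x]
    has the conditional law of the second coordinate given [x]. The two laws are compared on the
    strips that generate the product. *)
Lemma conditional_quantile : b (setT `*` `[0%R, 2%R]%classic) = 1 ->
  exists2 q : T * measurableTypeR R -> measurableTypeR R, measurable_fun setT q &
    forall E, measurable E -> (k \x U) [set x | E (x.1, q x)] = b E.
Proof.
move=> b1; have [H [mH H01 Hmon HE]] := conditional_cdf kE.
(* The bound [-1] keeps the set bounded below and the rationals from [2] on keep it nonempty, as
   [inf] requires. Both lie outside [[0, 2]], which carries [b], so the law is not affected. *)
pose S (x : T * R) : set R := [set s | exists p : rat,
  [/\ s = ratr p, (-1 <= s)%R & (x.2 <= H p x.1)%R \/ (2 <= s)%R]].
pose q (x : T * measurableTypeR R) : measurableTypeR R := inf (S x).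
have S2 x : S x 2%R.
  by exists (2%:R)%R; split; [rewrite ratr_nat| |right] => //; lra.
have lbS x : has_lbound (S x) by exists (-1)%R => s [p []].
have qlt x t : (q x < t)%R <-> exists p : rat,
    [/\ (ratr p < t)%R, (-1 <= ratr p :> R)%R & (x.2 <= H p x.1)%R \/ (2 <= ratr p :> R)%R].
  split => [/inf_lt[|_ [p [-> p1 p2]] pt]|[p [pt p1 p2]]].
  - by exists 2%R.
  - by exists p.
  - by apply: le_lt_trans pt; apply: ge_inf => //; exists p.
have mHp p : measurable [set x : T * measurableTypeR R | (x.2 <= H p x.1)%R].
  have := @measurable_lee _ (T * measurableTypeR R)%type R setT measurableT (EFin \o snd)
    (EFin \o (H p \o fst)).
  rewrite setTI; apply => //; first by apply: measurableT_comp => //; exact: measurable_snd.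
  apply: measurableT_comp => //; apply: measurableT_comp => //; exact: measurable_fst.
have mq : measurable_fun setT q.
  apply: (measurability _ (RGenInftyO.measurableE R)) => //.
  move=> _ [_ [t ->] <-]; rewrite setTI.
  rewrite (_ : _ @^-1` _ = \bigcup_p (if (ratr p < t)%R && (-1 <= ratr p :> R)%R
     then [set x : T * measurableTypeR R | (x.2 <= H p x.1)%R] `|`
          (if (2 <= ratr p :> R)%R then setT else set0) else set0)).
    apply: bigcupT_measurable_rat => p; case: ifPn => // _.
    by apply: measurableU => //; case: ifPn.
  apply/seteqP; split => x /=; rewrite in_itv /=.
    move=> /qlt[p [pt p1 p2]]; exists p => //; rewrite pt p1 /=.
    by case: p2 => [?|->]; [left|right].
  move=> [p _]; case: ifPn => // /andP[pt p1] xp; apply/qlt; exists p; split => //.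
  by case: xp; [left|case: ifPn => // *; right].
exists q => //.
have mg : measurable_fun setT (fun x : T * measurableTypeR R => (x.1, q x)).
  by apply/measurable_fun_pair => //; exact: measurable_fst.
have [Q QE] := image_probability (k \x U : probability _ R) mg.
suff QEE E : measurable E -> Q E = b E by move=> E mE; rewrite -QEE// QE.
apply: (@measure_unique _ R (T * measurableTypeR R)%type _
  (fun n => setT `*` `]-oo, (n%:R : R)[%classic) prod_ray_generated _ _ _ Q b).
- move=> _ _ [J mJ [t _ <-]] [J' mJ' [t' _ <-]]; rewrite -setXI.
  exists (J `&` J'); first exact: measurableI.
  exists (Num.min t t') => //; congr (_ `*` _); apply/seteqP.
  by split => r /=; rewrite !in_itv /= lt_min => /andP.
- by move=> n; exists setT => //; exists n%:R.
- apply/seteqP; split => // -[x y] _; exists (Num.truncn `|y|).+1 => //.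
  split => //=; rewrite in_itv /=.
  by rewrite (le_lt_trans (ler_norm y))// truncnS_gt.
- move=> _ [J mJ [t _ <-]]; apply: (eq_trans (QE _)).
  set A := _ @^-1` _; set C := setT `*` `[0%R, 2%R]%classic in b1.
  have mC : measurable C by exact: measurableX.
  have bnC B : measurable B -> B `&` C = set0 -> b B = 0.
    move=> mB BC; apply/eqP; rewrite eq_le measure_ge0 andbT.
    have <- : b (~` C) = 0 by rewrite probability_setC// b1 subee.
    apply: le_measure; rewrite ?inE//; first exact: measurableC.
    by move=> x Bx Cx; have : (B `&` C) x by []; rewrite BC.
  have mJt : measurable (J `*` `]-oo, t[%classic : set (T * measurableTypeR R)).
    exact: measurableX.
  (* For [b], a strip ending beyond [2] is the full cylinder over [J] and a strip ending before [-1]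
     is null; [q] behaves likewise by the choice of [S]. *)
  have [t2|t2] := ltP 2%R t.
    have -> : A = J `*` setT.
      apply/seteqP; split => x /=; rewrite /A /= in_itv /=; first by case.
      move=> [Jx _]; split => //; apply/qlt.
      have /rat_in_itvoo[p] := t2; rewrite inE /= => /andP[p2 pt].
      exists p; split => //; first by rewrite (le_trans _ (ltW p2))//; lra.
      by right; exact: ltW.
    apply: (eq_trans (product_measure1E k U mJ measurableT)).
    apply: (eq_trans (congr1 (fun z => k J * z) (probability_setT U))).
    rewrite mule1; apply: (eq_trans (kE mJ)).
    have mJT : measurable (J `*` setT : set (T * measurableTypeR R)) by exact: measurableX.
    apply: (eq_trans (measureDI b mJT mJt)).
    have B0 : b ((J `*` setT) `\` (J `*` `]-oo, t[%classic)) = 0.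
      apply: bnC; first exact: measurableD.
      apply/seteqP; split => // x [] [[Jx _]] H1 [_ /=]; rewrite in_itv /= => /andP[_ x2].
      by apply: H1; split => //=; rewrite in_itv /= (le_lt_trans x2).
    apply: (eq_trans (congr1 (fun z => z + _) B0)); rewrite add0e; congr (b _).
    by apply/seteqP; split => x /=; [move=> []|move=> [? ?]].
  have [t1|t1] := leP t (-1)%R.
    have -> : A = set0.
      apply/seteqP; split => // x /=; rewrite /A /= in_itv /= => -[_].
      move=> /qlt[p [pt p1 _]].
      by have := le_lt_trans p1 (lt_le_trans pt t1); rewrite ltxx.
    rewrite measure0; apply/esym/bnC => //; apply/seteqP; split => // x [] [_] /=; rewrite in_itv /=.
    move=> xt [_ /=]; rewrite in_itv /= => /andP[x0 _].
    by have := le_lt_trans x0 (lt_le_trans xt t1); rewrite oppr_gt0 ltr10.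
  (* An increasing sequence from [-1] to [t]. Rationals [s n] between its consecutive terms increase
     to [t], and both measures are continuous from below along them. *)
  pose tn (n : nat) : R := (t - (t + 1) / n.+1%:R)%R.
  have tn1 n : (tn n < tn n.+1)%R.
    by rewrite /tn ltrD2l ltrN2 ltr_pM2l ?ltf_pV2 ?posrE ?ltr_nat//; lra.
  have tnt n : (tn n < t)%R by rewrite /tn ltrBlDr ltrDl divr_gt0//; lra.
  have tnge n : (-1 <= tn n)%R.
    have : ((t + 1) / n.+1%:R <= t + 1)%R.
      by rewrite ler_pdivrMr// ler_peMr ?ler1n//; lra.
    by rewrite /tn => y1; rewrite lerBrDr -lerBrDl opprK.
  have /choice[s sP] : forall n, exists p : rat, (tn n < ratr p < tn n.+1)%R.
    by move=> n; have /rat_in_itvoo[p] := tn1 n; rewrite inE /= => ?; exists p.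
  have s_nd n m : (n <= m)%N -> (s n <= s m)%R.
    move=> nm; rewrite -(subnK nm); elim: (m - n)%N => // i ih.
    rewrite addSn (le_trans ih)// -(ler_rat R).
    have /andP[_ a] := sP (i + n)%N; have /andP[c _] := sP (i + n).+1%N.
    by rewrite (le_trans (ltW a) (ltW c)).
  have s_cof r : (r < t)%R -> exists n, (r < ratr (s n))%R.
    move=> rt; exists (Num.truncn ((t + 1) / (t - r))).
    set n := Num.truncn _; have /andP[a _] := sP n.
    apply: le_lt_trans a; rewrite /tn lerBrDr -lerBrDl.
    rewrite ler_pdivrMr// mulrC -ler_pdivrMr ?subr_gt0//.
    by rewrite ltW// truncnS_gt.
  pose F n : set (T * measurableTypeR R) :=
    (J `*` setT) `&` [set x | (x.2 <= H (s n) x.1)%R].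
  have mF n : measurable (F n) by apply: measurableI => //; exact: measurableX.
  have AF : A = \bigcup_n F n.
    apply/seteqP; split => x; rewrite /A /= in_itv /=.
      move=> [Jx /qlt[p [pt p1 [xp|]]]]; last first.
        by move=> p2; have := le_lt_trans p2 (lt_le_trans pt t2); rewrite ltxx.
      have [n pn] := s_cof _ pt; exists n => //; split => //=.
      by apply: le_trans xp _; apply: Hmon; rewrite ltr_rat in pn; exact: ltW.
    move=> [n _ [[Jx _] /= xn]]; split => //; apply/qlt; exists (s n).
    have /andP[a c] := sP n; split; [apply: lt_trans (tnt _); exact: c| |by left].
    by rewrite (le_trans (tnge n))// ltW.
  have JF : J `*` `]-oo, t[%classic =
      \bigcup_n (J `*` [set r : measurableTypeR R | (r <= ratr (s n))%R]).
    apply/seteqP; split => -[x r] /=; rewrite in_itv /=.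
      by move=> [Jx /s_cof[n /ltW rn]]; exists n.
    move=> [n _ [Jx /= rn]]; split => //; apply: le_lt_trans rn _.
    by have /andP[_ c] := sP n; apply: lt_trans (tnt _); exact: c.
  have mJF n : measurable (J `*` [set r : measurableTypeR R | (r <= ratr (s n))%R]).
    apply: measurableX => //.
    rewrite (_ : [set _ | _] = `]-oo, ratr (s n)]%classic); first exact: measurable_itv.
    by apply/seteqP; split => x /=; rewrite in_itv.
  have FE n : (k \x U) (F n) = b (J `*` [set r | (r <= ratr (s n))%R]).
    rewrite -HE// /product_measure1 [RHS]integral_mkcond.
    apply: eq_integral => x _ /=; rewrite patchE.
    case: ifPn => xJ.
      rewrite -[RHS](uniform_prob_ray (H01 (s n) x)); congr (U _).
      by apply/seteqP; split => y; rewrite /xsection /= inE; [move=> []|move=> ?; split => //=; split => //; exact/set_mem].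
    rewrite (_ : xsection _ _ = set0) ?measure0//.
    apply/seteqP; split => // y; rewrite /xsection /= inE => -[[/= /mem_set]].
    by rewrite (negbTE xJ).
  have cF : (k \x U : probability _ R) \o F @ \oo --> (k \x U) A.
    rewrite AF; apply: nondecreasing_cvg_mu => //; first exact: bigcupT_measurable.
    move=> n m nm; apply/subsetPset => x [Jx /= xn]; split => //=.
    by apply: le_trans xn _; apply: Hmon; exact: s_nd.
  have cb : (fun n => b (J `*` [set r | (r <= ratr (s n))%R])) @ \oo -->
      b (J `*` `]-oo, t[%classic).
    rewrite JF; apply: nondecreasing_cvg_mu => //; first exact: bigcupT_measurable.
    move=> n m nm; apply/subsetPset => -[x r] [Jx /= xn]; split => //=.
    by apply: le_trans xn _; rewrite ler_rat; exact: s_nd.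
  apply: (cvg_unique _ cF); first exact: ereal_hausdorff.
  by rewrite (_ : _ \o F = fun n => b (J `*` [set r | (r <= ratr (s n))%R]))//; apply/funext => n; exact: FE.
- by move=> n; rewrite (le_lt_trans (probability_le1 _ _))// ?ltry//; exact: measurableX.
Qed.

End conditional_quantile.

(** * Compactness and geodesics *)

Section ultrafilters.

Lemma ultra_bigcup (T : Type) (I : eqType) (F : set_system T) (s : seq I)
    (B : I -> set T) : UltraFilter F ->
  F [set x | exists2 i, i \in s & B i x] -> exists2 i, i \in s & F (B i).
Proof.
move=> FU; elim: s => [|i s ih] Fs.
  by exfalso; apply: (@filter_not_empty _ F _); apply: filterS Fs => x [].
have [Fi|Fi] := in_ultra_setVsetC (B i) FU; first by exists i; rewrite ?mem_head.
have [|j js Fj] := ih; last by exists j; rewrite // in_cons js orbT.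
apply: filterS (filterI Fs Fi) => x [[j]]; rewrite in_cons => /orP[/eqP ->//|].
by move=> js Bj _; exists j.
Qed.

Lemma ultra_nat : exists2 U : set_system nat, UltraFilter U & \oo `<=` U.
Proof. by have [U [UU sU]] := ultraFilterLemma eventually_filter; exists U. Qed.

Lemma ultra_lim (I : Type) (T : topologicalType) (K : set T) (F : set_system I)
    (u : I -> T) : UltraFilter F -> compact K -> F (u @^-1` K) ->
  exists2 l, K l & u @ F --> l.
Proof.
move=> FU; rewrite compact_ultra => cK FK.
by have [l [Kl Fl]] := cK (u @ F) (ultra_fmap _ FU) FK; exists l.
Qed.

Lemma ultra_lim_real (R : realType) (I : Type) (F : set_system I) (u : I -> R)
    (b : R) : UltraFilter F -> F [set i | `|u i| <= b] ->
  exists l : R, u @ F --> l.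
Proof.
move=> FU Fb; have [||l _ ul] := @ultra_lim _ _ `[- b, b]%classic F u FU.
- exact: segment_compact.
- by apply: filterS Fb => i /=; rewrite /preimage /= in_itv /= ler_norml.
- by exists l.
Qed.

End ultrafilters.

Section metric.
Context {R : realType} (X : metricType R).
Local Notation d := (@mdist R X).

Lemma ballE (p : X) (r : R) : ball p r = [set q | d p q < r].
Proof. exact: ballEmdist. Qed.

Lemma nbhs_mdist (p : X) (e : R) : 0 < e -> \forall q \near p, d p q < e.
Proof. move=> e0; have := nbhsx_ballx p e e0; apply: filterS => q.
by rewrite ballE. Qed.

Lemma mdist_lipschitz (p q q' : X) : `|d p q - d p q'| <= d q q'.
Proof.
have := metric_triangle p q q'; have := metric_triangle p q' q.
by rewrite (metric_sym q' q) ler_norml => h1 h2; apply/andP; split; lra.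
Qed.

Lemma mdist_quadrangle (p q p' q' : X) :
  `|d p q - d p' q'| <= d p p' + d q q'.
Proof.
have := metric_triangle p p' q; have := metric_triangle p' q' q.
have := metric_triangle p' p q'; have := metric_triangle p q q'.
rewrite (metric_sym p' p) (metric_sym q' q) ler_norml => ? ? ? ?.
by apply/andP; split; lra.
Qed.

Lemma mdist_continuous (p : X) : continuous (d p).
Proof.
move=> q; apply/cvgrPdist_lt => e e0.
by near=> r; apply: le_lt_trans (mdist_lipschitz _ _ _) _; near: r; exact: nbhs_mdist.
Unshelve. all: by end_near. Qed.

Lemma mdist_cvg (I : Type) (F : set_system I) {FF : Filter F} (u v : I -> X) p q :
  u @ F --> p -> v @ F --> q -> (fun i => d (u i) (v i)) @ F --> d p q.
Proof.
move=> up vq; apply/cvgrPdist_lt => e e0; have e20 : 0 < e / 2 by rewrite divr_gt0.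
near=> i; apply: le_lt_trans (mdist_quadrangle _ _ _ _) _; rewrite [e]splitr ltrD//.
  by near: i; exact: (metricType_numDomainType.cvgr_dist_lt up).
by near: i; exact: (metricType_numDomainType.cvgr_dist_lt vq).
Unshelve. all: by end_near. Qed.

Lemma cball_closed (p : X) (r : R) : closed (cball p r).
Proof.
apply: (@closed_comp _ _ (d p) [set s | s <= r]); last exact: closed_le.
by move=> q _; exact: mdist_continuous.
Qed.

Lemma mball_open (p : X) (r : R) : open (ball p r : set X).
Proof.
rewrite ballE; apply: (@open_comp _ _ (d p) [set s | s < r]); last exact: open_lt.
by move=> q _; exact: mdist_continuous.
Qed.

(** An ultrafilter containing a finite union of balls contains one of them; this holds at every
    radius, so it is Cauchy. *)
Lemma totally_bounded_compact (A : set X) : complete_space X -> closed A ->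
  (forall e, 0 < e -> exists s : seq X,
    forall q, A q -> exists2 p, p \in s & d p q <= e) -> compact A.
Proof.
move=> cX cA tA; rewrite compact_ultra => F FU FA.
have [l Fl] : exists l : X, F --> l.
  apply: cX; apply: cauchy_exP => e e0.
  have [|s sP] := tA (e / 2); first by rewrite divr_gt0.
  have [|p _ Fp] := @ultra_bigcup _ _ F s (fun p => cball p (e / 2)) FU.
    by apply: filterS FA => q /sP[p ps pq]; exists p.
  exists p; apply: filterS Fp => q pq; rewrite ballE /=.
  by apply: le_lt_trans pq _; rewrite ltr_pdivrMr// ltr_pMr// ltr1n.
by exists l; split => //; apply: (@closed_cvg _ _ F _ id A cA) => //.
Qed.

Lemma compact_totally_bounded (A : set X) (e : R) : 0 < e -> compact A ->
  exists s : seq X, (forall q, q \in s -> A q) /\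
    forall q, A q -> exists2 p, p \in s & d p q < e.
Proof.
have [->|/set0P[p0 Ap0]] := eqVneq A set0; first by exists [::].
pose XP : ptopologicalType := HB.pack (Metric.sort X) (isPointed.Build _ p0).
move=> e0 cA; have : @compact XP A by exact: cA.
rewrite compact_cover => /(_ XP A (fun p => ball (p : X) e)).
case=> [p _|q Aq|D DA AD]; first exact: mball_open.
  by exists q => //; exact: ballxx.
exists (finmap.enum_fset D); split => [q qD|q /AD[p pD]].
  by apply/set_mem; exact: DA.
by rewrite ballE; exists p.
Qed.

End metric.

Section hopf_rinow.
Context {R : realType} (X : metricType R).
Local Notation d := (@mdist R X).

Definition proper_space := forall (p : X) (r : R), compact (cball p r).

Lemma locally_compact_cball : locally_compact [set: X] ->
  forall p : X, exists2 r : R, 0 < r & compact (cball p r).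
Proof.
move=> lcX p; have [U pU [cU clU]] := lcX p I.
have /nbhs_ballP[e /= e0 eU] : nbhs p U.
  have pU' : nbhs p [set q | [set: X] q -> U q] := pU.
  by apply: filterS pU' => q; apply.
exists (e / 2); first by rewrite divr_gt0.
apply: (subclosed_compact _ cU); first exact: cball_closed.
move=> q pq; apply: eU; rewrite ballE /=; apply: le_lt_trans pq _.
by rewrite ltr_pdivrMr// ltr_pMr// ltr1n.
Qed.

(** A curve of length below [d p q + e] crosses the sphere of radius [s] around [p], and cutting it
    there into two pieces bounds what remains up to [q]. *)
Lemma length_between : length_space X -> forall (p q : X) (s e : R),
  0 <= s <= d p q -> 0 < e -> exists2 z, d p z <= s & d z q <= d p q - s + e.
Proof.
move=> lX p q s e /andP[s0 sl] e0.
(* At the two extreme values the crossing time could be [0] or [1], which is not an inner point of a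
   partition. *)
have [->|sN0] := eqVneq s 0.
  by exists p; rewrite ?mdistxx ?subr0//; lra.
have [->|sNl] := eqVneq s (d p q).
  by exists q; rewrite ?mdistxx//; lra.
have : (ereal_inf [set curve_length c | c in [set c : R -> X |
      [/\ {within `[0%R, 1%R], continuous c}, c 0%R = p & c 1%R = q]]] < (d p q + e)%:E)%E.
  by rewrite -lX lte_fin ltrDl.
move=> /ereal_inf_lt[_ [c [cc c0 c1] <-]] clt.
have cdc : {within `[0, 1], continuous (d p \o c)}.
  by apply: within_continuous_comp cc => z _; exact: mdist_continuous.
have [|t] := IVT (v := s) ler01 cdc.
  by rewrite /= c0 c1 mdistxx (min_idPl (mdist_ge0 _ _)) (max_idPr (mdist_ge0 _ _)) s0.
rewrite in_itv /= => /andP[t0 t1] ts.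
have tgt0 : 0 < t.
  by rewrite lt_neqAle t0 andbT; apply: contra_neq sN0 => t0'; rewrite -ts -t0' c0 mdistxx.
have tlt1 : t < 1.
  by rewrite lt_neqAle t1 andbT; apply: contra_neq sNl => t1'; rewrite -ts t1' c1.
exists (c t); first by rewrite ts.
suff : ((d p (c t) + d (c t) q)%:E <= curve_length c)%E.
  by move=> /le_lt_trans/(_ clt); rewrite lte_fin ts; lra.
apply: ereal_sup_ubound; exists [:: t; 1]; first by split => //=; rewrite tgt0 tlt1.
by rewrite /= big_nat_recl//= big_nat1 /= c0 c1.
Qed.

(** Let [rho] be the supremum of the radii of compact balls around [p]. Points of the ball of radius
    [rho] are close to a smaller compact ball, so it is totally bounded, hence compact. Compactness
    gives one radius [dlt] of compact balls around all its points, and finitely many of these cover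
    a ball larger than [rho] allows. *)
Lemma hopf_rinow : complete_space X -> locally_compact [set: X] ->
  length_space X -> proper_space.
Proof.
move=> cX lcX lX p r.
have sub a b (z : X) : a <= b -> compact (cball z b) -> compact (cball z a).
  move=> ab cb; apply: (subclosed_compact _ cb); first exact: cball_closed.
  by move=> q /le_trans; apply.
apply: contrapT => ncr.
pose S := [set a | compact (cball p a)].
have ubS : ubound S r.
  by move=> a Sa; rewrite leNgt; apply/negP => /ltW ra; apply: ncr; exact: sub Sa.
have [a a0 Sa] := locally_compact_cball lcX p.
have supS : has_sup S by split; [exists a|exists r].
pose rho := sup S.
have rho0 : 0 < rho by apply: lt_le_trans a0 _; apply: ub_le_sup => //; exact: supS.2.
have Slt b : b < rho -> S b.
  by move=> /(sup_gt supS.1)[b' Sb' bb']; apply: sub Sb'; exact: ltW.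
have Srho : compact (cball p rho).
  apply: totally_bounded_compact => //; first exact: cball_closed.
  move=> e e0; pose b := Num.max 0 (rho - e / 4).
  have b0 : 0 <= b by rewrite le_max lexx.
  have brho : b < rho by rewrite gt_max rho0 /=; lra.
  have be : rho - e / 4 <= b by rewrite le_max lexx orbT.
  have e40 : 0 < e / 4 by rewrite divr_gt0.
  have [s [_ sP]] := compact_totally_bounded e40 (Slt b brho).
  exists s => q pq; have [qb|bq] := leP (d p q) b.
    by have [z zs zq] := sP q qb; exists z => //; lra.
  have bpq : 0 <= b <= d p q by rewrite b0 ltW.
  have [z pz zq] := length_between lX bpq e40.
  have [z' z's z'z] := sP z pz; exists z' => //.
  have := metric_triangle z' z q; rewrite /cball /= in pq; lra.
have [dlt dlt0 cdlt] : exists2 dlt, 0 < dlt &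
    forall z, cball p rho z -> compact (cball z dlt).
  have := Srho; rewrite compact_near_coveringP.
  move=> /(_ R (0^'+) (fun e z => compact (cball z e)) _).
  case.
    move=> z _; have [e e0 ce] := locally_compact_cball lcX z.
    near=> z' e' => /=; apply: (subclosed_compact _ ce); first exact: cball_closed.
    move=> q /= z'q; rewrite /cball /=.
    have := metric_triangle z z' q.
    have : d z z' < e / 2 by near: z'; apply: nbhs_mdist; rewrite divr_gt0.
    have : e' < e / 2 by near: e'; apply: nbhs_right_lt; rewrite divr_gt0.
    by rewrite /cball /= in z'q; lra.
  move=> e /= e0 ce; exists (e / 2); first by rewrite divr_gt0.
  apply: ce; rewrite /= ?divr_gt0//.
  rewrite sub0r normrN gtr0_norm ?divr_gt0// ltr_pdivrMr// ltr_pMr//.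
  by rewrite ltr1n.
have : S (rho + dlt / 4).
  have dlt40 : 0 < dlt / 4 by rewrite divr_gt0.
  have [s [sK sP]] := compact_totally_bounded dlt40 Srho.
  have cU : compact (\big[setU/set0]_(z <- s) (if z \in s then cball z dlt else set0)).
    by apply: bigsetU_compact => z _; case: ifPn => [/sK/cdlt//|_]; exact: compact0.
  apply: (subclosed_compact _ cU); first exact: cball_closed.
  move=> q pq; rewrite -bigcup_seq.
  have [z pz zq] : exists2 z, cball p rho z & d z q <= dlt / 2.
    have [qr|rq] := leP (d p q) rho.
      by exists q; rewrite ?mdistxx// divr_ge0// ltW.
    have rpq : 0 <= rho <= d p q by rewrite ltW//= ltW.
    have [z pz zq] := length_between lX rpq dlt40.
    exists z => //; rewrite /cball /= in pq; lra.
  have [z' z's z'z] := sP z pz; exists z' => //; rewrite z's /cball /=.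
  have := metric_triangle z' z q; lra.
move=> /(ub_le_sup supS.2); rewrite -/rho; lra.
Unshelve. all: by end_near. Qed.

End hopf_rinow.

Section geodesics.
Context {R : realType} (X : metricType R).
Local Notation d := (@mdist R X).
Hypothesis pX : proper_space X.
Hypothesis lX : length_space X.

(** The total defect [f] attains its minimum on a compact ball, and the approximate points of
    [length_between] make it arbitrarily small. *)
Lemma exact_between (p q : X) (s : R) : 0 <= s <= d p q ->
  exists2 z, d p z = s & d z q = d p q - s.
Proof.
move=> /[dup] sl /andP[s0 s1].
pose f z := `|d p z - s| + `|d z q - (d p q - s)|.
have cf : continuous f.
  move=> z; apply: cvgD; apply: cvg_norm; apply: cvgB; try exact: cvg_cst.
    exact: mdist_continuous.
  under eq_fun do rewrite metric_sym.
  by rewrite (metric_sym z); exact: mdist_continuous.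
have [||z _ zmin] := @compact_EVT_min _ _ f (cball p (d p q)) _ (@pX p (d p q)).
- by exists p; rewrite /cball /= mdistxx mdist_ge0.
- exact: continuous_subspaceT.
have fz : f z <= 0.
  apply/ler_addgt0Pl => e e0; rewrite addr0.
  have e20 : 0 < e / 2 by rewrite divr_gt0.
  have [z' pz' z'q] := length_between lX sl e20.
  apply: (@le_trans _ _ (f z')); first by apply: zmin; apply/mem_set; exact: (le_trans pz').
  have := metric_triangle p z' q => h3; rewrite /f [leRHS]splitr lerD// ler_norml.
    by apply/andP; split; lra.
  by apply/andP; split; lra.
have := metric_triangle p z q => h3; exists z; apply/eqP; rewrite -subr_eq0 -normr_eq0.
  by rewrite eq_le normr_ge0 andbT (le_trans _ fz)// /f lerDl.
by rewrite eq_le normr_ge0 andbT (le_trans _ fz)// /f lerDr.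
Qed.

(** Each step of length [h] lowers the distance to [q] by exactly [h]; the triangle inequality then
    leaves no freedom for the distances inside the chain. *)
Lemma geodesic_chain (p q : X) (n : nat) : exists x : nat -> X,
  [/\ x 0 = p, x n.+1 = q & forall i j, (i <= j <= n.+1)%N ->
    d (x i) (x j) = (j - i)%:R * (d p q / n.+1%:R)].
Proof.
set h := d p q / n.+1%:R; have h0 : 0 <= h by rewrite divr_ge0 ?mdist_ge0.
have nh : n.+1%:R * h = d p q by rewrite mulrC divfK.
have /choice[f fP] : forall y, exists z, h <= d y q ->
    d y z = h /\ d z q = d y q - h.
  move=> y; have [hy|yh] := leP h (d y q); last by exists y.
  have hy' : 0 <= h <= d y q by rewrite h0.
  by have [z yz zq] := exact_between hy'; exists z.
pose x i := iter i f p.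
have xq i : (i <= n.+1)%N -> d (x i) q = d p q - i%:R * h.
  elim: i => [_|i ih ilt]; first by rewrite mul0r subr0.
  have ihi := ih (ltnW ilt); rewrite /x iterS -/(x i).
  have [|_ ->] := fP (x i); last by rewrite ihi -natr1 mulrDl mul1r; lra.
  rewrite ihi lerBrDr -nh -{1}[h]mul1r -mulrDl ler_wpM2r// nat1r ler_nat.
  exact: ilt.
have xx i : (i <= n)%N -> d (x i) (x i.+1) = h.
  move=> ilt; have [|-> _] := fP (x i) => //.
  rewrite xq ?(leq_trans ilt)// lerBrDr -nh -{1}[h]mul1r -mulrDl ler_wpM2r//.
  by rewrite nat1r ler_nat.
have xub i k : (i + k <= n.+1)%N -> d (x i) (x (i + k)%N) <= k%:R * h.
  elim: k => [_|k ih]; first by rewrite addn0 mdistxx mul0r.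
  rewrite addnS => ik; apply: le_trans (metric_triangle _ (x (i + k)%N) _) _.
  by rewrite -natr1 mulrDl mul1r lerD ?xx ?ih// ltnW.
exists x; split => //.
  apply/esym/mdist_positivity; rewrite metric_sym xq// nh; lra.
move=> i j /andP[ij jn]; apply/eqP; rewrite eq_le.
have := xub i (j - i)%N; rewrite subnKC// => /(_ jn) -> /=.
have := metric_triangle (x i) (x j) q.
by rewrite (xq i (leq_trans ij jn)) (xq j jn) natrB// mulrBl; lra.
Qed.

(** Defined on the whole line and constrained on [[0, L]] only, so that reparametrising and
    concatenating need no casts. *)
Definition unit_geodesic (L : R) (g : R -> X) :=
  forall s t : R, 0 <= s <= L -> 0 <= t <= L -> d (g s) (g t) = `|t - s|.

(** Step functions along chains of [n.+1] pieces preserve distances up to [L / n.+1%:R]. Their limit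
    along an ultrafilter exists at all times simultaneously and preserves distances exactly. *)
Lemma unit_geodesic_exists (p q : X) :
  exists g, [/\ unit_geodesic (d p q) g, g 0 = p & g (d p q) = q].
Proof.
set L := d p q; have [L0|LN0] := eqVneq L 0.
  exists (cst p); split => //; last exact: mdist_positivity L0.
  move=> s t; rewrite L0 => /andP[s0 s1] /andP[t0 t1].
  have -> : s = 0 by apply/eqP; rewrite eq_le s1.
  have -> : t = 0 by apply/eqP; rewrite eq_le t1.
  by rewrite mdistxx subrr normr0.
have L0 : 0 < L by rewrite lt_neqAle eq_sym LN0 mdist_ge0.
have /choice[x xP] := geodesic_chain p q.
pose k n (s : R) := Num.truncn (s * n.+1%:R / L).
pose g n s := x n (k n s).
have kP n (s : R) : 0 <= s <= L ->
    (k n s)%:R * (L / n.+1%:R) <= s < (k n s)%:R * (L / n.+1%:R) + L / n.+1%:R.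
  move=> /andP[s0 sL]; rewrite -[X in _ < _ + X]mul1r -mulrDl natr1.
  have n0 : 0 < n.+1%:R :> R by rewrite ltr0n.
  rewrite mulrA ler_pdivrMr// mulrA ltr_pdivlMr//.
  rewrite -ler_pdivlMr// -ltr_pdivrMr//.
  apply: truncn_itv; by rewrite !mulr_ge0 ?invr_ge0// ltW.
have kn n (s : R) : 0 <= s <= L -> (k n s <= n.+1)%N.
  move=> sL0; have /andP[ks _] := kP n s sL0; have /andP[_ sL] := sL0.
  have := le_trans ks sL; rewrite mulrCA ger_pMr//.
  by rewrite ler_pdivrMr ?ltr0n// mul1r ler_nat.
have gle n (s t : R) : 0 <= s <= L -> 0 <= t <= L ->
    `|d (g n s) (g n t) - `|t - s| | <= L / n.+1%:R.
  wlog st : s t / s <= t.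
    move=> hw sL tL; have [st|/ltW ts] := leP s t; first exact: hw.
    by rewrite metric_sym (distrC t) hw.
  move=> sL tL; have kst : (k n s <= k n t)%N.
    rewrite /k; apply: le_truncn.
    by rewrite ler_wpM2r ?invr_ge0 ?(ltW L0)// ler_wpM2r.
  have [_ _ xd] := xP n; pose h : R := L / n.+1%:R.
  pose A : R := (k n s)%:R * h; pose B : R := (k n t)%:R * h.
  have -> : d (g n s) (g n t) = B - A by rewrite /g xd ?kst ?kn// natrB// mulrBl.
  have /andP[a b] : A <= s < A + h by exact: kP.
  have /andP[a' b'] : B <= t < B + h by exact: kP.
  rewrite (ger0_norm (_ : 0 <= t - s)) ?subr_ge0// ler_norml -/h.
  by clearbody A B h; apply/andP; split; lra.
have [U UU sU] := ultra_nat.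
have gK n (s : R) : 0 <= s <= L -> cball p (2 * L) (g n s).
  move=> sL; have [x0 _ _] := xP n.
  have L00 : (0 : R) <= 0 <= L by apply/andP; split => //; exact: ltW.
  pose h : R := L / n.+1%:R.
  have hL : h <= L by rewrite ler_pdivrMr ?ltr0n// ler_pMr// ler1n.
  have : `|d p (g n s) - s| <= h.
    have := gle n 0 s L00 sL; have -> : g n 0 = p by rewrite /g /k !mul0r truncn0.
    by rewrite subr0 (ger0_norm (proj1 (andP sL))).
  move: sL; rewrite /cball /= ler_norml => /andP[? ?].
  by clearbody h => /andP[? ?]; lra.
have /choice[G GP] : forall s : R, exists l : X, 0 <= s <= L -> (g ^~ s) @ U --> l.
  move=> s; have [sL|?] := pselect (0 <= s <= L); last by exists p.
  have [||l _ ul] := @ultra_lim _ _ (cball p (2 * L)) U (g ^~ s) UU.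
  - exact: pX.
  - by apply: filterE => n; exact: gK.
  - by exists l.
have Geq (s : R) : 0 <= s <= L -> forall r, (forall n, g n s = r) -> G s = r.
  move=> sL r gr; apply: (cvg_unique _ (GP s sL)); first exact: metric_hausdorff.
  by rewrite (_ : g ^~ s = cst r); [exact: cvg_cst|apply/funext].
exists G; split.
- move=> s t sL tL.
  have c1 : (fun i => d (g i s) (g i t)) @ U --> d (G s) (G t).
    by apply: mdist_cvg; exact: GP.
  apply: (cvg_unique _ c1); first exact: Rhausdorff.
  apply/cvgrPdist_le => e e0; apply: sU.
  exists (Num.truncn (L / e)) => // n /= nle.
  rewrite distrC (le_trans (gle n s t sL tL))// ler_pdivrMr ?ltr0n//.
  rewrite mulrC -ler_pdivrMr//; apply: le_trans (ltW (truncnS_gt _)) _.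
  by rewrite ler_nat ltnS.
- apply: Geq; first by apply/andP; split => //; exact: ltW.
  by move=> n; rewrite /g /k !mul0r truncn0; have [] := xP n.
- apply: Geq; first by apply/andP; split => //; exact: ltW.
  move=> n; have [_ <- _] := xP n; congr (x n _).
  by rewrite /k mulrAC divff ?mul1r ?natrK// truncn_nat.
Qed.

(** A shortcut between a point of the first piece and one of the second would shorten the way
    between the two ends, whose distance is the full length. *)
Lemma unit_geodesic_cat (L1 L2 : R) (g h : R -> X) :
  0 <= L1 -> 0 <= L2 -> unit_geodesic L1 g -> unit_geodesic L2 h ->
  g L1 = h 0 -> d (g 0) (h L2) = L1 + L2 ->
  unit_geodesic (L1 + L2) (fun t => if t <= L1 then g t else h (t - L1)).
Proof.
move=> L10 L20 ug uh gh dgh s t.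
wlog st : s t / s <= t.
  move=> hw sL tL; have [st|/ltW ts] := leP s t; first exact: hw.
  by rewrite metric_sym (distrC t) hw.
move=> /andP[s0 sL] /andP[t0 tL].
rewrite (ger0_norm (_ : 0 <= t - s)) ?subr_ge0//.
case: (leP t L1) => tL1.
  by rewrite (le_trans st tL1) ug ?ger0_norm ?subr_ge0 ?s0 ?t0// (le_trans st).
case: (leP s L1) => sL1; last first.
  rewrite uh ?ger0_norm; [lra|lra|..]; by apply/andP; split; lra.
have ud (L : R) f (a b : R) : unit_geodesic L f -> 0 <= a -> a <= b -> b <= L ->
    d (f a) (f b) = b - a.
  by move=> uf a0 ab bL; rewrite uf ?ger0_norm ?subr_ge0// ?a0 ?(le_trans ab)// (le_trans a0).
have e1 : d (g 0) (g s) = s by rewrite (ud L1) ?subr0.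
have e2 : d (g s) (g L1) = L1 - s by rewrite (ud L1).
have e3 : d (h 0) (h (t - L1)) = t - L1 by rewrite (ud L2) ?subr0//; lra.
have e4 : d (h (t - L1)) (h L2) = L2 - (t - L1) by rewrite (ud L2)//; lra.
have := metric_triangle (g s) (h 0) (h (t - L1)).
have := metric_triangle (g 0) (g s) (h L2).
have := metric_triangle (g s) (h (t - L1)) (h L2).
rewrite gh in e2; move=> *; apply/eqP; rewrite eq_le; apply/andP; split; lra.
Qed.

Lemma unit_geodesic_through (p z q : X) : d p z + d z q = d p q ->
  exists g, [/\ unit_geodesic (d p q) g, g 0 = p, g (d p z) = z & g (d p q) = q].
Proof.
move=> pzq; have [g [ug g0 g1]] := unit_geodesic_exists p z.
have [h [uh h0 h1]] := unit_geodesic_exists z q.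
exists (fun t => if t <= d p z then g t else h (t - d p z)); rewrite lexx mdist_ge0 -pzq.
split => //.
- by apply: unit_geodesic_cat; rewrite ?mdist_ge0 ?g1 ?h0 ?g0 ?h1.
- have [|_] := leP; last by rewrite addrC addKr.
  rewrite gerDl => zq; have zq0 : d z q = 0 by apply/eqP; rewrite eq_le zq mdist_ge0.
  by rewrite zq0 addr0 g1; exact: mdist_positivity.
Qed.

End geodesics.

HB.instance Definition _ (R : realType) (S T : pseudoPMetricType R) :=
  Pointed.on (S * T)%type.

Section geo_compact.
Context {R : realType} (X : metricType R).
Local Notation d := (@mdist R X).

Lemma compact_sub_cball (A : set X) (p : X) : compact A ->
  exists r, A `<=` cball p r.
Proof.
move=> cA; have [->|/set0P A0] := eqVneq A set0; first by exists 0.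
have [|q _ qmax] := @compact_EVT_max _ _ (d p) A A0 cA.
  by apply: continuous_subspaceT; exact: mdist_continuous.
by exists (d p q) => z Az; apply: qmax; exact/mem_set.
Qed.

(** Pointwise limits along an ultrafilter have constant speed again. The speeds are bounded by [M],
    so closeness at the finitely many times of a grid of mesh [1 / n.+1%:R] gives uniform
    closeness. *)
Lemma geo_compact (A B : set X) : proper_space X -> compact A -> compact B ->
  compact [set g : Geo X | A (g 0%:i01) /\ B (g 1%:i01)].
Proof.
move=> pX cA cB; rewrite compact_ultra => F FU FS.
have [i0 i0E] : exists i : {i01 R}, i = 0%:i01 by exists 0%:i01.
have [g0 [Ag0 Bg0]] : exists g : Geo X, A (g 0%:i01) /\ B (g 1%:i01).
  exact: filter_ex FS.
move: (g0 _) (g0 _) Ag0 Bg0 => q p Ap Bq.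
have [rA Ar] := compact_sub_cball p cA; have [rB Br] := compact_sub_cball p cB.
pose M := rA + rB.
have M0 : 0 <= M.
  by rewrite addr_ge0// (le_trans (mdist_ge0 _ _) (Ar _ Ap), le_trans (mdist_ge0 _ _) (Br _ Bq)).
have FM : F [set g : Geo X | d (g 0%:i01) (g 1%:i01) <= M /\ A (g 0%:i01)].
  apply: filterS FS => g [Ag Bg]; split => //.
  move: (Ar _ Ag) (Br _ Bg); rewrite /cball /=; move: (g _) (g _) => b a pa pb.
  by apply: le_trans (metric_triangle a p b) _; rewrite (metric_sym a p) lerD.
have /choice[l lP] : forall t : {i01 R}, exists l : X, (fun g : Geo X => g t) @ F --> l.
  move=> t; have [||l _ ?] := @ultra_lim _ _ (cball p (rA + M)) F (fun g : Geo X => g t) FU.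
  - exact: pX.
  - apply: filterS FM => g [gM Ag]; rewrite /preimage /cball /=.
    apply: le_trans (metric_triangle _ (g i0) _) _; rewrite i0E.
    apply: lerD; first exact: Ar.
    rewrite geo_speed subr0 (le_trans _ gM)// ler_piMl ?mdist_ge0//.
    by rewrite ger0_norm.
  - by exists l.
have lspeed s t : d (l s) (l t) = `|t%:num - s%:num| * d (l 0%:i01) (l 1%:i01).
  have c1 : (fun g : Geo X => d (g s) (g t)) @ F --> d (l s) (l t).
    by apply: mdist_cvg; exact: lP.
  apply: (cvg_unique _ c1); first exact: Rhausdorff.
  have -> : (fun g : Geo X => d (g s) (g t)) =
      (fun g => `|t%:num - s%:num| * d (g 0%:i01) (g 1%:i01)).
    by apply/funext => g; exact: geo_speed.
  apply: cvgM; first exact: cvg_cst.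
  by apply: mdist_cvg; exact: lP.
pose gl := MkGeo lspeed.
have lM : d (gl 0%:i01) (gl 1%:i01) <= M.
  have c1 : (fun g : Geo X => d (g 0%:i01) (g 1%:i01)) @ F --> d (gl 0%:i01) (gl 1%:i01).
    by apply: mdist_cvg; exact: lP.
  apply: (@closed_cvg _ _ F _ _ [set r | r <= M] _ _ _ c1); first exact: closed_le.
  by apply: filterS FM => g [].
have cAl : closed A by apply: compact_closed => //; exact: metric_hausdorff.
have cBl : closed B by apply: compact_closed => //; exact: metric_hausdorff.
exists gl; split.
  split.
    by apply: (@closed_cvg _ _ F _ _ A cAl _ _ (lP _)); apply: filterS FS => g [].
  by apply: (@closed_cvg _ _ F _ _ B cBl _ _ (lP _)); apply: filterS FS => g [].
apply/metricType_numDomainType.fcvgrPdist_lt => e e0.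
pose n := Num.truncn (4 * M / e); pose h : R := M / n.+1%:R.
have n0 : 0 < n.+1%:R :> R by rewrite ltr0n.
have he : h <= e / 4.
  rewrite ler_pdivrMr// mulrC -ler_pdivrMr ?divr_gt0// invf_div mulrA (mulrC M).
  by rewrite ltW// truncnS_gt.
have grid_itv i : (i <= n.+1)%N -> (0 <= i%:R / n.+1%:R :> R) * (i%:R / n.+1%:R <= 1 :> R).
  by move=> ilt; rewrite divr_ge0//; split => //; rewrite ler_pdivrMr// mul1r ler_nat.
pose grid i : {i01 R} := if @idP (i <= n.+1)%N is ReflectT ilt
  then Itv01 (grid_itv i ilt).1 (grid_itv i ilt).2 else i0.
have gridE i : (i <= n.+1)%N -> (grid i)%:num = i%:R / n.+1%:R.
  by move=> ilt; rewrite /grid; case: {-}_ / idP.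
have near_grid m : F [set g : Geo X | forall i, (i <= m)%N -> d (gl (grid i)) (g (grid i)) < e / 4].
  have near1 i : F [set g : Geo X | d (gl (grid i)) (g (grid i)) < e / 4].
    by apply: (metricType_numDomainType.cvgr_dist_lt (lP (grid i))); rewrite divr_gt0.
  elim: m => [|m ih].
    by apply: filterS (near1 0) => g ? i; rewrite leqn0 => /eqP ->.
  apply: filterS (filterI ih (near1 m.+1)) => g [h1 h2] i.
  by rewrite leq_eqVlt => /orP[/eqP ->//|]; exact: h1.
apply: filterS (filterI FM (near_grid n.+1)) => g [[gM _] gn].
apply: (@le_lt_trans _ _ (3 * (e / 4))); last by lra.
apply: geo_dist_le => t; pose i := Num.truncn (t%:num * n.+1%:R).
have tn0 : 0 <= t%:num * n.+1%:R :> R by rewrite mulr_ge0.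
have /andP[ia ib] : (i%:R : R) <= t%:num * n.+1%:R < i.+1%:R by exact: truncn_itv.
have ilt : (i <= n.+1)%N.
  have : i%:R <= n.+1%:R :> R.
    by apply: le_trans ia _; rewrite ger_pMl.
  by rewrite ler_nat.
have tgrid (k : Geo X) : d (k 0%:i01) (k 1%:i01) <= M -> d (k t) (k (grid i)) <= e / 4.
  move=> kM; rewrite geo_speed gridE//; apply: le_trans he.
  rewrite /h mulrC ler_pM ?mdist_ge0//.
  rewrite distrC ger0_norm; last by rewrite subr_ge0 ler_pdivrMr.
  rewrite lerBlDl -[X in _ + X]mul1r -mulrDl natr1 ler_pdivlMr//.
  exact: ltW.
have h1 := tgrid gl lM; have h2 := tgrid g gM; have h3 := gn i ilt.
have := metric_triangle (gl t) (gl (grid i)) (g t).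
have := metric_triangle (gl (grid i)) (g (grid i)) (g t).
rewrite (metric_sym (g (grid i)) (g t)); lra.
Qed.

End geo_compact.

Lemma continuous_borel_real (R : realType) (T : ptopologicalType) (f : T -> R) :
  continuous f -> measurable_fun [set: borel T] (f : borel T -> measurableTypeR R).
Proof.
move=> cf; apply: (measurability _ (RGenOInfty.measurableE R)) => //.
move=> _ [_ [t ->] <-]; rewrite setTI; apply: sub_sigma_algebra.
apply: (@open_comp _ _ f); first by move=> x _; exact: cf.
exact: interval_open.
Qed.

(** The integral of a nonnegative [f] is a supremum over simple functions below it, so the bound
    holds without measurability of [f]. This spares a study of the distortion coefficient as a
    function of the geodesic. *)
Lemma integral_ge_cst d (T : measurableType d) (R : realType)
    (mu : {measure set T -> \bar R}) (D E : set T) (f : T -> \bar R) (c : R) :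
  measurable D -> measurable E -> E `<=` D -> 0 <= c ->
  (forall x, D x -> (0 <= f x)%E) -> (forall x, E x -> (c%:E <= f x)%E) ->
  (c%:E * mu E <= \int[mu]_(x in D) f x)%E.
Proof.
move=> mD mE ED c0 f0 fc.
have cE : (\int[mu]_x (c%:E * (\1_E x)%:E) = c%:E * mu E)%E.
  rewrite ge0_integralZl_EFin//; last exact/measurable_EFinP.
  by rewrite integral_indic// setIT.
rewrite -cE ge0_integralTE; last by move=> x; rewrite -EFinM lee_fin mulr_ge0.
rewrite ge0_integralE//; apply: ge_ereal_sup => _ [g gh <-].
apply: ereal_sup_ubound; exists g => // x.
apply: le_trans (gh x) _; rewrite patchE indicE.
have [xD|xD] := boolP (x \in D).
  case: (boolP (x \in E)) => xE.
    by rewrite mule1 fc//; exact/set_mem.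
  by rewrite mule0 f0//; exact/set_mem.
case: (boolP (x \in E)) => xE; last by rewrite mule0.
by exfalso; move: xD; rewrite notin_setE; apply; apply: ED; exact/set_mem.
Qed.

(** * Non-degeneracy *)

Section distortion_bound.
Context {R : realType}.

(** At time [1/2] the duplication formulas simplify the quotients to [1 / (2 cos a)], at least
    [1/2], and to [1 / (2 cosh a)], bounded below for bounded [a]. For nonnegative [K] the square
    root in the bound is [0], which leaves [1/2]. *)
Lemma sigma_half_ge (K N r theta : R) : 0 < N -> 0 <= theta <= r ->
  (((2 * expR (r * Num.sqrt (- K / N)))^-1)%:E <= sigma K N 2^-1 theta)%E.
Proof.
move=> N0 /andP[t0 tr]; have r0 := le_trans t0 tr.
set s := (_ * _)^-1.
have e1 : 1 <= expR (r * Num.sqrt (- K / N)).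
  by rewrite -expR0 ler_expR mulr_ge0// sqrtr_ge0.
have s2 : s <= 2^-1.
  by rewrite /s lef_pV2 ?posrE ?mulr_gt0 ?expR_gt0//; lra.
rewrite /sigma; case: ifPn => [_|]; first by rewrite leey.
rewrite -ltNge => KN; case: ifPn => [K0|nK].
  have theta0 : 0 < theta.
    by rewrite lt_neqAle t0 andbT; apply: contraTneq K0 => <-; rewrite expr0n mulr0 ltxx.
  have K0' : 0 < K by move: K0; rewrite pmulr_lgt0// exprn_gt0.
  set k := Num.sqrt _; have k0 : 0 < k by rewrite sqrtr_gt0 divr_gt0.
  have kpi : theta * k < pi.
    rewrite -(ltr_pXn2r (n := 2)) ?nnegrE ?mulr_ge0 ?pi_ge0 ?(ltW k0)//.
    rewrite exprMn sqr_sqrtr ?divr_ge0 ?ltW// mulrA ltr_pdivrMr//.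
    by rewrite mulrC (mulrC (pi ^+ 2)).
  pose a := 2^-1 * theta * k.
  have a0 : 0 < a by rewrite !mulr_gt0// invr_gt0.
  have aE : theta * k = a + a by rewrite /a -!mulrA; lra.
  rewrite lee_fin -/a aE (le_trans s2)//.
  have sa : 0 < sin a by apply: sin_gt0_pi; rewrite a0 /=; lra.
  have saa : 0 < sin (a + a) by apply: sin_gt0_pi; lra.
  have : cos a * sin a <= sin a by rewrite ger_pMl// cos_le1.
  by rewrite ler_pdivlMr// sinD (mulrC (sin a)); lra.
case: ifPn => [_|K1]; first by rewrite lee_fin.
rewrite lee_fin.
have theta0 : 0 < theta.
  by rewrite lt_neqAle t0 andbT; apply: contraNneq K1 => <-; rewrite expr0n mulr0.
have K0 : K < 0.
  have : K * theta ^+ 2 < 0 by rewrite lt_neqAle K1 leNgt nK.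
  by rewrite pmulr_llt0// exprn_gt0.
move: e1 s2; rewrite /s; set k := Num.sqrt _ => e1 s2.
have k0 : 0 < k by rewrite sqrtr_gt0 divr_gt0// oppr_gt0.
pose a := 2^-1 * theta * k.
have a0 : 0 < a by rewrite !mulr_gt0// invr_gt0.
have aE : theta * k = a + a by rewrite /a -!mulrA; lra.
rewrite -/a aE /sinh opprD !expRD.
set E := expR a; set E' := expR (- a).
have E1 : 1 < E by rewrite -expR0 ltr_expR.
have E'1 : E' < 1 by rewrite -expR0 ltr_expR; lra.
have E'0 : 0 < E' by exact: expR_gt0.
have EX : E <= expR (r * k).
  rewrite ler_expR (le_trans (_ : a <= theta * k))//; first by rewrite aE; lra.
  by rewrite ler_wpM2r// ltW.
set X := expR _ in e1 s2 EX *.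
have -> : (E * E - E' * E') / 2 = (E - E') / 2 * (E + E') by lra.
have d0 : 0 < (E - E') / 2 by lra.
rewrite ler_pdivlMr; last by rewrite mulr_gt0//; lra.
rewrite mulrCA ger_pMr//.
by rewrite mulrC ler_pdivrMr ?mul1r; lra.
Qed.

Lemma tau_half_ge (K N r : R) : 1 < N -> exists2 c : R, 0 < c &
  forall theta, 0 <= theta <= r -> (c%:E <= tau K N 2^-1 theta `^ N)%E.
Proof.
move=> N1; pose s := (2 * expR (r * Num.sqrt (- K / (N - 1))))^-1.
have s0 : 0 < s by rewrite invr_gt0 mulr_gt0// expR_gt0.
exists ((2^-1 `^ N^-1 * s `^ ((N - 1) / N)) `^ N).
  by rewrite powR_gt0// mulr_gt0// powR_gt0.
move=> theta tr.
have ssig : (s%:E <= sigma K (N - 1) 2^-1 theta)%E by apply: sigma_half_ge => //; lra.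
rewrite -poweR_EFin; apply: gt0_ler_poweR.
- by lra.
- by rewrite in_itv /= leey andbT lee_fin mulr_ge0// powR_ge0.
- by rewrite in_itv /= leey andbT mule_ge0// ?lee_fin ?powR_ge0// poweR_ge0.
- rewrite EFinM /tau lee_pmul ?lee_fin ?powR_ge0//.
  rewrite -poweR_EFin; apply: gt0_ler_poweR.
  + by rewrite divr_ge0//; lra.
  + by rewrite in_itv /= leey andbT lee_fin ltW.
  + by rewrite in_itv /= leey andbT (le_trans _ ssig)// lee_fin ltW.
  + exact: ssig.
Qed.

End distortion_bound.

Section contraction.
Context {R : realType} (X : metricType R).

(** [tau] is the fraction of the way to [p] that remains. Only distances occur, which makes
    iteration and compactness direct. *)
Definition toward (tau : R) (A : set X) (p : X) : set X :=
  [set z | exists2 v, A v &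
    mdist z p = tau * mdist v p /\ mdist v z = (1 - tau) * mdist v p].

End contraction.

Lemma probability1C d (T : measurableType d) (R : realType)
    (P : probability T R) (A : set T) : measurable A ->
  P A = 1%E -> P (~` A) = 0%E.
Proof. by move=> mA PA; rewrite probability_setC// PA subee. Qed.

Lemma probability1I d (T : measurableType d) (R : realType)
    (P : probability T R) (A B : set T) : measurable A -> measurable B ->
  P A = 1%E -> P B = 1%E -> P (A `&` B) = 1%E.
Proof.
move=> mA mB PA PB; rewrite -[A `&` B]setCK probability_setC; last first.
  by apply: measurableC; exact: measurableI.
rewrite setCI (_ : P _ = 0%E) ?sube0//; apply/eqP.
rewrite eq_le measure_ge0 andbT.
apply: le_trans (measureU2 P (measurableC mA) (measurableC mB)) _.
rewrite [X in (X + _)%E](probability1C mA PA).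
by rewrite [X in (_ + X)%E](probability1C mB PB) adde0.
Qed.

Lemma integral_le_cst d (T : measurableType d) (R : realType)
    (P : probability T R) (A : set T) (f : T -> \bar R) (c : R) :
  measurable A -> P A = 1%E -> measurable_fun setT f ->
  (forall x, (0 <= f x)%E) -> (forall x, A x -> (f x <= c%:E)%E) ->
  (\int[P]_x f x <= c%:E)%E.
Proof.
move=> mA PA mf f0 fc.
have mAC : measurable (~` A) by exact: measurableC.
rewrite -(setUv A) ge0_integral_setU//; last 2 first.
- by rewrite setUv.
- by apply/disj_setPCl.
rewrite [X in (_ + X)%E](null_set_integral mAC)//; last 2 first.
- exact: measurable_funTS.
- exact: probability1C.
rewrite adde0; apply: (@le_trans _ _ (\int[P]_(x in A) (cst c%:E x))%E).
  by apply: ge0_le_integral => //; exact: measurable_funTS.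
by rewrite integral_cst// [X in (_ * X)%E]PA mule1.
Qed.

Lemma measurable_fst_borel (S T : ptopologicalType) (A : set (borel S)) :
  measurable A -> measurable (fst @^-1` A : set (borel (S * T)%type)).
Proof.
move=> mA; rewrite -[X in measurable X]setTI.
apply: (@continuous_borel (S * T)%type S fst) => // x; exact: cvg_fst.
Qed.

Lemma measurable_snd_borel (S T : ptopologicalType) (A : set (borel T)) :
  measurable A -> measurable (snd @^-1` A : set (borel (S * T)%type)).
Proof.
move=> mA; rewrite -[X in measurable X]setTI.
apply: (@continuous_borel (S * T)%type T snd) => // x; exact: cvg_snd.
Qed.

Section nondegenerate.
Context {R : realType} {X : pmetricType R}.
Variable m : {measure set (borel X) -> \bar R}.
Local Notation d := (@mdist R X).

(** The common consequence of the two hypotheses. The constant [c] may depend on the place, but the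
    scale [rho] may not, as it sets the step length along geodesics at the end. A measurable [B]
    around the contracted set replaces that set, which need not be Borel. *)
Definition nondegenerate := exists2 rho : R, 0 < rho &
  forall x0 : X, exists2 c : R, 0 < c &
    forall (p : X) (A B : set (borel X)), ball x0 rho p ->
      measurable A -> measurable B -> A `<=` ball p rho ->
      toward 2^-1 A p `<=` B -> (c%:E * m A <= m B)%E.

Lemma half_itv : (0 <= 2^-1 :> R) * (2^-1 <= 1 :> R).
Proof. by split; lra. Qed.

Definition half : {i01 R} := Itv01 half_itv.1 half_itv.2.

Lemma geo_half_toward (A : set X) (p : X) (g : Geo X) :
  A (g 0%:i01) -> g 1%:i01 = p -> toward 2^-1 A p (g half).
Proof.
move=> Ag gp; exists (g 0%:i01) => //.
rewrite -gp [d (g half) _]geo_speed [d _ (g half)]geo_speed /= subr0.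
by rewrite !ger0_norm; [split; congr (_ * _)|..]; lra.
Qed.

(** The unit ball around any [p] with [d x0 p < 1] lies in [ball x0 2], and the value of [f] at
    [1/2] is the constant there. *)
Lemma qualitatively_nondegenerate_nondegenerate :
  qualitatively_nondegenerate m -> nondegenerate.
Proof.
move=> qn; exists 1 => // x0; have [//|f [f0 _ fm]] := qn x0 2.
have half01 : 0 < (half%:num : R) < 1 by apply/andP; split => /=; lra.
exists (f half%:num) => [|p A B x0p mA mB Ap AB]; first exact: f0.
have A2 : A `<=` ball x0 2.
  move=> q /Ap; rewrite !ballE /=; rewrite ballE /= in x0p.
  by have := metric_triangle x0 p q; lra.
have p2 : ball x0 2 p by move: x0p; rewrite !ballE /= => ?; lra.
apply: le_trans (fm A p half mA A2 p2 half01) _.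
rewrite -(measurable_mu_extE m mB).
apply: le_mu_ext => _ [g [Ag gp] <-]; apply: AB; exact: geo_half_toward.
Qed.

Lemma compact_finite_measure (K : set X) :
  (forall p : X, exists2 U : set X, open_nbhs p U & (m U < +oo)%E) ->
  compact K -> (m K < +oo)%E.
Proof.
move=> lf cK; have /choice[U UP] : forall p : X, exists U : set X,
    open_nbhs p U /\ (m U < +oo)%E.
  by move=> p; have [U ? ?] := lf p; exists U.
have := cK; rewrite compact_cover => /(_ X K U).
case=> [p _|q Kq|D _ KD]; first by have [[]] := UP p.
  by exists q => //; have [[]] := UP q.
have fin : measurable (\bigcup_(p in [set i | i \in finmap.pred_of_finset D]) U p : set (borel X)) /\
    (m (\bigcup_(p in [set i | i \in finmap.pred_of_finset D]) U p) < +oo)%E.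
  rewrite bigcup_fset; elim/big_ind : _ => [|A B [mA fA] [mB fB]|p _].
  - by rewrite measure0.
  - split; first exact: measurableU.
    by rewrite (le_lt_trans (measureU2 m mA mB))// lte_add_pinfty.
  - by have [[oU _] ?] := UP p; split => //; exact: sub_sigma_algebra.
apply: le_lt_trans fin.2; apply: le_measure; rewrite ?inE//; last exact: fin.1.
by apply: closed_borel; apply: compact_closed => //; exact: metric_hausdorff.
Qed.

(** Almost every geodesic of the given plan starts in [A] and ends at [p], so it is in [B] at time
    [1/2], where the density is at least [c]. For positive [K] the scale [rho] is the radius below
    which [MCP] applies. *)
Lemma MCP_nondegenerate (K N : R) : 1 < N -> proper_space X ->
  (forall p : X, exists2 U : set X, open_nbhs p U & (m U < +oo)%E) ->
  MCP m K N -> nondegenerate.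
Proof.
move=> N1 pX lf mcp.
pose rho := if 0 < K then pi * Num.sqrt ((N - 1) / K) else 1.
have rho0 : 0 < rho.
  rewrite /rho; case: ifPn => // K0.
  by rewrite mulr_gt0 ?pi_gt0// sqrtr_gt0 divr_gt0// subr_gt0.
exists rho => // x0; have [c c0 cP] := tau_half_ge K rho N1.
exists c => // p A B _ mA mB Ap AB.
have [mA0|mA0] := eqVneq (m A) 0%E; first by rewrite mA0 mule0 measure_ge0.
have Acb : A `<=` cball p rho.
  by move=> q /Ap; rewrite ballE; exact: ltW.
have Afin : (m A < +oo)%E.
  apply: le_lt_trans (compact_finite_measure lf (pX p rho)).
  apply: le_measure; rewrite ?inE//; apply: closed_borel; exact: cball_closed.
have Apos : (0 < m A)%E by rewrite lt_neqAle eq_sym mA0 measure_ge0.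
pose mu0 : probability (borel X) R :=
  mnormalize (mrestr m mA) (dirac (p : borel X)).
have mu0E U : mu0 U = (m (U `&` A) * (fine (m A))^-1%:E)%E.
  rewrite /mu0 /= /mnormalize /= /mrestr (@setTI (borel X) A) (negbTE mA0) lt_eqF//.

have mu0A : mu0 A = 1%E.
  by rewrite mu0E setIid -{1}(@fineK _ (m A)) ?ge0_fin_numE// -EFinM divff// fine_eq0 ?ge0_fin_numE.
have P2mu0 : P2 mu0.
  exists p; apply: (@le_lt_trans _ _ (rho ^+ 2)%:E); last exact: ltry.
  apply: (@integral_le_cst _ _ _ mu0 A) => //.
  - apply: (@measurableT_comp _ _ _ _ _ _ EFin) => //.
    apply: measurable_funX; apply: (@continuous_borel_real R X (d p)).
    exact: mdist_continuous.
  - by move=> z; rewrite lee_fin sqr_ge0.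
  - by move=> z /Acb pz; rewrite lee_fin lerXn2r ?nnegrE ?mdist_ge0// ltW.
have AK : 0 < K -> A `<=` ball p (pi * Num.sqrt ((N - 1) / K)).
  by move=> K0; move: Ap; rewrite /rho K0.
have [P [cpl _] PB] := mcp p A mA Apos Afin P2mu0 AK.
have {}PB := PB half B mB.
have [E [mE PE EP]] : exists E : set (borel (Geo X)), [/\ measurable E, P E = 1%E &
    forall g : Geo X, E g -> A (g 0%:i01) /\ g 1%:i01 = p].
  have mp : measurable ([set p] : set (borel X)).
    by apply: closed_borel; apply/accessible_closed_set1/hausdorff_accessible/metric_hausdorff.
  have [cA _] := cpl A mA; have [_ cp] := cpl [set p] mp.
  exists (ev01 @^-1` (fst @^-1` A) `&` ev01 @^-1` (snd @^-1` [set p])).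
  have m1 : measurable (ev01 @^-1` (fst @^-1` A)).
    by rewrite -[X in measurable X]setTI; apply: ev01_measurable => //; exact: measurable_fst_borel.
  have m2 : measurable (ev01 @^-1` (snd @^-1` [set p])).
    by rewrite -[X in measurable X]setTI; apply: ev01_measurable => //; exact: measurable_snd_borel.
  split; [exact: measurableI| |by move=> g []].
  apply: probability1I => //; first by rewrite -mu0A -[RHS]cA.
  by apply: (eq_trans cp); rewrite /= diracE mem_set.
have cB : (c%:E <= (fine (m A))^-1%:E * m B)%E.
  apply: le_trans PB; rewrite /pushforward -[leLHS]mule1 -PE.
  apply: integral_ge_cst => //.
  - by rewrite -[_ @^-1` _]setTI; exact: ev_measurable.
  - by move=> g /EP[Ag gp]; apply: AB; exact: geo_half_toward.
  - exact: ltW.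
  - by move=> g _; exact: poweR_ge0.
  - move=> g /EP[Ag gp]; rewrite (_ : 1 - half%:num = 2^-1)//=; last by lra.
    apply: cP; rewrite mdist_ge0 gp /=; rewrite metric_sym; exact: Acb.
have fA0 : 0 < fine (m A) by rewrite fine_gt0// Apos.
rewrite -(@fineK _ (m A)) ?ge0_fin_numE// muleC -lee_pdivlMl//.
Qed.

End nondegenerate.

Lemma countable_enum (T : choiceType) (B : set T) (t0 : T) : countable B ->
  exists e : nat -> T, forall U, B U -> exists n, e n = U.
Proof.
move=> /countable_injP[f finj].
exists (fun n => xget t0 [set U | B U /\ f U = n]) => U BU; exists (f U).
case: xgetP => [V _ [BV fV]|/(_ U)[]//].
by apply: finj => //; exact: mem_set.
Qed.

Lemma second_countable_prod (S T : topologicalType) :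
  @second_countable S -> @second_countable T -> @second_countable (S * T)%type.
Proof.
move=> [B cB [Bo Bb]] [C cC [Co Cb]].
exists [set U.1 `*` U.2 | U in B `*` C].
  apply: (card_le_trans (card_image_le _ _)).
  have /countable_injP[f fi] := cB; have /countable_injP[g gi] := cC.
  apply/countable_injP; exists (fun z => pickle (f z.1, g z.2)).
  move=> [x y] [x' y'] /set_mem[/= Bx Cy] /set_mem[/= Bx' Cy'].
  move=> /(pcan_inj pickleK)[fx gy].
  by congr (_, _); [apply: fi|apply: gi] => //; exact: mem_set.
split => [_ [[U V] /= [BU CV] <-]|[x y] O].
  rewrite openE => -[a b] /= [Ua Vb]; exists (U, V) => //; split.
    by apply: open_nbhs_nbhs; split => //; exact: Bo.
  by apply: open_nbhs_nbhs; split => //; exact: Co.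
move=> [[P Q] /= [/Bb[U [BU Ux] UP] /Cb[V [CV Vy] VQ]] PQ].
exists (U `*` V); first by split => //; exists (U, V).
by move=> [a b] /= [Ua Vb]; apply: PQ; split; [exact: UP|exact: VQ].
Qed.

(** The target carries the Borel sets of the product topology; second countability makes every open
    set a countable union of rectangles. *)
Lemma measurable_fun_pair_borel d (W : measurableType d) (S T : ptopologicalType)
    (f : W -> S) (g : W -> T) :
  @second_countable S -> @second_countable T ->
  measurable_fun setT (f : W -> borel S) -> measurable_fun setT (g : W -> borel T) ->
  measurable_fun setT (fun w => (f w, g w) : borel (S * T)%type).
Proof.
move=> [B cB [Bo Bb]] [C cC [Co Cb]] mf mg.
have [e eP] := countable_enum set0 cB; have [h hP] := countable_enum set0 cC.
apply: (measurability (@open (S * T)%type : set (set (borel (S * T)%type)))) => //.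
move=> _ [D oD <-]; rewrite setTI.
pose F n k := if `[< [/\ B (e n), C (h k) & e n `*` h k `<=` D] >]
  then f @^-1` e n `&` g @^-1` h k else set0.
have -> : (fun w => (f w, g w)) @^-1` D = \bigcup_n \bigcup_k F n k.
  apply/seteqP; split => w /=.
    move=> Dw; have := oD; rewrite openE => /(_ _ Dw).
    move=> [[P Q] /= [/Bb[U [BU Ux] UP] /Cb[V [CV Vy] VQ]] PQ].
    have [n en] := eP U BU; have [k hk] := hP V CV.
    exists n => //; exists k => //; rewrite /F en hk; case: asboolP => // -[].
    by split => // -[a b] /= [Ua Vb]; apply: PQ; split; [exact: UP|exact: VQ].
  move=> [n _ [k _]]; rewrite /F; case: asboolP => // -[_ _ UVD] [fw gw].
  by apply: UVD.
apply: bigcupT_measurable => n; apply: bigcupT_measurable => k.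
rewrite /F; case: asboolP => // -[Bn Ck _]; apply: measurableI.
  by rewrite -[X in measurable X]setTI; apply: mf => //; apply: sub_sigma_algebra; exact: Bo.
by rewrite -[X in measurable X]setTI; apply: mg => //; apply: sub_sigma_algebra; exact: Co.
Qed.

(** * Branching plans *)

Section disintegration_compact.
Context {R : realType} (X : pmetricType R).
Local Open Scope ereal_scope.
Local Notation U := (uniform_prob (@ltr01 R) : probability (measurableTypeR R) R).

(* The first coordinate is the level; the second one, uniform and independent of
   it, selects the point in the level set. *)
Lemma compact_disintegration (A : set X) (P : probability (borel X) R)
    (lev : X -> R) : compact A -> P A = 1 -> continuous lev ->
  exists (k : probability (measurableTypeR R) R)
    (V : measurableTypeR R * measurableTypeR R -> borel X)
    (E : set (measurableTypeR R * measurableTypeR R)),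
    [/\ forall J, k J = P (lev @^-1` J), measurable_fun setT V,
      forall N, measurable N -> (k \x U) (V @^-1` N) = P N,
      measurable E /\ (k \x U) E = 1 &
      forall w, E w -> A (V w) /\ lev (V w) = w.1].
Proof.
move=> cA PA clev.
have [A0|/set0P A0] := eqVneq A set0.
  by exfalso; move: PA; rewrite A0 measure0 => /eqP; rewrite eq_sym onee_eq0.
(* For the identity map this is a Borel code [c], injective on [A], with Borel left inverse [k]. The
   joint law [b] of level and code reduces the disintegration to two real variables. *)
have [k [kA mk] /(_ X id)[|x|c mc [c02 ck]]] :=
  borel_section (@metric_hausdorff R X) cA A0.
- exact: metric_hausdorff.
- exact: cvg_id.
have mlev := continuous_borel_real clev.
have [kap kapE] := image_probability P mlev.
have mpair : measurable_fun setT
    (fun x : borel X => (lev x, c x) : measurableTypeR R * measurableTypeR R).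
  exact/measurable_fun_pair.
have [b bE] := image_probability P mpair.
have [||q mq qE] := @conditional_quantile _ (measurableTypeR R) R b kap.
- by move=> J mJ; rewrite kapE bE; congr (P _); apply/seteqP; split => // x [].
- rewrite bE (_ : _ @^-1` _ = setT) ?probability_setT//.
  by apply/seteqP; split => // x _; split => //=; rewrite in_itv /=.
have mA : measurable (A : set (borel X)).
  by apply: closed_borel; apply: compact_closed => //; exact: metric_hausdorff.
have mV : measurable_fun setT (fun w : measurableTypeR R * measurableTypeR R => k (q w) : borel X).
  exact: measurableT_comp.
have aeA (S S' : set (borel X)) : measurable S -> measurable S' ->
    (forall x, A x -> S x <-> S' x) -> P S = P S'.
  move=> mS mS' SS'.
  have PI (D : set (borel X)) : measurable D -> P D = P (D `&` A).
    move=> mD; apply: (eq_trans (measureDI P mD mA)).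
    have D0 : P (D `\` A) = 0.
      apply/eqP; rewrite eq_le measure_ge0 andbT -(probability1C mA PA).
      by apply: le_measure; rewrite ?inE;
        [exact: measurableD|exact: measurableC|move=> x []].
    by rewrite [X in X + _]D0 add0e.
  rewrite PI// [RHS]PI//; congr (P _); apply/seteqP; split => x [Sx Ax].
    by split => //; apply/SS'.
  by split => //; apply/SS'.
pose F : set (measurableTypeR R * measurableTypeR R) :=
  [set z | A (k z.2) /\ lev (k z.2) = z.1].
have mF : measurable F.
  have mk2 : measurable_fun setT
      (fun z : measurableTypeR R * measurableTypeR R => k z.2 : borel X).
    by apply: measurableT_comp => //; exact: measurable_snd.
  rewrite (_ : F = ((fun z => k z.2) @^-1` A) `&`
     ((fun z : measurableTypeR R * measurableTypeR R => (lev (k z.2) - z.1)%R) @^-1` [set 0%R])).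
    apply: measurableI; first by rewrite -[X in measurable X]setTI; exact: mk2.
    have md : measurable_fun setT
        (fun z : measurableTypeR R * measurableTypeR R => (lev (k z.2) - z.1)%R).
      apply: measurable_funB; first exact: (measurableT_comp mlev mk2).
      exact: measurable_fst.
    by rewrite -[X in measurable X]setTI; exact: md.
  apply/seteqP; split => z /= [Az /eqP].
    by rewrite -subr_eq0 => /eqP.
  by rewrite subr_eq0 => /eqP.
have mE : measurable [set w | F (w.1, q w)].
  rewrite -[X in measurable X]setTI.
  by apply: (measurable_fun_pair measurable_fst mq) => //.
exists kap, (fun w => k (q w)), [set w | F (w.1, q w)]; split => //.
- move=> N mN; have mN' : measurable ((setT : set (measurableTypeR R)) `*` (k @^-1` N)).
    by apply: measurableX => //; rewrite -[X in measurable X]setTI; exact: mk.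
  apply: eq_trans (_ : (kap \x U) [set x | (setT `*` (k @^-1` N)) (x.1, q x)] = _).
    by congr ((kap \x U) _); apply/seteqP; split => x //= [].
  rewrite qE// bE; apply: aeA => //.
    by rewrite -[X in measurable X]setTI; exact: mpair.
  move=> x Ax /=; rewrite ck; last by exists x.
  by split => [[]|].
- split => //; rewrite qE// bE -PA; apply: aeA => //.
    by rewrite -[X in measurable X]setTI; exact: mpair.
  by move=> x Ax; rewrite /F /= ck; [split|exists x].
Qed.

(** Almost every section is null for [k'], and the exceptional first coordinates are null for [k] as
    well. *)
Lemma prod_null_dominates (k k' : probability (measurableTypeR R) R)
    (S : set (measurableTypeR R * measurableTypeR R)) :
  (forall J, measurable J -> k' J = 0 -> k J = 0) -> measurable S ->
  (k' \x U) S = 0 -> (k \x U) S = 0.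
Proof.
move=> kk' mS; rewrite /product_measure1 => h.
have mx : measurable_fun setT (U \o xsection S) by exact: measurable_fun_xsection.
have : ae_eq k' setT (U \o xsection S) (cst 0).
  apply/ae_eq_integral_abs => //; rewrite -[RHS]h.
  by apply: eq_integral => x _; rewrite gee0_abs.
move=> [N [mN N0 NS]].
apply: etrans (_ : \int[k]_x cst 0 x = 0); last exact: integral0.
apply: ae_eq_integral => //; exists N; split => //; exact: kk'.
Qed.

End disintegration_compact.

Lemma half_sum_probability d (T : measurableType d) (R : realType)
    (P Q : probability T R) : exists M : probability T R,
  forall S, measurable S -> M S = ((P S + Q S) * 2^-1%:E)%E.
Proof.
exists (mnormalize (measure_add P Q) P) => S mS.
have e2 : measure_add P Q setT = 2%:E.
  rewrite measure_addE [X in (X + _)%E](probability_setT P).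
  by rewrite [X in (_ + X)%E](probability_setT Q).
rewrite /= /mnormalize; case: ifPn => [/orP[]/eqP h|_].
- by have := etrans (esym e2) h => /eqP; rewrite eqe pnatr_eq0.
- by have := etrans (esym e2) h.
have -> : (P S + Q S = measure_add P Q S)%E by rewrite measure_addE.
by rewrite -[in RHS](_ : fine (measure_add P Q setT) = 2%R)// e2.
Qed.

Section antitone_coupling.
Context {R : realType} {X : pmetricType R}.
Local Notation d := (@mdist R X).
Local Open Scope ereal_scope.

Lemma measurable_mdist_fst (a : X) : measurable_fun setT
  (fun z : borel (X * X)%type => d a z.1 : measurableTypeR R).
Proof.
apply: (@continuous_borel_real R (X * X)%type (fun z => d a z.1)) => z.
by apply: (@mdist_cvg _ _ _ _ _ (fun=> a) fst); [exact: cvg_cst|exact: cvg_fst].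
Qed.

Lemma measurable_mdist_snd (a : X) : measurable_fun setT
  (fun z : borel (X * X)%type => d a z.2 : measurableTypeR R).
Proof.
apply: (@continuous_borel_real R (X * X)%type (fun z => d a z.2)) => z.
by apply: (@mdist_cvg _ _ _ _ _ (fun=> a) snd); [exact: cvg_cst|exact: cvg_snd].
Qed.

Lemma measurable_mdist_pair : measurable_fun setT
  (fun z : borel (X * X)%type => d z.1 z.2 : measurableTypeR R).
Proof.
apply: (@continuous_borel_real R (X * X)%type (fun z => d z.1 z.2)) => z.
by apply: (@mdist_cvg _ _ _ _ _ fst snd); [exact: cvg_fst|exact: cvg_snd].
Qed.

Lemma coupling_integral_fst (mu0 mu1 : probability (borel X) R) s
    (f : borel X -> \bar R) : coupling mu0 mu1 s -> measurable_fun setT f ->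
  (forall x, 0 <= f x) -> \int[s]_z f z.1 = \int[mu0]_x f x.
Proof.
move=> cpl mf f0.
have mfst : measurable_fun setT (fst : borel (X * X)%type -> borel X).
  by apply: (@continuous_borel (X * X)%type X fst) => x; exact: cvg_fst.
have := @ge0_integral_pushforward _ _ _ _ R _ mfst s setT f measurableT mf (fun y _ => f0 y).
rewrite preimage_setT => <-; apply: eq_measure_integral => B mB _.
by have [] := cpl B mB.
Qed.

Lemma coupling_integral_snd (mu0 mu1 : probability (borel X) R) s
    (f : borel X -> \bar R) : coupling mu0 mu1 s -> measurable_fun setT f ->
  (forall x, 0 <= f x) -> \int[s]_z f z.2 = \int[mu1]_x f x.
Proof.
move=> cpl mf f0.
have msnd : measurable_fun setT (snd : borel (X * X)%type -> borel X).
  by apply: (@continuous_borel (X * X)%type X snd) => x; exact: cvg_snd.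
have := @ge0_integral_pushforward _ _ _ _ R _ msnd s setT f measurableT mf (fun y _ => f0 y).
rewrite preimage_setT => <-; apply: eq_measure_integral => B mB _.
by have [] := cpl B mB.
Qed.

(* With [u = d a v] and [y = d a z], optimality follows from
     tau (u + y)^2 + ((1 - tau) y^2 + c^2)
       = (y + tau u - c)^2 + (tau (1 - tau) u^2 + 2 c tau u) + 2 c y,
   where all terms but the cost and the square depend on one marginal only. *)
Lemma antitone_coupling_optimal (mu0 mu1 : probability (borel X) R)
    (s0 : probability (borel (X * X)%type) R) (A D : set (borel X)) (a : X)
    (tau c u0 y0 : R) :
  (0 < tau < 1)%R -> (0 <= c)%R -> measurable A -> measurable D ->
  mu0 A = 1 -> mu1 D = 1 ->
  (forall v z, A v -> D z -> (d v z = d a v + d a z)%R) ->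
  (forall v, A v -> (d a v <= u0)%R) -> (forall z, D z -> (d a z <= y0)%R) ->
  coupling mu0 mu1 s0 ->
  (exists2 E, measurable E /\ s0 E = 1 &
    forall z, E z -> (d a z.2 + tau * d a z.1 = c)%R) ->
  Opt mu0 mu1 s0.
Proof.
move=> /andP[tau0 tau1] c0 mA mD A1 D1 dAD Au Dy cpl0 [E [mE E1] Ec].
split => // s cpl.
have mu : measurable_fun setT (d a : borel X -> measurableTypeR R).
  by apply: continuous_borel_real; exact: mdist_continuous.
pose e1 x : \bar R := ((1 - tau) * d a x ^+ 2 + c ^+ 2)%:E.
pose e2 x : \bar R := (tau * (1 - tau) * d a x ^+ 2 + 2 * c * tau * d a x)%:E.
pose e3 x : \bar R := (2 * c * d a x)%:E.
pose sq (z : X * X) : \bar R := ((d a z.2 + tau * d a z.1 - c) ^+ 2)%:E.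
have t1 : (0 <= 1 - tau)%R by lra.
have t0 : (0 <= tau)%R by lra.
have me1 : measurable_fun setT (e1 : borel X -> \bar R).
  apply/measurable_EFinP; apply: measurable_funD => //.
  by apply: measurable_funM => //; exact: measurable_funX.
have me2 : measurable_fun setT (e2 : borel X -> \bar R).
  apply/measurable_EFinP; apply: measurable_funD; apply: measurable_funM => //.
  by apply: measurable_funM => //; exact: measurable_funX.
have me3 : measurable_fun setT (e3 : borel X -> \bar R).
  by apply/measurable_EFinP; apply: measurable_funM.
have e10 x : 0 <= e1 x.
  by rewrite lee_fin addr_ge0 ?sqr_ge0 ?mulr_ge0 ?sqr_ge0 ?mdist_ge0.
have e20 x : 0 <= e2 x.
  by rewrite lee_fin addr_ge0 ?mulr_ge0 ?sqr_ge0 ?mdist_ge0.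
have e30 x : 0 <= e3 x by rewrite lee_fin !mulr_ge0 ?mdist_ge0.
have mfst : measurable_fun setT (fst : borel (X * X)%type -> borel X).
  by apply: (@continuous_borel (X * X)%type X fst) => x; exact: cvg_fst.
have msnd : measurable_fun setT (snd : borel (X * X)%type -> borel X).
  by apply: (@continuous_borel (X * X)%type X snd) => x; exact: cvg_snd.
have msq : measurable_fun setT (sq : borel (X * X)%type -> \bar R).
  apply/measurable_EFinP; apply: measurable_funX; apply: measurable_funB => //.
  apply: measurable_funD; first exact: measurable_mdist_snd.
  by apply: measurable_funM => //; exact: measurable_mdist_fst.
have sq0 z : 0 <= sq z by rewrite lee_fin sqr_ge0.
have mcost : measurable_fun setT
    (fun z : borel (X * X)%type => (tau%:E * ((d z.1 z.2) ^+ 2)%:E) : \bar R).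
  apply/measurable_EFinP; apply: measurable_funM => //.
  by apply: measurable_funX; exact: measurable_mdist_pair.
have key (s' : probability (borel (X * X)%type) R) : coupling mu0 mu1 s' ->
    tau%:E * cost s' + \int[mu1]_x e1 x =
    \int[s']_z sq z + \int[mu0]_x e2 x + \int[mu1]_x e3 x.
  move=> cpl'.
  rewrite -(coupling_integral_snd cpl' me1 e10) -(coupling_integral_fst cpl' me2 e20).
  rewrite -(coupling_integral_snd cpl' me3 e30) /cost.
  rewrite -ge0_integralZl_EFin//; last first.
  - apply/measurable_EFinP/measurable_funX; exact: measurable_mdist_pair.
  - by move=> z _; rewrite lee_fin sqr_ge0.
  have me1' := measurableT_comp me1 msnd.
  have me2' := measurableT_comp me2 mfst.
  have me3' := measurableT_comp me3 msnd.
  rewrite -!ge0_integralD//; last 3 first.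
  - by move=> z _; rewrite adde_ge0.
  - exact: emeasurable_funD.
  - by move=> z _; rewrite mule_ge0 ?lee_fin ?sqr_ge0.
  have cA : s' (fst @^-1` A) = 1 by have [-> _] := cpl' A mA.
  have cD : s' (snd @^-1` D) = 1 by have [_ ->] := cpl' D mD.
  have mA' := measurable_fst_borel (T := X) mA.
  have mD' := measurable_snd_borel (S := X) mD.
  have AD1 := probability1I mA' mD' cA cD.
  apply: ae_eq_integral => //.
  - exact: emeasurable_funD.
  - by apply: emeasurable_funD => //; exact: emeasurable_funD.
  (* The cost is a function of the two levels for [v] in [A] and [z] in [D], and these pairs carry
     every coupling. *)
  exists (~` (fst @^-1` A `&` snd @^-1` D)); split.
  - by apply: measurableC; exact: measurableI.
  - by apply: probability1C => //; exact: measurableI.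
  move=> z /= /not_implyP[_ zne] [Az Dz]; apply: zne.
  rewrite /sq /e1 /e2 /e3 -!EFinM -!EFinD; congr EFin; rewrite (dAD _ _ Az Dz); ring.
have sq00 : \int[s0]_z sq z = 0.
  apply: etrans (_ : \int[s0]_z cst 0 z = 0); last exact: integral0.
  apply: ae_eq_integral => //; exists (~` E); split; [exact: measurableC|exact: probability1C|].
  move=> z /= /not_implyP[_ zne] Ez; apply: zne.
  by rewrite /sq (Ec _ Ez) subrr expr0n.
(* The costs are compared after adding this integral to both, so it has to be finite to be
   cancelled. *)
have fin1 : \int[mu1]_x e1 x \is a fin_num.
  rewrite ge0_fin_numE ?integral_ge0//.
  apply: (@le_lt_trans _ _ ((1 - tau) * y0 ^+ 2 + c ^+ 2)%:E); last exact: ltry.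
  apply: integral_le_cst D1 _ _ _ => // z Dz; rewrite lee_fin lerD2r ler_wpM2l//.
  by rewrite lerXn2r ?nnegrE ?mdist_ge0 ?(le_trans (mdist_ge0 a z)) ?Dy.
have := key s0 cpl0; rewrite sq00 add0e => k0.
have ks := key s cpl.
have : tau%:E * cost s0 + \int[mu1]_x e1 x <= tau%:E * cost s + \int[mu1]_x e1 x.
  by rewrite k0 ks -addeA leeDr// integral_ge0.
by rewrite leeD2rE// lee_pmul2l// lte_fin.
Qed.

End antitone_coupling.

Lemma hausdorff_prod (S T : topologicalType) :
  hausdorff_space S -> hausdorff_space T -> hausdorff_space (S * T)%type.
Proof.
move=> hS hT [x y] [x' y'] cl; congr (_, _).
  apply: hS => A B Ax Bx; have [||[z w] [/= Az Bz]] := cl (fst @^-1` A) (fst @^-1` B).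
  - by apply: (@cvg_fst _ _ (nbhs x) (nbhs y)); exact: Ax.
  - by apply: (@cvg_fst _ _ (nbhs x') (nbhs y')); exact: Bx.
  by exists z.
apply: hT => A B Ay By; have [||[z w] [/= Aw Bw]] := cl (snd @^-1` A) (snd @^-1` B).
- by apply: (@cvg_snd _ _ (nbhs x) (nbhs y)); exact: Ay.
- by apply: (@cvg_snd _ _ (nbhs x') (nbhs y')); exact: By.
by exists w.
Qed.

Lemma pair_continuous (S T V : topologicalType) (f : S -> T) (g : S -> V) :
  continuous f -> continuous g -> continuous (fun x => (f x, g x)).
Proof.
by move=> cf cg x; exact: (@cvg_pair _ _ _ (nbhs x) (nbhs (f x)) (nbhs (g x))
  _ _ _ _ _ (cf x) (cg x)).
Qed.

Section metric_tools.
Context {R : realType} {X : metricType R}.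
Local Notation d := (@mdist R X).

Lemma separable_second_countable : separable_space X -> @second_countable X.
Proof.
move=> [D cD dD].
exists [set ball z.1 (z.2.+1%:R^-1 : R) | z in D `*` [set: nat]].
  apply: (card_le_trans (card_image_le _ _)).
  have /countable_injP[f fi] := cD.
  apply/countable_injP; exists (fun z => pickle (f z.1, z.2)).
  move=> [x y] [x' y'] /set_mem[/= Dx _] /set_mem[/= Dx' _].
  move=> /(pcan_inj pickleK)[fx ->].
  by congr (_, _); apply: fi => //; exact: mem_set.
split => [_ [[p k] /= _ <-]|p O]; first exact: mball_open.
move=> /nbhs_ballP[e /= e0 eO].
have e20 : 0 < e / 2 by rewrite divr_gt0.
have [k ke] : exists k : nat, k.+1%:R^-1 < e / 2.
  by have [k _ kP] := near_infty_natSinv_lt (PosNum e20); exists k; exact: kP k (leqnn k).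
have k0 : 0 < k.+1%:R^-1 :> R by rewrite invr_gt0.
have [q [Dq pq]] : exists q, D q /\ d p q < k.+1%:R^-1.
  have [|q] := dD (ball p k.+1%:R^-1) _ (mball_open _ _); first by exists p; exact: ballxx.
  by rewrite ballE => -[pq Dq]; exists q.
exists (ball q k.+1%:R^-1).
  by split; [exists (q, k)|rewrite ballE /= metric_sym].
apply: subset_trans eO => w; rewrite !ballE /= => qw.
rewrite (le_lt_trans (metric_triangle p q w))//.
by rewrite [ltRHS](splitr e); apply: ltrD; [apply: lt_trans pq _|apply: lt_trans qw _].
Qed.

Lemma unit_geodesic_geo (L : R) (g : R -> X) : 0 <= L -> unit_geodesic L g ->
  exists h : Geo X, forall s : {i01 R}, h s = g (s%:num * L).
Proof.
move=> L0 ug.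
have sL (s : {i01 R}) : 0 <= s%:num * L <= L.
  by rewrite mulr_ge0//= ler_piMl.
have hP (s t : {i01 R}) : d (g (s%:num * L)) (g (t%:num * L)) =
    `|t%:num - s%:num| * d (g ((0%:i01 : {i01 R})%:num * L)) (g ((1%:i01 : {i01 R})%:num * L)).
  rewrite !ug// -!mulrBl !normrM mulrA; congr (_ * _).
  by rewrite subr0 normr1 mulr1.
by exists (MkGeo hP).
Qed.

(** Both geodesics begin with the same geodesic from [v] to [a]. Their total lengths are equal, so
    the constant speed parametrisations agree too, up to any fraction [s0] of time before [a] is
    passed. *)
Lemma branching_pair (pX : proper_space X) (lX : length_space X) (a v z1 z2 : X) (s0 : R) :
  d v z1 = d a v + d a z1 -> d v z2 = d a v + d a z2 -> d a z1 = d a z2 ->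
  s0 * (d a v + d a z1) <= d a v ->
  exists g h : Geo X, [/\ g 0%:i01 = v /\ g 1%:i01 = z1, h 0%:i01 = v /\ h 1%:i01 = z2 &
    forall s : {i01 R}, s%:num <= s0 -> g s = h s].
Proof.
move=> e1 e2 e12 hs0.
have [k [uk k0 k1]] := unit_geodesic_exists pX lX v a.
have [k1' [uk1 k10 k11]] := unit_geodesic_exists pX lX a z1.
have [k2' [uk2 k20 k21]] := unit_geodesic_exists pX lX a z2.
rewrite (metric_sym v a) in uk k1.
have u1 := unit_geodesic_cat (mdist_ge0 _ _) (mdist_ge0 _ _) uk uk1.
have u2 := unit_geodesic_cat (mdist_ge0 _ _) (mdist_ge0 _ _) uk uk2.
rewrite k1 k10 k0 k11 in u1; rewrite k1 k20 k0 k21 in u2.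
have {}u1 := u1 erefl e1; have {}u2 := u2 erefl e2.
have L0 : 0 <= d a v + d a z1 by rewrite addr_ge0 ?mdist_ge0.
have [g gE] := unit_geodesic_geo L0 u1.
rewrite -e12 in u2.
have [h hE] := unit_geodesic_geo L0 u2.
exists g, h; split.
- rewrite !gE/= mul0r mul1r mdist_ge0 k0; split => //.
  case: ifPn => [le|_]; last by rewrite addrC addKr k11.
  have az0 : d a z1 = 0 by apply/eqP; rewrite eq_le mdist_ge0 andbT; lra.
  by rewrite az0 addr0 k1; exact: mdist_positivity.
- rewrite !hE/= mul0r mul1r mdist_ge0 k0; split => //.
  case: ifPn => [le|_]; last by rewrite addrC addKr e12 k21.
  have az0 : d a z1 = 0 by apply/eqP; rewrite eq_le mdist_ge0 andbT; lra.
  by rewrite az0 addr0 k1; apply: mdist_positivity; rewrite -e12.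
move=> s ss0; rewrite gE hE ifT ?ifT//;
  by apply: le_trans hs0; rewrite ler_wpM2r.
Qed.

End metric_tools.

Section branching.
Context {R : realType} {X : pmetricType R}.
Local Notation d := (@mdist R X).

Lemma coincidence_closed (s0 : R) : closed [set g : Geo X * Geo X |
  forall s : {i01 R}, s%:num <= s0 -> g.1 s = g.2 s].
Proof.
have -> : [set g : Geo X * Geo X | forall s : {i01 R}, s%:num <= s0 -> g.1 s = g.2 s] =
    \bigcap_(s in [set s : {i01 R} | s%:num <= s0])
      ((fun g : Geo X * Geo X => d (g.1 s) (g.2 s)) @^-1` [set 0]).
  apply/seteqP; split => g gP s ss0 /=; first by rewrite gP// mdistxx.
  exact/mdist_positivity/gP.
apply: closed_bigI => s _; apply: closed_comp; last exact: closed_eq.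
move=> [g h] _; apply: (@mdist_cvg R X _ (nbhs (g, h)) _ (fun z => z.1 s) (fun z => z.2 s) (g s) (h s)).
  by apply: (@cvg_comp _ _ _ fst (fun k : Geo X => k s) _ (nbhs g)); [exact: cvg_fst|exact: ev_continuous].
by apply: (@cvg_comp _ _ _ snd (fun k : Geo X => k s) _ (nbhs h)); [exact: cvg_snd|exact: ev_continuous].
Qed.

Lemma probability0C d' (T : measurableType d') (P : probability T R) (E : set T) :
  measurable E -> P (~` E) = 0%E -> P E = 1%E.
Proof.
move=> mE h; rewrite -(probability_setT P) -(setvU E) measureU//; last 2 first.
- exact: measurableC.
- by rewrite setICl.
by rewrite [X in (X + _)%E]h add0e.
Qed.

Lemma restriction_probability (m : {measure set (borel X) -> \bar R}) (A : set (borel X)) :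
  measurable A -> (0 < m A)%E -> (m A < +oo)%E ->
  exists P : probability (borel X) R, P A = 1%E /\
    forall N, P N = 0%E <-> m (N `&` A) = 0%E.
Proof.
move=> mA A0 Afin; have [a _] : exists a, A a.
  by apply/set0P/eqP => A0'; move: A0; rewrite A0' measure0 ltxx.
have AN : mrestr m mA setT = m A by rewrite /mrestr (@setTI (borel X) A).
have Afn : m A \is a fin_num by rewrite ge0_fin_numE.
have A00 : fine (m A) != 0 by rewrite fine_eq0// gt_eqF.
pose P : probability (borel X) R := mnormalize (mrestr m mA) (dirac (a : borel X)).
have E N : P N = (m (N `&` A) * ((fine (m A))^-1)%:E)%E.
  rewrite /= /mnormalize /= AN ifF//; apply/negbTE.
  by rewrite negb_or gt_eqF//= lt_eqF.
exists P; split => [|N]; first by rewrite E setIid -{1}(fineK Afn) -EFinM divff.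
rewrite E; split => [/eqP|->]; last by rewrite mul0e.
by rewrite mule_eq0 eqe invr_eq0 (negbTE A00) orbF => /eqP.
Qed.

Lemma probability_setU0 d' (T : measurableType d') (P : probability T R) (A B : set T) :
  measurable A -> measurable B -> P A = 0%E -> P B = 0%E -> P (A `|` B) = 0%E.
Proof.
move=> mA mB A0 B0; apply/eqP; rewrite eq_le measure_ge0 andbT.
have := measureU2 P mA mB; rewrite [X in (X + _)%E]A0 [X in (_ + X)%E]B0.
by rewrite adde0.
Qed.

(* The geodesics from [VA w] through [a] to [V1 w] and [V2 w] agree up to [a]:
   averaging the two couplings gives an optimal plan that branches on every pair. *)
Lemma branching_couplings (m : {measure set (borel X) -> \bar R}) d' (Om : measurableType d')
    (M : probability Om R) (EA E1 E2 : set Om) (VA V1 V2 : Om -> borel X)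
    (a : X) (A D1 D2 : set X) (tau c dl : R) :
  proper_space X -> length_space X -> @second_countable X ->
  compact A -> compact D1 -> compact D2 -> D1 `&` D2 = set0 ->
  0 < tau < 1 -> 0 <= c -> 0 < dl -> (forall v, A v -> dl <= d a v) ->
  (forall v z, A v -> D1 z \/ D2 z -> d v z = d a v + d a z) ->
  measurable EA -> measurable E1 -> measurable E2 ->
  M EA = 1%E -> M E1 = 1%E -> M E2 = 1%E ->
  measurable_fun setT VA -> measurable_fun setT V1 -> measurable_fun setT V2 ->
  (forall N : set (borel X), measurable N -> m N = 0%E ->
    [/\ M (VA @^-1` N) = 0%E, M (V1 @^-1` N) = 0%E & M (V2 @^-1` N) = 0%E]) ->
  (forall w, EA w -> E1 w -> E2 w -> [/\ A (VA w), D1 (V1 w), D2 (V2 w),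
     d a (V1 w) + tau * d a (VA w) = c & d a (V1 w) = d a (V2 w)]) ->
  ~ essentially_nonbranching m.
Proof.
move=> pX lX sX cA cD1 cD2 D12 tau01 c0 dl0 Adl dAD mEA mE1 mE2 EA1 E11 E21 mVA mV1 mV2 ac EP enb.
pose W := EA `&` E1 `&` E2.
have mW : measurable W by apply: measurableI => //; exact: measurableI.
have MW : M W = 1%E.
  apply: (@probability1I _ _ _ M (EA `&` E1) E2) => //; first exact: measurableI.
  exact: (@probability1I _ _ _ M EA E1).
have WP w : W w -> [/\ A (VA w), D1 (V1 w), D2 (V2 w), d a (V1 w) + tau * d a (VA w) = c &
    d a (V1 w) = d a (V2 w)] by move=> [[w0 w1] w2]; exact: EP.
have hX : hausdorff_space X by exact: metric_hausdorff.
have mcp (B : set X) : compact B -> measurable (B : set (borel X)).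
  by move=> cB; apply: closed_borel; exact: compact_closed.
have MWC : M (~` W) = 0%E by exact: probability1C.
have NA (N : set (borel X)) : measurable N -> m N = 0%E -> M (VA @^-1` N) = 0%E.
  by move=> mN /(ac _ mN)[].
have N1 (N : set (borel X)) : measurable N -> m N = 0%E -> M (V1 @^-1` N) = 0%E.
  by move=> mN /(ac _ mN)[].
have N2 (N : set (borel X)) : measurable N -> m N = 0%E -> M (V2 @^-1` N) = 0%E.
  by move=> mN /(ac _ mN)[].
have null0 (Z N : set Om) : measurable Z -> measurable N -> M N = 0%E ->
    Z `&` W `<=` N -> M Z = 0%E.
  move=> mZ mN N0 ZN; apply: (@subset_measure0 _ _ _ M _ (~` W `|` N)) => //.
  - by apply: measurableU => //; exact: measurableC.
  - move=> w Zw; have [Ww|nWw] := pselect (W w); [right; exact: ZN|by left].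
  - by apply: probability_setU0 => //; exact: measurableC.
have [i0 i0E] : exists i : {i01 R}, i = 0%:i01 by exists 0%:i01.
have [i1 i1E] : exists i : {i01 R}, i = 1%:i01 by exists 1%:i01.
have [uA AuA] := compact_sub_cball a cA; have [u1 Du1] := compact_sub_cball a cD1.
have [u2 Du2] := compact_sub_cball a cD2.
(* An upper bound for all lengths of the geodesics. As [a] is at distance at least [dl] from [A], no
   pair separates before the fraction [s0 = dl / b], whatever [w] is; the term [2 * dl] makes [b]
   positive and [s0] less than [1]. *)
pose b : R := `|uA| + `|u1| + 2 * dl.
have b0 : 0 < b by rewrite /b ltr_wpDl ?addr_ge0// mulr_gt0.
pose s0 : R := dl / b.
have s00 : 0 < s0 by rewrite divr_gt0.
have s01 : s0 < 1.
  rewrite ltr_pdivrMr// mul1r /b.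
  by have := normr_ge0 uA; have := normr_ge0 u1; move: dl0; clear; lra.
(* The uniform [s0] makes the admissible pairs a compact set, so a Borel section of [ends] selects
   one pair for each triple of end points. *)
pose KK : set (Geo X * Geo X) := ([set g : Geo X | A (g i0) /\ D1 (g i1)] `*`
    [set g : Geo X | A (g i0) /\ D2 (g i1)]) `&`
  [set g : Geo X * Geo X | forall s : {i01 R}, s%:num <= s0 -> g.1 s = g.2 s].
have cKK : compact KK.
  apply: compact_closedI; last exact: coincidence_closed.
  by rewrite i0E i1E; apply: compact_setX; exact: geo_compact.
pose ends (g : Geo X * Geo X) : X * (X * X) := (g.1 i0, (g.1 i1, g.2 i1)).
have cends : continuous ends.
  have ce1 i : continuous (fun g : Geo X * Geo X => g.1 i).
    move=> [g h]; apply: (@cvg_comp _ _ _ fst (fun k : Geo X => k i) _ (nbhs g)).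
      exact: cvg_fst.
    exact: ev_continuous.
  have ce2 i : continuous (fun g : Geo X * Geo X => g.2 i).
    move=> [g h]; apply: (@cvg_comp _ _ _ snd (fun k : Geo X => k i) _ (nbhs h)).
      exact: cvg_snd.
    exact: ev_continuous.
  by do 2?[apply: pair_continuous].
have Wpair w : W w -> exists2 g, KK g & ends g = (VA w, (V1 w, V2 w)).
  move=> /WP[Av Dz1 Dz2 lev e12].
  have [||||g [h [[g0 g1] [h0 h1] gh]]] := @branching_pair _ _ pX lX a (VA w) (V1 w) (V2 w) s0.
  - by apply: dAD => //; left.
  - by apply: dAD => //; right.
  - exact: e12.
  - apply: le_trans (Adl _ Av); rewrite /s0 mulrAC ler_pdivrMr// ler_pM2l//.
    have := AuA _ Av; have := Du1 _ Dz1; rewrite /cball /= /b => h1 h2.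
    by have := ler_norm uA; have := ler_norm u1; move: dl0 h1 h2; clear; lra.
  by exists (g, h); rewrite /KK /ends /= i0E i1E ?g0 ?g1 ?h0 ?h1.
have [w0 W0] : W !=set0.
  by apply/set0P/eqP => h; move: MW; rewrite h measure0 => /eqP; rewrite eq_sym onee_eq0.
have hG : hausdorff_space (Geo X * Geo X)%type.
  by apply: hausdorff_prod; exact: metric_hausdorff.
have KK0 : KK !=set0 by have [g Kg _] := Wpair _ W0; exists g.
have [k [kK mk] ksec] := borel_section hG cKK KK0.
have hL : hausdorff_space (X * (X * X))%type by do 2?[apply: hausdorff_prod => //].
have [cc mcc [_ ccE]] := ksec (X * (X * X))%type ends hL cends.
have mV : measurable_fun setT (fun w => (VA w, (V1 w, V2 w)) : borel (X * (X * X))%type).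
  apply: measurable_fun_pair_borel => //; first exact: second_countable_prod.
  exact: measurable_fun_pair_borel.
pose Gm (w : Om) : borel (Geo X * Geo X)%type := k (cc (VA w, (V1 w, V2 w))).
have mGm : measurable_fun setT Gm by exact: (measurableT_comp mk (measurableT_comp mcc mV)).
have mfst : measurable_fun setT (fst : borel (Geo X * Geo X)%type -> borel (Geo X)).
  by apply: (@continuous_borel (Geo X * Geo X)%type (Geo X) fst) => x; exact: cvg_fst.
have msnd : measurable_fun setT (snd : borel (Geo X * Geo X)%type -> borel (Geo X)).
  by apply: (@continuous_borel (Geo X * Geo X)%type (Geo X) snd) => x; exact: cvg_snd.
have mG1 := measurableT_comp mfst mGm; have mG2 := measurableT_comp msnd mGm.
have GmK w : KK (Gm w) by exact: kK.
have GmE w : W w -> ends (Gm w) = (VA w, (V1 w, V2 w)).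
  by move=> /Wpair[g Kg gE]; apply: ccE; exists g.
have coin w s : s%:num <= s0 -> (Gm w).1 s = (Gm w).2 s by case: (GmK w) => _; apply.
have g10 w : W w -> (Gm w).1 i0 = VA w by move=> /GmE[].
have g11 w : W w -> (Gm w).1 i1 = V1 w by move=> /GmE[].
have g21 w : W w -> (Gm w).2 i1 = V2 w by move=> /GmE[].
have g20 w : W w -> (Gm w).2 i0 = VA w.
  by move=> Ww; rewrite -coin ?g10// i0E /= ltW.
have [Q1 Q1E] := image_probability M mG1; have [Q2 Q2E] := image_probability M mG2.
have [P PE] := half_sum_probability Q1 Q2.
have P0 S : measurable S -> P S = 0%E <-> Q1 S = 0%E /\ Q2 S = 0%E.
  move=> mS; split => [|[q1 q2]]; last by rewrite (PE _ mS) q1 q2 adde0 mul0e.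
  move=> h; have := esym (etrans (esym (PE _ mS)) h) => /esym/eqP.
  rewrite mule_eq0 eqe invr_eq0 pnatr_eq0 orbF => /eqP hs.
  have := measure_ge0 Q1 S; have := measure_ge0 Q2 S => q2 q1.
  by split; apply/eqP; rewrite eq_le ?q1 ?q2 andbT -hs ?leeDl ?leeDr.
have Pnull (S : set (borel (Geo X))) (N1' N2' : set Om) : measurable S ->
    measurable N1' -> measurable N2' -> M N1' = 0%E -> M N2' = 0%E ->
    (forall w, W w -> S (Gm w).1 -> N1' w) -> (forall w, W w -> S (Gm w).2 -> N2' w) ->
    P S = 0%E.
  move=> mS mN1 mN2 N10 N20 h1 h2; apply/P0 => //; split.
    apply: (eq_trans (Q1E _)); apply: null0 mN1 N10 _.
      by rewrite -[X in measurable X]setTI; exact: mG1.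
    by move=> w [Sw Ww]; exact: h1.
  apply: (eq_trans (Q2E _)); apply: null0 mN2 N20 _.
    by rewrite -[X in measurable X]setTI; exact: mG2.
  by move=> w [Sw Ww]; exact: h2.
have Pone (S : set (borel (Geo X))) : measurable S ->
    (forall w, W w -> S (Gm w).1 /\ S (Gm w).2) -> P S = 1%E.
  move=> mS h; apply: probability0C => //.
  by apply: (Pnull _ set0 set0) => // [|w /h[] |w /h[]]//; exact: measurableC.
pose mu0 : probability (borel X) R := distribution P (ev i0).
pose mu1 : probability (borel X) R := distribution P (ev i1).
have mev i (S : set (borel X)) : measurable S -> measurable (ev i @^-1` S).
  by move=> mS; rewrite -[X in measurable X]setTI; exact: (ev_measurable i).
have mu0A : mu0 A = 1%E.
  apply: (Pone (ev i0 @^-1` A)); first by apply: mev; apply: mcp.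
  by move=> w Ww; rewrite /= /ev g10// g20//; case: (WP _ Ww).
have mD := measurableU _ _ (mcp _ cD1) (mcp _ cD2).
have mu1D : mu1 (D1 `|` D2) = 1%E.
  apply: (Pone (ev i1 @^-1` (D1 `|` D2))); first exact: mev.
  by move=> w Ww; rewrite /= /ev g11// g21//; case: (WP _ Ww); split; [left|right].
have bnd (mu : probability (borel X) R) (S : set (borel X)) r : measurable S -> mu S = 1%E ->
    (forall x, S x -> d a x <= r) -> P2 mu.
  move=> mS S1 Sr; exists a; apply: (@le_lt_trans _ _ (r ^+ 2)%:E); last exact: ltry.
  apply: integral_le_cst mS S1 _ _ _.
  - apply/measurable_EFinP/measurable_funX.
    by apply: (@continuous_borel_real R X); exact: mdist_continuous.
  - by move=> x; rewrite lee_fin sqr_ge0.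
  - move=> x Sx; rewrite lee_fin lerXn2r ?nnegrE ?mdist_ge0 ?Sr//.
    by rewrite (le_trans (mdist_ge0 a x)) ?Sr.
have Dr z : (D1 `|` D2) z -> d a z <= `|u1| + `|u2|.
  by move=> [/Du1|/Du2] h; apply: le_trans h _; apply: (le_trans (ler_norm _));
    rewrite ?lerDl ?lerDr.
have ac0 : P2ac m mu0.
  split; first exact: bnd (mcp _ cA) mu0A AuA.
  apply/null_content_dominatesP => N mN N0; apply: (Pnull (ev i0 @^-1` N) (VA @^-1` N) (VA @^-1` N)).
  - exact: mev.
  - by rewrite -[X in measurable X]setTI; exact: mVA.
  - by rewrite -[X in measurable X]setTI; exact: mVA.
  - exact: NA.
  - exact: NA.
  - by move=> w Ww; rewrite /= /ev g10.
  - by move=> w Ww; rewrite /= /ev g20.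
have ac1 : P2ac m mu1.
  split; first exact: bnd mD mu1D Dr.
  apply/null_content_dominatesP => N mN N0; apply: (Pnull (ev i1 @^-1` N) (V1 @^-1` N) (V2 @^-1` N)).
  - exact: mev.
  - by rewrite -[X in measurable X]setTI; exact: mV1.
  - by rewrite -[X in measurable X]setTI; exact: mV2.
  - exact: N1.
  - exact: N2.
  - by move=> w Ww; rewrite /= /ev g11.
  - by move=> w Ww; rewrite /= /ev g21.
have opt : OptGeo mu0 mu1 P.
  apply: (@antitone_coupling_optimal _ _ mu0 mu1 (distribution P ev01) A (D1 `|` D2) a tau c
    uA (`|u1| + `|u2|)) => //.
  - exact: mcp.
  - by move=> S mS; rewrite /mu0 /mu1 i0E i1E; split.
  pose lv (z : X * X) := d a z.2 + tau * d a z.1.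
  have mlv : measurable_fun setT (lv : borel (X * X)%type -> measurableTypeR R).
    apply: measurable_funD; first exact: measurable_mdist_snd.
    by apply: measurable_funM => //; exact: measurable_mdist_fst.
  have mE : measurable (lv @^-1` [set c] : set (borel (X * X)%type)).
    by rewrite -[X in measurable X]setTI; apply: mlv.
  exists (lv @^-1` [set c]) => //; split => //.
  apply: (Pone (ev01 @^-1` (lv @^-1` [set c]))).
    by rewrite -[X in measurable X]setTI; exact: ev01_measurable.
  move=> w Ww; rewrite /= /lv /ev01 -i0E -i1E /= g10// g20// g11// g21//.
  by have [_ _ _ e <-] := WP _ Ww; split.
have [G [mG PG nbG]] := enb mu0 mu1 ac0 ac1 P opt.
have [q1 q2] : Q1 (~` G) = 0%E /\ Q2 (~` G) = 0%E.
  by apply/P0 => //; exact: measurableC.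
(* A set null for the average is null for both families, so at almost every [w] both geodesics of
   the pair lie in the non-branching set. *)
have [w [Ww Gw1 Gw2]] : exists w, [/\ W w, G (Gm w).1 & G (Gm w).2].
  apply: contrapT => nex.
  have : M W = 0%E; last by rewrite MW => /eqP; rewrite onee_eq0.
  apply: (@subset_measure0 _ _ _ M _ ((fst \o Gm) @^-1` (~` G) `|` (snd \o Gm) @^-1` (~` G))) => //.
  - apply: measurableU; rewrite -[X in measurable X]setTI; [apply: mG1|apply: mG2] => //;
      exact: measurableC.
  - move=> w Ww; apply: contrapT => /not_orP[/contrapT Gw1 /contrapT Gw2].
    by apply: nex; exists w.
  - apply: probability_setU0; last 2 first.
    - exact: (eq_trans (esym (Q1E _))).
    - exact: (eq_trans (esym (Q2E _))).
    - by rewrite -[X in measurable X]setTI; apply: mG1 => //; exact: measurableC.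
    - by rewrite -[X in measurable X]setTI; apply: mG2 => //; exact: measurableC.
have : (Gm w).1 = (Gm w).2.
  apply: nbG => //.
  exists (Itv01 (ltW s00) (ltW s01)); split; first by rewrite /= s00 s01.
  by move=> s; exact: coin.
move=> /(congr1 (fun g : Geo X => g i1)); rewrite g11// g21// => e.
have [_ Dz1 Dz2 _ _] := WP _ Ww; have : (D1 `&` D2) (V1 w) by split => //; rewrite e.
by rewrite D12.
Qed.

Local Notation U := (@uniform_prob R 0 1 ltr01).
Local Notation RR := (measurableTypeR R * measurableTypeR R)%type.

(** The hypotheses on [J] make the law of [c - tau * d a v] on [A] absolutely continuous with
    respect to the law of the level on [D1] and on [D2]. Hence the points of [D1] and [D2] may be
    selected over the level law of [A] instead of their own, and the selections still charge no
    [m]-null set. *)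
Lemma branching_geodesics (m : {measure set (borel X) -> \bar R})
    (a : X) (A D1 D2 : set X) (tau c dl : R) :
  proper_space X -> length_space X -> @second_countable X ->
  (forall p : X, exists2 O : set X, open_nbhs p O & (m O < +oo)%E) ->
  compact A -> compact D1 -> compact D2 -> D1 `&` D2 = set0 -> (0 < m A)%E ->
  0 < tau < 1 -> 0 <= c -> 0 < dl -> (forall v, A v -> dl <= d a v) ->
  (forall v z, A v -> D1 z \/ D2 z -> d v z = d a v + d a z) ->
  (forall J : set (measurableTypeR R), measurable J ->
     m (D1 `&` [set z | J (d a z)]) = 0%E ->
     m (A `&` [set v | J (c - tau * d a v)]) = 0%E) ->
  (forall J : set (measurableTypeR R), measurable J ->
     m (D2 `&` [set z | J (d a z)]) = 0%E ->
     m (A `&` [set v | J (c - tau * d a v)]) = 0%E) ->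
  ~ essentially_nonbranching m.
Proof.
move=> pX lX sX fX cA cD1 cD2 D12 A0 tau01 c0 dl0 Adl dAD J1 J2.
have hX : hausdorff_space X by exact: metric_hausdorff.
have mcp (B : set X) : compact B -> measurable (B : set (borel X)).
  by move=> cB; apply: closed_borel; exact: compact_closed.
have cda : continuous (d a) by exact: mdist_continuous.
have clev : continuous (fun v => c - tau * d a v).
  by move=> v; apply: cvgB; [exact: cvg_cst|apply: cvgM; [exact: cvg_cst|exact: cda]].
have Afin := compact_finite_measure fX cA.
have [PA [PA1 PAE]] := restriction_probability (mcp _ cA) A0 Afin.
have [kA [VA [EA [kAE mVA VAE [mEA EA1] EAP]]]] := compact_disintegration cA PA1 clev.
have side (D : set X) : compact D ->
    (forall J : set (measurableTypeR R), measurable J ->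
       m (D `&` [set z | J (d a z)]) = 0%E ->
       m (A `&` [set v | J (c - tau * d a v)]) = 0%E) ->
    exists (V : RR -> borel X) (E : set RR),
    [/\ measurable_fun setT V, measurable E, (kA \x U)%E E = 1%E,
      forall w, E w -> D (V w) /\ d a (V w) = w.1 &
      forall N, measurable N -> m N = 0%E -> (kA \x U)%E (V @^-1` N) = 0%E].
  move=> cD JD.
  have D0 : (0 < m D)%E.
    rewrite lt0e measure_ge0 andbT; apply/eqP => D0.
    have := JD setT measurableT; rewrite !setIT => /(_ D0) h.
    by move: A0; rewrite h ltxx.
  have [P [P1 PE]] := restriction_probability (mcp _ cD) D0 (compact_finite_measure fX cD).
  have [k [V [E [kE mV VE [mE E1] EP]]]] := compact_disintegration cD P1 cda.
  have dom J : measurable J -> k J = 0%E -> kA J = 0%E.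
    move=> mJ; rewrite kE => /PE; rewrite setIC => /(JD J mJ) h.
    by apply: (eq_trans (kAE _)); apply/PAE; rewrite setIC.
  exists V, E; split; [exact: mV|exact: mE| |exact: EP|].
    have h : (kA \x U)%E (~` E) = 0%E.
      apply: (@prod_null_dominates _ kA k) => //; first exact: measurableC.
      exact: probability1C.
    exact: probability0C.
  move=> N mN N0; apply: (@prod_null_dominates _ kA k) => //.
    by rewrite -[V @^-1` N]setTI; exact: mV.
  apply: (eq_trans (VE _ mN)); apply/PE.
  apply: (@subset_measure0 _ _ _ m _ N) => //.
  by apply: measurableI => //; exact: mcp.
have [V1 [E1 [mV1 mE1 E11 E1P N1]]] := side D1 cD1 J1.
have [V2 [E2 [mV2 mE2 E21 E2P N2]]] := side D2 cD2 J2.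
pose M : probability RR R := (kA \x U)%E.
apply: (@branching_couplings m _ _ M EA E1 E2 VA V1 V2 a A D1 D2 tau c dl pX lX sX cA cD1 cD2
  D12 tau01 c0 dl0 Adl dAD mEA mE1 mE2 EA1 E11 E21 mVA mV1 mV2).
  move=> N mN N0; split; [|exact: N1|exact: N2].
  apply: (eq_trans (VAE _ mN)); apply/PAE; apply: (@subset_measure0 _ _ _ m _ N) => //.
  by apply: measurableI => //; exact: mcp.
move=> w /EAP[Av lA] /E1P[D1z l1] /E2P[D2z l2]; split => //; last by rewrite l1 l2.
by rewrite l1 -lA subrK.
Qed.

End branching.

Section toward_iteration.
Context {R : realType} {X : metricType R}.
Local Notation d := (@mdist R X).

Lemma toward_half (t : R) (A : set X) (p : X) :
  toward 2^-1 (toward t A p) p `<=` toward (t / 2) A p.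
Proof.
move=> z [y [v Av [yp vy]] [zp yz]]; exists v => //.
have h1 := metric_triangle v y z; have h2 := metric_triangle v z p.
have zE : d z p = t / 2 * d v p by rewrite zp yp; ring.
by split=> //; apply/eqP; rewrite eq_le; apply/andP; split; lra.
Qed.

Lemma toward_compact (t : R) (A : set X) (p : X) : proper_space X ->
  compact A -> compact (toward t A p).
Proof.
move=> pX cA; have [r Ar] := compact_sub_cball p cA.
have -> : toward t A p = snd @` ((A `*` cball p (`|t| * r)) `&`
    [set z : X * X | d p z.2 = t * d p z.1 /\ d z.1 z.2 = (1 - t) * d p z.1]).
  apply/seteqP; split => [z [v Av [zp vz]]|_ [[v z] /= [[Av _] [pz vz]] <-]].
    exists (v, z); split => //=; last first.
      by rewrite (metric_sym p z) (metric_sym p v).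
    split => //; rewrite /cball /= metric_sym zp.
    have : d v p <= r by rewrite metric_sym; exact: Ar.
    move=> vr; rewrite (le_trans (ler_wpM2r (mdist_ge0 _ _) (ler_norm t)))//.
    by rewrite ler_wpM2l.
  by exists v => //; rewrite metric_sym pz vz (metric_sym v p).
apply: (@continuous_compact _ _ snd).
  by apply: continuous_subspaceT => z; exact: cvg_snd.
apply: compact_closedI; first exact: compact_setX.
pose f1 (z : X * X) : R := d p z.2 - t * d p z.1.
pose f2 (z : X * X) : R := d z.1 z.2 - (1 - t) * d p z.1.
have -> : [set z : X * X | d p z.2 = t * d p z.1 /\ d z.1 z.2 = (1 - t) * d p z.1] =
    f1 @^-1` [set 0] `&` f2 @^-1` [set 0].
  apply/seteqP; split => z [/eqP h1 /eqP h2]; split; apply/eqP;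
    rewrite /f1 /f2 ?subr_eq0//.
  - by rewrite -subr_eq0.
  - by rewrite -subr_eq0.
have cf (z : X * X) : (fun z => d p z.1) @ z --> d p z.1.
  by apply: (@mdist_cvg _ _ _ _ _ (fun=> p) fst); [exact: cvg_cst|exact: cvg_fst].
have cs (z : X * X) : (fun z => d p z.2) @ z --> d p z.2.
  by apply: (@mdist_cvg _ _ _ _ _ (fun=> p) snd); [exact: cvg_cst|exact: cvg_snd].
have cd (z : X * X) : (fun z => d z.1 z.2) @ z --> d z.1 z.2.
  by apply: (@mdist_cvg _ _ _ _ _ fst snd); [exact: cvg_fst|exact: cvg_snd].
apply: closedI; apply: closed_comp; try exact: closed_eq.
  by move=> z _; apply: cvgB; [exact: cs|apply: cvgM; [exact: cvg_cst|exact: cf]].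
by move=> z _; apply: cvgB; [exact: cd|apply: cvgM; [exact: cvg_cst|exact: cf]].
Qed.

(* Every geodesic from [v] to [p] passes through [a]. *)
Definition cut_point (a v p : X) := d v p = d v a + d a p /\
  forall z, d v z + d z p = d v p -> d v z = d v a -> z = a.

End toward_iteration.

(** * Points common to all geodesics *)

Section cut_points.
Context {R : realType} {X : pmetricType R} (m : {measure set (borel X) -> \bar R}).
Context (pX : proper_space X) (lX : length_space X) (sX : @second_countable X).
Context (fX : forall p : X, exists2 O : set X, open_nbhs p O & (m O < +oo)%E).
Context (oX : forall O : set X, open O -> O !=set0 -> (0 < m O)%E).
Context (enb : essentially_nonbranching m).
Context (rho : R) (rho0 : 0 < rho).
Context (nd : forall x0 : X, exists2 c : R, 0 < c &
    forall (p : X) (A B : set (borel X)), ball x0 rho p ->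
      measurable A -> measurable B -> A `<=` ball p rho ->
      toward 2^-1 A p `<=` B -> (c%:E * m A <= m B)%E).
Local Notation d := (@mdist R X).

Let compact_measurable (A : set X) : compact A -> measurable (A : set (borel X)).
Proof. by move=> cA; apply: closed_borel; apply: compact_closed => //; exact: metric_hausdorff. Qed.

Let measurable_level (k : R) (p : X) (J : set (measurableTypeR R)) : measurable J ->
  measurable ([set v | J (k * d v p)%R] : set (borel X)).
Proof.
move=> mJ; rewrite -[X in measurable X]setTI.
have h : measurable_fun setT ((fun v => k * d v p) : borel X -> measurableTypeR R).
  apply: continuous_borel_real => v; apply: cvgM; first exact: cvg_cst.
  by apply: (@mdist_cvg _ _ _ _ _ id (fun=> p)); [exact: cvg_id|exact: cvg_cst].
exact: h.
Qed.

(** Halving towards [p] halves the distance to [p], so a condition on that distance is preserved up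
    to the factor [2 ^+ n]. A null image forces a null source at each of the [n] steps. *)
Lemma toward_null (n : nat) (A : set X) (p : X) (J : set (measurableTypeR R)) :
  compact A -> A `<=` ball p rho -> measurable J ->
  m (toward (2^-1 ^+ n) A p `&` [set z | J (2 ^+ n * d z p)]) = 0%E ->
  m (A `&` [set v | J (d v p)]) = 0%E.
Proof.
move=> cA Ar mJ.
have mB k : measurable (toward (2^-1 ^+ k) A p `&` [set z | J (2 ^+ k * d z p)] : set (borel X)).
  apply: measurableI; last exact: measurable_level.
  by apply: compact_measurable; exact: toward_compact.
have t1 k : 0 <= (2^-1 : R) ^+ k <= 1.
  by rewrite exprn_ge0 ?invr_ge0 ?ler0n//= exprn_ile1 ?invr_ge0 ?ler0n// invf_le1 ?ltr0n// ler1n.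
elim: n => [|n IHn] h.
  apply: (@subset_measure0 _ _ _ m _ _ _ (mB 0%N) _ h).
    apply: measurableI; first exact: compact_measurable.
    have := measurable_level 1 p mJ; congr measurable.
    by apply/seteqP; split => v; rewrite /= mul1r.
  move=> v [Av Jv]; split; last by rewrite /= expr0 mul1r.
  by exists v => //; rewrite expr0 mul1r subrr mul0r mdistxx.
apply: IHn; have [c c0 cP] := nd p.
have h1 := cP p _ _ (ballxx _ rho0) (mB n) (mB n.+1).
pose S : set (borel X) := toward (2^-1 ^+ n) A p `&` [set z | J (2 ^+ n * d z p)].
have {}h1 : (c%:E * m S <= 0)%E.
  rewrite -h; apply: h1.
    move=> z [[v Av [zp _]] _]; rewrite ballE /= metric_sym zp.
    have vr : d v p < rho by have := Ar _ Av; rewrite ballE /= metric_sym.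
    by apply: le_lt_trans vr; rewrite ler_piMl ?mdist_ge0//; case/andP: (t1 n).
  move=> z [y [Ay Jy] [zp yz]]; split.
    by rewrite exprSr; apply: toward_half; exists y.
  by rewrite /= zp exprSr -mulrA (mulrA 2) divff// mul1r.
have h2 : (c%:E * m S)%E = 0%E.
  by apply/eqP; rewrite eq_le h1 mule_ge0// lee_fin ltW.
by move/eqP: h2; rewrite mule_eq0 eqe gt_eqF//= => /eqP.
Qed.

(** If [z] is reached from [v] with the fraction [t] of the way left, then
    [d a z = (1 - t) * w - t * d a v]. Since [w] is the distance from [a] to both [p1] and [p2], the
    two targets have the same level map, as [branching_geodesics] requires. *)
Lemma cut_points_unique (a v0 p1 p2 : X) (eta : R) : 0 < eta ->
  (forall v, ball v0 eta v -> cut_point a v p1 /\ cut_point a v p2) ->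
  eta <= d a v0 -> d v0 p1 + eta <= rho -> d v0 p2 + eta <= rho ->
  d a p1 = d a p2 -> p1 = p2.
Proof.
move=> eta0 cut av0 r1 r2 ap12; apply: contrapT => p12.
pose w := d a p1; pose u0 := d a v0 + eta.
have w0 : 0 < w.
  rewrite lt_neqAle mdist_ge0 andbT; apply/eqP => h; apply: p12.
  have e1 : a = p1 by apply: mdist_positivity; exact: esym h.
  by rewrite -e1; apply: mdist_positivity; rewrite -ap12; exact: esym h.
have p120 : 0 < d p1 p2.
  by rewrite lt_neqAle mdist_ge0 andbT; apply/eqP => h; apply: p12;
    by apply: mdist_positivity; exact: esym h.
have u00 : 0 <= u0 by rewrite /u0 addr_ge0 ?mdist_ge0 ?ltW.
(* With [t < e], the part [t * (u0 + w)] that is left at most is shorter than [w], so the targets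
   lie beyond [a], and shorter than half of [d p1 p2], so they are disjoint. A power of [1/2] is
   taken in order to iterate halving. *)
pose e : R := Num.min w (d p1 p2 / 2) / (u0 + w).
have e0 : 0 < e by rewrite divr_gt0 ?lt_min ?w0 ?divr_gt0//= ltr_wpDl.
have [n ne] : exists n : nat, 2^-1 ^+ n < e.
  have [n _ nP] := near_infty_natSinv_expn_lt (PosNum e0).
  by exists n; have := nP n (leqnn n); rewrite /= exprVn div1r.
pose t : R := 2^-1 ^+ n.
have t0 : 0 < t by rewrite exprn_gt0// invr_gt0.
have tw : t * (u0 + w) < w /\ t * (u0 + w) < d p1 p2 / 2.
  have : t * (u0 + w) < Num.min w (d p1 p2 / 2) by rewrite -ltr_pdivlMr// ltr_wpDl.
  by rewrite lt_min => /andP[].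
have t1 : t < 1.
  rewrite -(ltr_pM2r w0) mul1r; apply: le_lt_trans tw.1.
  by rewrite ler_pM2l// lerDr.
pose A := cball v0 (eta / 2).
have cA : compact A by exact: pX.
have Aball v : A v -> ball v0 eta v.
  by rewrite /A /cball ballE /= => /le_lt_trans; apply; rewrite ltr_pdivrMr// ltr_pMr// ltr1n.
have Au v : A v -> eta / 2 <= d a v <= u0.
  rewrite /A /cball /= /u0 => h; have h1 := metric_triangle a v v0; rewrite (metric_sym v v0) in h1.
  by have h2 := metric_triangle a v0 v; apply/andP; split; move: av0 eta0 h h1 h2; lra.
have half p : (forall v, ball v0 eta v -> cut_point a v p) -> d a p = w ->
    d v0 p + eta <= rho ->
    [/\ (forall v z, A v -> toward t A p z -> d v z = d a v + d a z),
      (forall z, toward t A p z -> d z p < d p1 p2 / 2) &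
      (forall J : set (measurableTypeR R), measurable J ->
        m (toward t A p `&` [set z | J (d a z)]) = 0%E ->
        m (A `&` [set v | J ((1 - t) * w - t * d a v)]) = 0%E)].
  move=> cutp apw pr.
  have vp v : A v -> d v p = d a v + w.
    by move=> /Aball/cutp[-> _]; rewrite apw metric_sym.
  have az v z : A v -> d z p = t * d v p -> d v z = (1 - t) * d v p ->
      d a z = (1 - t) * w - t * d a v.
    move=> Av zp vz; have [_ cutv] := cutp _ (Aball _ Av).
    have vzp : d v z + d z p = d v p by rewrite zp vz; ring.
    have [g [ug g0 gz g1]] := unit_geodesic_through pX lX vzp.
    have /andP[_ Avu] := Au _ Av.
    have tle : t * d v p <= w.
      rewrite (vp _ Av); apply: le_trans (ltW tw.1).
      by rewrite ler_pM2l// lerD2r.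
    have d0 := mdist_ge0 a v.
    have lvz : d a v <= d v z by rewrite vz (vp _ Av) in tle *; move: tle; lra.
    have vzL : 0 <= d v z <= d v p by rewrite mdist_ge0 vz ler_piMl ?mdist_ge0// lerBlDr lerDl ltW.
    have avL : 0 <= d a v <= d v p by rewrite d0 (vp _ Av) lerDl ltW.
    have vpL : 0 <= d v p <= d v p by rewrite mdist_ge0 lexx.
    have L0 : 0 <= (0 : R) <= d v p by rewrite lexx mdist_ge0.
    have ga : g (d a v) = a.
      have e1 : d v (g (d a v)) = d a v by rewrite -{1}g0 ug// subr0 ger0_norm.
      apply: cutv; last by rewrite e1 metric_sym.
      have e2 : d (g (d a v)) p = d v p - d a v.
        by rewrite -[X in d _ X = _]g1 ug// ger0_norm ?subr_ge0//; case/andP: avL.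
      by rewrite e1 e2 addrC subrK.
    have := ug _ _ avL vzL; rewrite ga gz ger0_norm ?subr_ge0// => ->.
    by rewrite vz (vp _ Av); ring.
  have zp0 z : toward t A p z -> exists2 v, A v & [/\ d z p = t * d v p,
      d a z = (1 - t) * w - t * d a v & d v p = d a v + w].
    by move=> [v Av [zp vz]]; exists v => //; split; [|exact: az|exact: vp].
  split.
  (* Here [z] may come from another point [v'] of [A]; the lower bound is the triangle inequality
     for the way from [v] to [p] through [z]. *)
  - move=> v z Av /zp0[v' Av' [zp azE vpE]]; apply/eqP; rewrite eq_le.
    rewrite (le_trans (metric_triangle v a z)) ?(metric_sym v a)//=.
    have := metric_triangle v z p; rewrite (vp _ Av) zp vpE azE; lra.
  - move=> z /zp0[v Av [-> _ ->]]; apply: le_lt_trans tw.2; rewrite ler_pM2l// lerD2r.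
    by have /andP[] := Au _ Av.
  - move=> J mJ h.
    (* The same condition in terms of [r = d v p], which exceeds [d a v] by [w]; this is the form
       that [toward_null] transports. *)
    pose J' : set (measurableTypeR R) := [set r : R | J ((1 - t) * w - t * (r - w))].
    have mJ' : measurable J'.
      rewrite -[X in measurable X]setTI.
      have h' : measurable_fun setT ((fun r : R => (1 - t) * w - t * (r - w)) :
        measurableTypeR R -> measurableTypeR R).
        by apply: measurable_funB => //; apply: measurable_funM => //; exact: measurable_funB.
      exact: h'.
    have tE : 2 ^+ n * t = 1 by rewrite /t exprVn divff// expf_neq0.
    have Ar : A `<=` ball p rho.
      move=> v Av; rewrite ballE /=; have := Aball _ Av.
      rewrite ballE /= metric_sym => h1; have := metric_triangle v v0 p.
      by rewrite (metric_sym p v); move: h1 pr; lra.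
    have n0 : m (toward t A p `&` [set z | J' (2 ^+ n * d z p)%R]) = 0%E.
      rewrite -h; congr (m _); apply/seteqP; split => z [Dz Jz]; split => //;
        move: (Dz) Jz => /zp0[v Av [zp azE vpE]]; rewrite /J' /= zp azE vpE mulrA tE mul1r addrK//.
    rewrite -(toward_null cA Ar mJ' n0); congr (m _).
    by apply/seteqP; split => v [Av Jv]; split => //; move: Jv; rewrite /J' /= (vp _ Av) addrK.
have [dA1 D1p J1] := half p1 (fun v vb => (cut v vb).1) erefl r1.
have [dA2 D2p J2] := half p2 (fun v vb => (cut v vb).2) (esym ap12) r2.
apply: (@branching_geodesics R X m a A (toward t A p1) (toward t A p2) t ((1 - t) * w) (eta / 2)) => //.
- exact: toward_compact.
- exact: toward_compact.
- apply/seteqP; split => // z [/D1p h1 /D2p h2].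
  by have := metric_triangle p1 z p2; rewrite (metric_sym p1 z); move: h1 h2; lra.
- apply: (@lt_le_trans _ _ (m (ball v0 (eta / 2)))).
    apply: oX; first exact: mball_open.
    by exists v0; apply: ballxx; rewrite divr_gt0.
  rewrite le_measure ?inE//.
  + by apply: sub_sigma_algebra; exact: mball_open.
  + exact: compact_measurable.
  + by move=> v; rewrite ballE /A /cball /= => /ltW.
- by rewrite t0.
- by rewrite mulr_ge0 ?subr_ge0 ?ltW.
- by rewrite divr_gt0.
- by move=> v /Au/andP[].
- by move=> v z Av [/dA1|/dA2]; apply.
Qed.

End cut_points.

(** * Tangents as ultralimits *)

Section packing.
Context {R : realType} {X : pmetricType R} (m : {measure set (borel X) -> \bar R}).
Local Notation d := (@mdist R X).

Definition separated (e : R) (s : seq X) := pairwise (fun p q => e <= d p q) s.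

(* Halving towards the centre makes [m] doubling on small balls. *)
Lemma nondegenerate_packing (x : X) (K e : R) : proper_space X ->
  (forall p : X, exists2 O : set X, open_nbhs p O & (m O < +oo)%E) ->
  (forall O : set X, open O -> O !=set0 -> (0 < m O)%E) -> nondegenerate m ->
  0 < K -> 0 < e -> exists N : nat, exists2 r0 : R, 0 < r0 &
    forall r, 0 < r <= r0 -> forall s, separated (e * r) s ->
      (forall p, p \in s -> d x p <= K * r) -> (size s <= N)%N.
Proof.
move=> pX fX oX [rho rho0 nd] K0 e0; have [c c0 cP] := nd x.
have mball p t : measurable (ball p t : set (borel X)).
  by apply: sub_sigma_algebra; exact: mball_open.
have halve p t : ball x rho p -> 2 * t <= rho ->
    (c%:E * m (ball p (2 * t)%R) <= m (ball p t))%E.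
  move=> xp t2; apply: (cP p) => //.
    by move=> v; rewrite !ballE /= => /lt_le_trans; apply.
  move=> z [v]; rewrite !ballE /= (metric_sym p v) (metric_sym p z) => pv [-> _].
  by move: pv; lra.
have halven n p t : ball x rho p -> 2 ^+ n * t <= rho -> 0 < t ->
    ((c ^+ n)%:E * m (ball p (2 ^+ n * t)%R) <= m (ball p t))%E.
  move=> xp; elim: n t => [|n IHn] t tr t0; first by rewrite expr0 mul1e expr0 mul1r.
  have t20 : 0 < 2 * t by rewrite mulr_gt0.
  have tr' : 2 ^+ n * (2 * t) <= rho by rewrite mulrA -exprSr.
  have h2 : 2 * t <= rho.
    apply: le_trans tr'; rewrite ler_peMl ?(ltW t20)//.
    by rewrite exprn_ege1// ler1n.
  apply: le_trans (halve p t xp h2); rewrite exprS EFinM -muleA lee_pmul2l ?lte_fin//.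
  by have := IHn (2 * t) tr' t20; rewrite mulrA -exprSr.
(* The ball of radius [(2 * K + e) * r] around a point within [K * r] of [x] contains [V], and [J]
   halvings reduce its radius to at most [e / 2 * r]. *)
have [J JP] : exists J : nat, 2 * K + e <= 2 ^+ J * (e / 2).
  have b0 : 0 < (2 * K + e) / (e / 2) by rewrite divr_gt0 ?addr_gt0 ?mulr_gt0 ?divr_gt0.
  exists (Num.bound ((2 * K + e) / (e / 2))); rewrite -ler_pdivrMr ?divr_gt0//.
  apply: ltW; apply: (lt_trans (archi_boundP (ltW b0))).
  by rewrite -natrX ltr_nat ltn_expl.
have J0 : 0 < 2 ^+ J * (e / 2) by apply: mulr_gt0; [exact: exprn_gt0|exact: divr_gt0].
(* The balls of radius [e / 2 * r] around separated points are disjoint, lie in [V], and each has at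
   least the share [c ^+ J] of its measure. *)
pose N := Num.bound ((c ^+ J)^-1).
exists N, (rho / (2 ^+ J * (e / 2))); first exact: divr_gt0.
move=> r /andP[r0 rr] s sep sK.
have rr' : 2 ^+ J * (e / 2 * r) <= rho.
  by rewrite mulrA mulrC -ler_pdivlMr.
pose V := ball x ((K + e) * r).
have V0 : (0 < m V)%E.
  apply: oX; first exact: mball_open.
  by exists x; apply: ballxx; rewrite mulr_gt0 ?addr_gt0.
have Vfin : (m V < +oo)%E.
  apply: (@le_lt_trans _ _ (m (cball x ((K + e) * r)))).
    apply: le_measure; rewrite ?inE; [exact: mball|apply: (@closed_borel X); exact: cball_closed|].
    by move=> v; rewrite /V ballE /cball /= => /ltW.
  exact: compact_finite_measure (pX _ _).
pose v := fine (m V).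
have vE : m V = v%:E by rewrite fineK// ge0_fin_numE// ltW.
have v0 : 0 < v by rewrite -lte_fin -vE.
have hsmall : (K + e) * r <= rho.
  apply: le_trans rr'; rewrite mulrA ler_pM2r//; apply: le_trans JP.
  by rewrite lerD2r; move: K0; lra.
have KJ : K * r < rho.
  by apply: lt_le_trans hsmall; rewrite ltr_pM2r// ltrDl.
have one p : d x p <= K * r -> ((c ^+ J * v)%:E <= m (ball p (e / 2 * r)))%E.
  move=> xp; rewrite EFinM -vE.
  have xp' : ball x rho p by rewrite ballE /=; exact: le_lt_trans xp KJ.
  have er0 : 0 < e / 2 * r by rewrite mulr_gt0 ?divr_gt0.
  apply: le_trans (halven J p _ xp' rr' er0).
  rewrite lee_pmul2l ?lte_fin ?exprn_gt0//.
  apply: le_measure; rewrite ?inE; [exact: mball|exact: mball|].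
  move=> q; rewrite /V !ballE /= => xq.
  have h := metric_triangle p x q; rewrite (metric_sym p x) in h.
  have : (2 * K + e) * r <= 2 ^+ J * (e / 2 * r) by rewrite (mulrA _ _ r) ler_pM2r.
  by move: xp xq h; rewrite !mulrDl; lra.
pose US (s : seq X) : set X := [set q | exists2 p, p \in s & ball p (e / 2 * r) q].
have UScons p s' : US (p :: s') = ball p (e / 2 * r) `|` US s'.
  apply/seteqP; split => q.
    by move=> [p']; rewrite inE => /orP[/eqP->|p's] h; [left|right; exists p'].
  move=> [h|[p' p's h]]; first by exists p => //; rewrite mem_head.
  by exists p' => //; rewrite inE p's orbT.
have mUS s' : measurable (US s' : set (borel X)).
  elim: s' => [|p s' IH].
    rewrite (_ : US [::] = set0); first exact: measurable0.
    by apply/seteqP; split => // q [].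
  by rewrite UScons; exact: measurableU.
have sum : (((size s)%:R * (c ^+ J * v))%:E <= m (US s))%E.
  elim: s sep sK => [_ _|p s' IH]; first by rewrite mul0r.
  rewrite /separated /= => /andP[/allP ps sep] sK.
  rewrite UScons.
  rewrite measureU//; last first.
    apply/seteqP; split => // q [pq [p' p's p'q]]; move: pq p'q; rewrite !ballE /=.
    have := ps _ p's; have := metric_triangle p q p'; rewrite (metric_sym q p').
    by rewrite -(mulrA e); lra.
  rewrite -natr1 mulrDl mul1r addrC EFinD leeD ?one ?sK ?mem_head//.
  by apply: IH => // q qs; apply: sK; rewrite inE qs orbT.
have : (((size s)%:R * (c ^+ J * v))%:E <= v%:E)%E.
  apply: (le_trans sum); rewrite -vE.
  apply: le_measure; rewrite ?inE; [exact: mUS|exact: mball|].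
  move=> q [p ps]; rewrite /V !ballE /= => pq.
  have := sK _ ps; have := metric_triangle x p q; have := mulr_gt0 e0 r0.
  by move: pq; rewrite mulrDl -(mulrA e); lra.
rewrite lee_fin mulrA -[leRHS]mul1r ler_pM2r// -ler_pdivlMr ?exprn_gt0// div1r => h.
by rewrite -(ler_nat R) (le_trans h)// /N ltW// archi_boundP// invr_ge0 exprn_ge0// ltW.
Qed.

End packing.

(** A separated sequence of maximal size is a net. *)
Lemma separated_net (R : realType) (Y : metricType R) (A : set Y) (e : R) (N : nat) :
  (forall s, pairwise (fun p q => e <= mdist p q) s -> (forall p, p \in s -> A p) -> (size s <= N)%N) ->
  exists s : seq Y, (forall p, p \in s -> A p) /\ forall q, A q -> exists2 p, p \in s & mdist p q < e.
Proof.
move=> bnd.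
pose P n := `[< exists s : seq Y, [/\ size s = n, pairwise (fun p q => e <= mdist p q) s &
  forall p, p \in s -> A p] >].
have P0 : exists n, P n by exists 0%N; apply/asboolP; exists [::].
have PN n : P n -> (n <= N)%N by move=> /asboolP[s [<- ss sA]]; exact: bnd.
case: (ex_maxnP P0 PN) => n /asboolP[s [sn ss sA]] nmax.
exists s; split => // q Aq; apply: contrapT => nq.
have : P n.+1.
  apply/asboolP; exists (q :: s); split; first by rewrite /= sn.
    rewrite /= ss andbT; apply/allP => p ps; rewrite leNgt; apply/negP => pq.
    by apply: nq; exists p; rewrite // metric_sym.
  by move=> p; rewrite inE => /orP[/eqP->|/sA].
by move=> /nmax; rewrite ltnn.
Qed.

Lemma filter_forall_seq (I : Type) (T : eqType) (F : set_system I) (s : seq T)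
    (P : T -> set I) : Filter F -> (forall a, a \in s -> F (P a)) ->
  F [set i | forall a, a \in s -> P a i].
Proof.
move=> FF; elim: s => [|b s IH] h; first by apply: filterS filterT.
have Fb := h b (mem_head _ _).
have Fs : F [set i | forall a, a \in s -> P a i].
  by apply: IH => a bs; apply: h; rewrite inE bs orbT.
by apply: filterS (filterI Fb Fs) => i [ib is' a]; rewrite inE => /orP[/eqP->|/is'].
Qed.

Section ultralimit.
Context {R : realType} (X : pmetricType R) (x : X) (l : nat -> {posnum R}).
Local Notation d := (@mdist R X).

Definition scaled n (p q : X) : R := (l n)%:num * d p q.
Definition scaled_bounded (s : nat -> X) := exists b, forall n, scaled n x (s n) <= b.
Lemma scaled_ge0 n p q : 0 <= scaled n p q.
Proof. by rewrite mulr_ge0 ?mdist_ge0. Qed.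

Lemma scaled_sym n p q : scaled n p q = scaled n q p.
Proof. by rewrite /scaled metric_sym. Qed.

Lemma scaled_triangle n q p r : scaled n p r <= scaled n p q + scaled n q r.
Proof. by rewrite -mulrDr ler_pM2l// metric_triangle. Qed.

Context (U : set_system nat) {UU : UltraFilter U} (Uoo : \oo `<=` U).

Definition udist (s t : nat -> X) : R := lim ((fun n => scaled n (s n) (t n)) @ U).

Lemma udist_cvg s t : scaled_bounded s -> scaled_bounded t ->
  (fun n => scaled n (s n) (t n)) @ U --> udist s t.
Proof.
move=> [b sb] [c tc].
have [|v uv] := @ultra_lim_real R nat U (fun n => scaled n (s n) (t n)) (b + c).
  apply: filterS (@filterT _ U _) => n _ /=; rewrite ger0_norm ?scaled_ge0//.
  by rewrite (le_trans (scaled_triangle n x _ _))// lerD// scaled_sym.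
exact: cvgP uv.
Qed.

Lemma udist_eq s t (v : R) : (fun n => scaled n (s n) (t n)) @ U --> v -> udist s t = v.
Proof. by move=> sv; apply: cvg_lim => //; exact: Rhausdorff. Qed.

Lemma udistxx s : udist s s = 0.
Proof.
apply: udist_eq; rewrite (_ : (fun n => _) = fun=> 0); first exact: cvg_cst.
by apply/funext => n; rewrite /scaled mdistxx mulr0.
Qed.

Lemma udist_sym s t : udist s t = udist t s.
Proof.
rewrite /udist (_ : (fun n => scaled n (s n) (t n)) = fun n => scaled n (t n) (s n))//.
by apply/funext => n; rewrite scaled_sym.
Qed.

Lemma udist_le s t (v : R) : scaled_bounded s -> scaled_bounded t ->
  U [set n | scaled n (s n) (t n) <= v] -> udist s t <= v.
Proof.
by move=> bs bt h; apply: limr_le => //; exact: cvgP (udist_cvg bs bt).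
Qed.

Lemma udist_ge0 s t : scaled_bounded s -> scaled_bounded t -> 0 <= udist s t.
Proof.
move=> bs bt; apply: limr_ge; first exact: cvgP (udist_cvg bs bt).
by apply: filterS (@filterT _ U _) => n _; exact: scaled_ge0.
Qed.

Lemma udist_triangle s t r : scaled_bounded s -> scaled_bounded t -> scaled_bounded r ->
  udist s r <= udist s t + udist t r.
Proof.
move=> bs bt br.
have UF : Filter U by exact: _.
have h := cvgD (udist_cvg bs bt) (udist_cvg bt br).
have h2 := cvgB (h UF) (udist_cvg bs br).
have {}h2 := h2 UF; rewrite -subr_ge0.
rewrite -(cvg_lim (@Rhausdorff R) h2); apply: limr_ge; first exact: cvgP h2.
by apply: filterS (@filterT _ U _) => n _ /=; rewrite subr_ge0; exact: scaled_triangle.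
Qed.

Definition uclass (s : nat -> X) : set (nat -> X) :=
  [set t | scaled_bounded t /\ udist s t = 0].
(** One representative per class: the points of the ultralimit are the sequences fixed by [canon],
    so that distance zero means equality. *)
Definition canon (s : nat -> X) : nat -> X := get (uclass s).

Lemma canonP s : scaled_bounded s -> uclass s (canon s).
Proof. by move=> bs; apply: getPex; exists s; split => //; exact: udistxx. Qed.

Lemma canon_eq s t : scaled_bounded s -> scaled_bounded t -> udist s t = 0 -> canon s = canon t.
Proof.
move=> bs bt st; rewrite /canon; congr (xget _ _); apply/seteqP; split => r [br sr];
  split => //; apply/eqP; rewrite eq_le udist_ge0// andbT.
- by rewrite (le_trans (udist_triangle bt bs br))// udist_sym st sr addr0.
- by rewrite (le_trans (udist_triangle bs bt br))// st sr addr0.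
Qed.

Record ulim := ULim {
  useq : nat -> X ;
  useq_bounded : scaled_bounded useq ;
  useq_canon : canon useq = useq }.

Definition ucl s (bs : scaled_bounded s) : ulim :=
  ULim (canonP bs).1 (canon_eq (canonP bs).1 bs (etrans (udist_sym _ _) (canonP bs).2)).

HB.instance Definition _ := gen_eqMixin ulim.
HB.instance Definition _ := gen_choiceMixin ulim.

Lemma ulim_ext (a b : ulim) : useq a = useq b -> a = b.
Proof.
case: a b => [s bs cs] [t bt ct] /= st; case: _ / st in bt ct *.
by congr ULim; exact: Prop_irrelevance.
Qed.

Definition ulim_dist (a b : ulim) : R := udist (useq a) (useq b).

Lemma ulim_distxx a : ulim_dist a a = 0. Proof. exact: udistxx. Qed.

Lemma ulim_dist_positivity a b : ulim_dist a b = 0 -> a = b.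
Proof.
move=> ab; apply: ulim_ext; rewrite -(useq_canon a) -(useq_canon b).
by apply: canon_eq ab; exact: useq_bounded.
Qed.

Lemma ulim_dist_sym a b : ulim_dist a b = ulim_dist b a.
Proof. exact: udist_sym. Qed.

Lemma ulim_dist_triangle b a c : ulim_dist a c <= ulim_dist a b + ulim_dist b c.
Proof. by apply: udist_triangle; exact: useq_bounded. Qed.

HB.instance Definition _ := isMetric.Build R ulim
  ulim_distxx ulim_dist_positivity ulim_dist_sym ulim_dist_triangle.

Lemma ulim_mdistE (a b : ulim) : mdist a b = udist (useq a) (useq b).
Proof. by []. Qed.

Lemma ulim_cvg (a b : ulim) :
  (fun n => scaled n (useq a n) (useq b n)) @ U --> (mdist a b : R).
Proof. by apply: udist_cvg; exact: useq_bounded. Qed.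

Lemma udist_congr s s' t : scaled_bounded s -> scaled_bounded s' -> scaled_bounded t ->
  udist s s' = 0 -> udist s t = udist s' t.
Proof.
move=> bs bs' bt ss; apply/eqP; rewrite eq_le; apply/andP; split.
  by rewrite (le_trans (udist_triangle bs bs' bt))// ss add0r.
by rewrite (le_trans (udist_triangle bs' bs bt))// udist_sym ss add0r.
Qed.

Lemma ucl_dist s t (bs : scaled_bounded s) (bt : scaled_bounded t) :
  mdist (ucl bs) (ucl bt) = udist s t.
Proof.
have [bcs cs] := canonP bs; have [bct ct] := canonP bt.
rewrite ulim_mdistE /= -(udist_congr bs bcs bct cs) udist_sym.
by rewrite -(udist_congr bt bct bs ct) udist_sym.
Qed.

Lemma ucl_useq (a : ulim) (ba : scaled_bounded (useq a)) : ucl ba = a.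
Proof. by apply: ulim_ext => /=; exact: useq_canon. Qed.

Lemma base_bounded : scaled_bounded (fun=> x).
Proof. by exists 0 => n; rewrite /scaled mdistxx mulr0. Qed.

Definition ubase : ulim := ucl base_bounded.

Lemma scaled_bounded_near s t (c : R) : scaled_bounded s ->
  (forall n, scaled n (s n) (t n) <= c) -> scaled_bounded t.
Proof.
move=> [b sb] st; exists (b + c) => n.
by rewrite (le_trans (scaled_triangle n (s n) _ _))// lerD.
Qed.

Lemma ulim_useq (a : ulim) : exists ba : scaled_bounded (useq a), ucl ba = a.
Proof. by exists (useq_bounded a); exact: ucl_useq. Qed.

Lemma ulim_lt (a b : ulim) (v : R) : mdist a b < v ->
  U [set n | scaled n (useq a n) (useq b n) < v].
Proof.
move=> abv; have e0 : 0 < v - mdist a b by rewrite subr_gt0.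
move/cvgrPdist_lt: (@ulim_cvg a b) => /(_ _ e0); apply: filterS => n /=.
by rewrite ltr_distlC => /andP[_]; rewrite addrC subrK.
Qed.

(** A diagonal argument: at stage [n] the limit sequence follows [w i] for the largest [i] with
    [G i n]. The clause [i <= n] makes this maximum exist, and holds almost surely because [U]
    contains the cofinite sets. *)
Lemma ulim_complete : complete_space ulim.
Proof.
move=> F PF /cauchyP cF.
have p0 i : 0 < (2^-1 : R) ^+ i by rewrite exprn_gt0// invr_gt0.
have /choice[w wF] (i : nat) : exists w : ulim, F (ball w (2^-1 ^+ i : R)).
  by have [|w Fw] := cF (2^-1 ^+ i); [exact: p0|exists w].
have wd i j : (j <= i)%N -> mdist (w j) (w i) < 2 * 2^-1 ^+ j.
  move=> ji; have [v [jv iv]] := filter_ex (filterI (wF j) (wF i)).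
  rewrite !ballE /= in jv iv; apply: le_lt_trans (metric_triangle _ v _) _.
  rewrite mulr_natl mulr2n ltrD// metric_sym (lt_le_trans iv)//.
  by apply: ler_wiXn2l; rewrite ?invr_ge0// invf_le1// ler1n.
pose G i := [set n : nat | (i <= n)%N /\
  forall j, j \in iota 0 i -> scaled n (useq (w j) n) (useq (w i) n) < 2 * 2^-1 ^+ j].
have UG i : U (G i).
  apply: filterI.
    by apply: Uoo; exists i.
  apply: (@filter_forall_seq _ _ U (iota 0 i)) => j; rewrite mem_iota add0n => /andP[_ ji].
  by apply: ulim_lt; apply: wd; exact: ltnW.
have /choice[k kP] (n : nat) : exists k, G k n /\ forall i, G i n -> (i <= k)%N.
  have G0 : exists i, `[< G i n >] by exists 0%N; apply/asboolP; split.
  have Gn i : `[< G i n >] -> (i <= n)%N by move=> /asboolP[].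
  case: (ex_maxnP G0 Gn) => i /asboolP Gi imax; exists i; split => // j Gj.
  by apply: imax; exact/asboolP.
pose p n := useq (w (k n)) n.
have pw i n : G i n -> scaled n (useq (w i) n) (p n) <= 2 * 2^-1 ^+ i.
  move=> Gin; have [[_ Gk] kmax] := kP n; have := kmax _ Gin.
  rewrite leq_eqVlt => /orP[/eqP ik|ik].
    by rewrite /p -ik /scaled mdistxx mulr0 mulr_ge0// ltW.
  by apply/ltW/Gk; rewrite mem_iota.
have bp : scaled_bounded p.
  apply: (@scaled_bounded_near (useq (w 0%N)) p (2 * 2^-1 ^+ 0)); first exact: useq_bounded.
  by move=> n; apply: pw; split.
exists (ucl bp); apply/cvg_ballP => e e0.
have e30 : 0 < e / 3 by rewrite divr_gt0.
have [i _ iP] := near_infty_natSinv_expn_lt (PosNum e30).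
have {}iP : 2^-1 ^+ i < e / 3 by have := iP i (leqnn i); rewrite /= exprVn div1r.
apply: filterS (wF i) => v; rewrite !ballE /= => wv.
have [bw wE] := ulim_useq (w i).
have wp : mdist (w i) (ucl bp) <= 2 * 2^-1 ^+ i.
  rewrite -{1}wE ucl_dist; apply: udist_le => //.
  by apply: filterS (UG i) => n; exact: pw.
have h : mdist (ucl bp) v <= mdist (w i) (ucl bp) + mdist (w i) v.
  by rewrite (metric_sym (w i) (ucl bp)); exact: metric_triangle.
pose z : R := 2^-1 ^+ i; rewrite -/z in wv wp iP.
by clearbody z; move: h wp wv iP; lra.
Qed.

Lemma ulim_geodesic : proper_space X -> length_space X -> geodesic_space ulim.
Proof.
move=> pX lX a b; pose i0 : {i01 R} := 0%:i01; pose i1 : {i01 R} := 1%:i01.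
have /choice[g gP] n : exists g : Geo X, g 0%:i01 = useq a n /\ g 1%:i01 = useq b n.
  have [h [uh h0 h1]] := unit_geodesic_exists pX lX (useq a n) (useq b n).
  have [g gE] := unit_geodesic_geo (mdist_ge0 _ _) uh.
  by exists g; rewrite !gE /= mul0r mul1r.
have gd n (s t : {i01 R}) : scaled n (g n s) (g n t) =
    `|t%:num - s%:num| * scaled n (useq a n) (useq b n).
  by have [<- <-] := gP n; rewrite /scaled mulrCA -geo_speed.
have bg (t : {i01 R}) : scaled_bounded (fun n => g n t).
  have [c cP] : exists c, forall n, scaled n (useq a n) (useq b n) <= c.
    have [c1 h1] := useq_bounded a; have [c2 h2] := useq_bounded b; exists (c1 + c2) => n.
    by rewrite (le_trans (scaled_triangle n x _ _))// lerD// scaled_sym.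
  apply: (@scaled_bounded_near (useq a) _ c); first exact: useq_bounded.
  move=> n; rewrite -(gP n).1 gd subr0 ger0_norm//; apply: le_trans (cP n).
  by rewrite ler_piMl ?scaled_ge0.
have gE (s t : {i01 R}) : mdist (ucl (bg s)) (ucl (bg t)) = `|t%:num - s%:num| * mdist a b.
  rewrite ucl_dist; apply: udist_eq; under eq_fun do rewrite gd.
  by apply: cvgM; [exact: cvg_cst|exact: ulim_cvg].
have ga : ucl (bg 0%:i01) = a.
  apply: ulim_dist_positivity; rewrite -[LHS]/(mdist (ucl (bg 0%:i01)) a).
  have [ba <-] := ulim_useq a; rewrite ucl_dist.
  by rewrite (_ : (fun n => _) = useq a) ?udistxx//; apply/funext => n; case: (gP n).
have gb : ucl (bg 1%:i01) = b.
  apply: ulim_dist_positivity; rewrite -[LHS]/(mdist (ucl (bg 1%:i01)) b).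
  have [bb <-] := ulim_useq b; rewrite ucl_dist.
  by rewrite (_ : (fun n => _) = useq b) ?udistxx//; apply/funext => n; case: (gP n).
have gs (s t : {i01 R}) : mdist (ucl (bg s)) (ucl (bg t)) =
    `|t%:num - s%:num| * mdist (ucl (bg 0%:i01)) (ucl (bg 1%:i01)).
  by rewrite gE ga gb.
by exists (MkGeo gs).
Qed.

End ultralimit.

Section ultralimit_approximation.
Context {R : realType} (X : pmetricType R) (x : X) (l : nat -> {posnum R})
  (U : set_system nat) {UU : UltraFilter U} (Uoo : \oo `<=` U).
Context (pX : proper_space X) (lX : length_space X).
Context (pack : forall K e : R, 0 < K -> 0 < e -> exists N : nat,
  U [set n | forall s, pairwise (fun p q => e <= scaled l n p q) s ->
    (forall p, p \in s -> scaled l n x p <= K) -> (size s <= N)%N]).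
Local Notation d := (@mdist R X).
Local Notation sc := (scaled l).
Local Notation Y := (ulim x l U).
Local Notation y := (@ubase R X x l U UU).

Lemma udist_near (s t : nat -> X) (e : R) : scaled_bounded x l s ->
  scaled_bounded x l t -> 0 < e ->
  U [set n | `|sc n (s n) (t n) - udist l U s t| < e].
Proof.
move=> bs bt e0; have := udist_cvg (UU := UU) bs bt.
move/cvgrPdist_lt => /(_ _ e0); apply: filterS => n /=.
by rewrite distrC.
Qed.

Lemma ulim_near (a b : Y) (e : R) : 0 < e ->
  U [set n | `|sc n (useq a n) (useq b n) - mdist a b| < e].
Proof. by move=> e0; apply: udist_near => //; exact: useq_bounded. Qed.

Lemma ubase_near (e : R) : 0 < e -> U [set n | sc n x (useq y n) < e].
Proof.
move=> e0; have [bc cc] := canonP (UU := UU) (base_bounded x l).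
have := udist_near (base_bounded x l) bc e0.
by apply: filterS => n /=; rewrite cc subr0 ger0_norm// scaled_ge0.
Qed.

(** Finitely many separated points of the limit are separated by half as much at almost every stage,
    so the packing bound passes to the limit. The extra [1] in the radius absorbs the drift of the
    base point and of the distances, [1/2] each. *)
Lemma ulim_proper : proper_space Y.
Proof.
have key (K : R) : compact (cball y K).
  apply: totally_bounded_compact; [exact: ulim_complete|exact: cball_closed|].
  move=> e e0; have e20 : 0 < e / 2 by rewrite divr_gt0.
  have K10 : 0 < `|K| + 1 by rewrite ltr_wpDl.
  have [N UN] := pack K10 e20.
  have [|s [_ sP]] := @separated_net R Y (cball y K) e N; last first.
    by exists s => q /sP[p ps pq]; exists p => //; exact: ltW.
  move=> s ss sK.
  have Us : U [set n | forall a, a \in s -> forall b, b \in s ->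
      `|sc n (useq a n) (useq b n) - mdist a b| < e / 2].
    apply: (@filter_forall_seq nat Y U s (fun a => [set n |
      forall b, b \in s -> `|sc n (useq a n) (useq b n) - mdist a b| < e / 2])) => a _.
    apply: (@filter_forall_seq nat Y U s (fun b => [set n |
      `|sc n (useq a n) (useq b n) - mdist a b| < e / 2])) => b _.
    exact: ulim_near.
  have h20 : 0 < 2^-1 :> R by [].
  have Ub : U [set n | forall a, a \in s -> `|sc n (useq y n) (useq a n) - mdist y a| < 2^-1].
    apply: (@filter_forall_seq nat Y U s (fun a => [set n |
      `|sc n (useq y n) (useq a n) - mdist y a| < 2^-1])) => a _.
    exact: ulim_near.
  have [n [[[nN ns] nb] nx]] :=
    filter_ex (F := U) (@filterI _ U _ _ _ (@filterI _ U _ _ _ (@filterI _ U _ _ _ UN Us) Ub)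
      (ubase_near h20)).
  rewrite -(size_map (fun a => useq a n)); apply: nN.
    rewrite pairwise_map; move: ss; apply: (@sub_in_pairwise _ (mem s)); last exact/allP.
    move=> a b as' bs ab /=; have := ns a as' b bs.
    by rewrite ltr_distl => /andP[h _]; move: h ab; lra.
  move=> _ /mapP[a as' ->].
  have := nb a as'; rewrite ltr_distl => /andP[_ h].
  have := sK a as'; rewrite /cball /= => aK.
  have h1 := scaled_triangle l n (useq y n) x (useq a n); have h2 := ler_norm K.
  have nx' : sc n x (useq y n) < 2^-1 := nx.
  by move: h h1 h2 aK nx'; lra.
move=> p r; apply: subclosed_compact (cball_closed (p := p) (r := r)) (key (mdist y p + r)) _.
move=> q; rewrite /cball /= => pq; apply: le_trans (metric_triangle _ p _) _.
by rewrite lerD2l.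
Qed.

(** Balls are matched only up to the slack [e] in the radii; the geodesics of the limit remove it
    afterwards. *)
Definition approximates (n : nat) (K e : R) (f : X -> Y) :=
  [/\ f x = y,
    (forall p q, sc n x p <= K + e -> sc n x q <= K + e ->
      `|mdist (f p) (f q) - sc n p q| <= e) &
    (forall a, mdist y a <= K -> exists p,
      sc n x p <= mdist y a + e /\ mdist (f p) a <= e)].

(** A point is sent to an element of a finite net of the limit whose representative is near it. Such
    an element exists for almost every [n]: otherwise a sequence of points far from all
    representatives would define a point of the limit far from the net. With [e1 = e / 8] the errors
    add up to less than [e]. *)
Lemma ulim_approximates (K e : R) : 0 < K -> 0 < e ->
  U [set n | exists f, approximates n K e f].
Proof.
move=> K0 e0; pose e1 : R := e / 8; have e10 : 0 < e1 by rewrite divr_gt0.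
have [s [_ sP]] := compact_totally_bounded e10 (@ulim_proper y (K + e)).
pose s1 := y :: s.
have Us : U [set n | forall a, a \in s1 -> forall b, b \in s1 ->
    `|sc n (useq a n) (useq b n) - mdist a b| < e1].
  apply: (@filter_forall_seq nat Y U s1 (fun a => [set n |
    forall b, b \in s1 -> `|sc n (useq a n) (useq b n) - mdist a b| < e1])) => a _.
  apply: (@filter_forall_seq nat Y U s1 (fun b => [set n |
    `|sc n (useq a n) (useq b n) - mdist a b| < e1])) => b _.
  exact: ulim_near.
pose E := [set n | forall p, sc n x p <= K + e ->
  exists2 a, a \in s1 & sc n p (useq a n) <= 2 * e1].
have UE : U E.
  have [//|UCE] := in_ultra_setVsetC E UU.
  exfalso.
  have /choice[p pP] n : exists p, sc n x p <= K + e /\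
      (~ E n -> forall a, a \in s1 -> 2 * e1 < sc n p (useq a n)).
    have [En|nEn] := pselect (E n).
      by exists x; split => //; rewrite /scaled mdistxx mulr0 ltW// addr_gt0.
    move: (nEn) => /existsNP[p /not_implyP[pK h]]; exists p; split => // _ a as1.
    by rewrite ltNge; apply/negP => ?; apply: h; exists a.
  have bp : scaled_bounded x l p by exists (K + e) => n; case: (pP n).
  have pK : cball y (K + e) (ucl (UU := UU) bp).
    rewrite /cball /= ucl_dist; apply: (udist_le (base_bounded x l) bp).
    by apply: filterS (@filterT _ U _) => n _; case: (pP n).
  have [a as' ap] := sP _ pK.
  have [ba aE] := ulim_useq a.
  have ap' : udist l U (useq a) p < e1 by rewrite -(ucl_dist (UU := UU) ba bp) aE.
  have [n [nE na]] := filter_ex (F := U) (@filterI _ U _ _ _ UCE (udist_near ba bp e10)).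
  have as1 : a \in s1 by rewrite inE as' orbT.
  have := (pP n).2 nE a as1; rewrite scaled_sym.
  by move: na; rewrite /= ltr_distl => /andP[_]; move: ap' e10; lra.
apply: filterS (@filterI _ U _ _ _ (@filterI _ U _ _ _ Us UE) (ubase_near e10)) => n [[ns nE] ny'].
have ny : sc n x (useq y n) < e1 := ny'.
have ys : y \in s1 by rewrite mem_head.
have /choice[f fP] p : exists a, (p = x -> a = y) /\ (sc n x p <= K + e ->
    a \in s1 /\ sc n p (useq a n) <= 2 * e1).
  have [->|px] := pselect (p = x).
    by exists y; split => // _; split => //; move: ny e10; lra.
  have [/nE[a as1 ap]|nK] := pselect (sc n x p <= K + e); first by exists a.
  by exists y; split.
exists f; split.
- exact: (fP x).1.
- move=> p q pK qK; have [fps fp] := (fP p).2 pK; have [fqs fq] := (fP q).2 qK.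
  have := ns _ fps _ fqs; rewrite ltr_distl => /andP[h1 h2].
  have t1 := scaled_triangle l n (useq (f p) n) p q.
  have t2 := scaled_triangle l n q p (useq (f q) n).
  have t3 := scaled_triangle l n p (useq (f p) n) (useq (f q) n).
  have t4 := scaled_triangle l n (useq (f q) n) (useq (f p) n) q.
  rewrite (scaled_sym l n (useq (f p) n) p) (scaled_sym l n (useq (f q) n) q) in t1 t2 t3 t4.
  have e8 : e = 8 * e1 by rewrite /e1; field.
  by rewrite ler_distl e8; apply/andP; split; move: fp fq h1 h2 t1 t2 t3 t4 e10; lra.
- move=> a aK; have [|b bs ba] := sP a.
    by rewrite /cball /=; move: aK e0; lra.
  have bs1 : b \in s1 by rewrite inE bs orbT.
  have e8 : e = 8 * e1 by rewrite /e1; field.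
  have bx : sc n x (useq b n) <= mdist y a + 3 * e1.
    have := ns _ ys _ bs1; rewrite ltr_distl => /andP[_ h].
    have := scaled_triangle l n (useq y n) x (useq b n).
    have := metric_triangle y a b; rewrite (metric_sym a b).
    by move: ny h ba; lra.
  exists (useq b n); split; first by rewrite e8; move: bx e10; lra.
  have [|fs fb] := (fP (useq b n)).2; first by rewrite e8; move: bx aK e10; lra.
  have := ns _ fs _ bs1; rewrite ltr_distl scaled_sym => /andP[h1 _].
  have := metric_triangle (f (useq b n)) b a.
  by rewrite e8; move: fb h1 ba e10; lra.
Qed.

End ultralimit_approximation.

Lemma geodesic_pull (R : realType) (Z : metricType R) (y z : Z) (v e : R) :
  geodesic_space Z -> 0 <= v -> 0 <= e -> mdist y z <= v + e ->
  exists w, mdist y w <= v /\ mdist w z <= e.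
Proof.
move=> gZ v0 e0 yz; have [yv|vy] := leP (mdist y z) v.
  by exists z; rewrite mdistxx.
have [g [g0 g1]] := gZ y z.
have yz0 : 0 < mdist y z by exact: le_lt_trans vy.
have t0 : 0 <= v / mdist y z by rewrite divr_ge0// ltW.
have t1 : v / mdist y z <= 1 by rewrite ler_pdivrMr// mul1r ltW.
pose t : {i01 R} := Itv01 t0 t1.
exists (g t); split.
  rewrite -{1}g0 geo_speed g0 g1.
  by rewrite subr0 ger0_norm//= divfK// gt_eqF.
rewrite -{1}g1 geo_speed g0 g1.
rewrite ger0_norm/= ?subr_ge0//.
by rewrite mulrBl mul1r divfK ?gt_eqF//; move: yz; lra.
Qed.

Section proper_spaces.
Context {R : realType} (Z : metricType R) (pZ : proper_space Z).

Lemma proper_locally_compact : locally_compact [set: Z].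
Proof.
move=> p _; exists (cball p 1); last by split; [exact: pZ|exact: cball_closed].
have : nbhs p (cball p 1).
  by apply: filterS (nbhs_mdist p (@ltr01 R)) => q; exact: ltW.
by apply: filterS => q ? _.
Qed.

Lemma proper_separable (z0 : Z) : separable_space Z.
Proof.
have /choice[s sP] (n : nat) : exists s : seq Z, forall q, cball z0 n%:R q ->
    exists2 p, p \in s & mdist p q < n.+1%:R^-1.
  have n0 : 0 < n.+1%:R^-1 :> R by rewrite invr_gt0.
  have [s [_ sP]] := compact_totally_bounded n0 (@pZ z0 n%:R).
  by exists s.
exists (\bigcup_n [set` s n]).
  by apply: bigcup_countable => // n _; exact: finite_set_countable.
move=> O [q Oq] oO.
have /nbhs_ballP[e /= e0 eO] : nbhs q O by exact: open_nbhs_nbhs.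
have [n1 _ n1P] := near_infty_natSinv_lt (PosNum e0).
have [n2 n2P] : exists n2 : nat, mdist z0 q <= n2%:R.
  by exists (Num.bound (mdist z0 q)); rewrite ltW// archi_boundP// mdist_ge0.
have [|p ps pq] := sP (maxn n1 n2) q.
  by rewrite /cball /= (le_trans n2P)// ler_nat leq_maxr.
exists p; split; last by exists (maxn n1 n2).
apply: eO; rewrite ballE /= metric_sym (lt_trans pq)//.
by apply: n1P; rewrite /= leq_maxl.
Qed.

End proper_spaces.

Section ultralimit_tangent.
Context {R : realType} (X : pmetricType R) (x : X) (l : nat -> {posnum R})
  (U : set_system nat) {UU : UltraFilter U} (Uoo : \oo `<=` U).
Context (pX : proper_space X) (lX : length_space X).
Context (pack : forall K e : R, 0 < K -> 0 < e -> exists N : nat,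
  U [set n | forall s, pairwise (fun p q => e <= scaled l n p q) s ->
    (forall p, p \in s -> scaled l n x p <= K) -> (size s <= N)%N]).
Local Notation d := (@mdist R X).
Local Notation sc := (scaled l).
Local Notation Y := (ulim x l U).
Local Notation y := (@ubase R X x l U UU).

(** Images are pulled along geodesics into the ball of radius [r], at a cost of [e] each. For
    density of the image, the target is first pulled to radius [r - 2 * e], so that its approximate
    preimage lies in the ball; if [r < 2 * e] the centre is near enough. *)
Lemma approximates_quasi_isometry (n : nat) (K e r : R) (f : X -> Y) :
  0 < e -> 0 < r <= K -> approximates n K e f ->
  exists2 h : X -> Y,
    @quasi_isometry R (4 * e) (rescale (l n) X) Y
      (@cball R (rescale (l n) X) x r) (cball y r) h & h x = y.
Proof.
move=> e0 /andP[r0 rK] [fx fd fs]; have gY : geodesic_space Y by exact: ulim_geodesic.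
have xx : sc n x x = 0 by rewrite /scaled mdistxx mulr0.
have /choice[h hP] (p : X) : exists w : Y, (p = x -> w = y) /\ (sc n x p <= r ->
    mdist y w <= r /\ mdist w (f p) <= e).
  have [->|px] := pselect (p = x).
    by exists y; split => // _; rewrite fx mdistxx (ltW r0) (ltW e0).
  have [pr|pr] := pselect (sc n x p <= r); last by exists y; split.
  have fp : mdist y (f p) <= r + e.
    have := fd x p; rewrite xx fx ler_distl => h.
    have /andP[_ h2] : sc n x p - e <= mdist y (f p) <= sc n x p + e.
      by apply: h; [move: r0 rK e0; lra|move: pr rK e0; lra].
    by move: h2 pr; lra.
  have [w [w1 w2]] := geodesic_pull gY (ltW r0) (ltW e0) fp.
  by exists w.
exists h; last exact: (hP x).1.
split.
- by move=> p pr; exact: ((hP p).2 pr).1.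
- move=> p q pr qr.
  have pr' : sc n x p <= r := pr; have qr' : sc n x q <= r := qr.
  have [_ hp] := (hP p).2 pr; have [_ hq] := (hP q).2 qr.
  have := fd p q; rewrite ler_distl => h0.
  have /andP[h1 h2] : sc n p q - e <= mdist (f p) (f q) <= sc n p q + e.
    by apply: h0; [move: pr' rK e0; lra|move: qr' rK e0; lra].
  have /andP[t1 t2] : mdist (f p) (f q) - (mdist (h p) (f p) + mdist (h q) (f q)) <=
      mdist (h p) (h q) <= mdist (f p) (f q) + (mdist (h p) (f p) + mdist (h q) (f q)).
    by rewrite -ler_distl; exact: mdist_quadrangle.
  rewrite -[@mdist R (rescale (l n) X) p q]/(sc n p q) ler_distl.
  by apply/andP; split; move: t1 t2 hp hq h1 h2 e0; lra.
- move=> z; rewrite /cball /= => yz.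
  have [r2|r2] := leP (2 * e) r; last first.
    exists x; first by rewrite -[mdist _ _]/(sc n x x) xx ltW.
    by rewrite (hP x).1//; move: yz r2 e0; lra.
  have re0 : 0 <= r - 2 * e by rewrite subr_ge0.
  have e20 : 0 <= 2 * e by rewrite mulr_ge0 ?ltW.
  have [|w [w1 w2]] := geodesic_pull (y := y) (z := z) gY re0 e20.
    by rewrite subrK.
  have [|p [px pw]] := fs w; first by move: w1 rK e0; lra.
  have pr : sc n x p <= r by move: px w1 e0; lra.
  exists p => //; have [_ hp] := (hP p).2 pr.
  have := metric_triangle (h p) (f p) z; have := metric_triangle (f p) w z.
  by move: hp pw w2 e0; lra.
Qed.

(** Convergence concerns an actual sequence: stages [k i >= i] are extracted where an approximation
    of radius [i.+1] and error [1 / i.+1] exists. *)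
Lemma ulim_tangent : (fun n => (l n)%:num : R) @ \oo --> +oo -> tangent x y.
Proof.
move=> loo; have pY : proper_space Y by exact: ulim_proper.
split.
  split; [exact: ulim_complete| | |exact: ulim_geodesic].
    exact: (proper_separable pY y).
  exact: (proper_locally_compact pY).
have /choice[k kP] (i : nat) : exists n, (i <= n)%N /\
    exists f, @approximates R X x l U UU n i.+1%:R i.+1%:R^-1 f.
  have i0 : 0 < i.+1%:R :> R by [].
  have iV0 : 0 < (i.+1%:R)^-1 :> R by rewrite invr_gt0.
  have Ui : U [set n | (i <= n)%N] by apply: Uoo; exists i.
  have [n [ni nf]] := filter_ex (F := U) (@filterI _ U _ _ _ Ui
    (ulim_approximates Uoo pack i0 iV0)).
  by exists n.
exists (fun i => l (k i)).
  apply/cvgryPge => A; have [N _ NP] := (cvgryPge _).1 loo A; exists N => // i /= Ni.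
  by apply: NP; apply: leq_trans (kP i).1.
move=> r r0.
(* A map is demanded at every [i]; at the finitely many early ones a constant map serves, with the
   diameter bound [2 * r] as error. *)
exists (fun i => if r <= i.+1%:R then 4 * i.+1%:R^-1 else 2 * r).
  have h : (fun i : nat => 4 * i.+1%:R^-1 : R) @ \oo --> (0 : R).
    by rewrite -(mulr0 4); apply: cvgM; [exact: cvg_cst|exact: cvg_harmonic].
  apply: cvg_trans h; apply: near_eq_cvg; exists (Num.bound r) => // i /= ri.
  rewrite ifT// (le_trans (ltW (archi_boundP (ltW r0))))// ler_nat.
  exact: leq_trans ri _.
move=> i; case: ifPn => [ri|]; last first.
  rewrite -ltNge => ir; exists (fun=> y) => //; split.
  - by move=> p _; rewrite /cball /= mdistxx ltW.
  - move=> p q; rewrite /cball /= => pr qr; rewrite mdistxx sub0r normrN ger0_norm ?mdist_ge0//.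
    have := @metric_triangle R (rescale (l (k i)) X) p x q.
    by rewrite (@metric_sym R (rescale (l (k i)) X) p x); move: pr qr; lra.
  - move=> z yz; exists x; first by rewrite /cball /= mdistxx ltW.
    by have yz' : mdist y z <= r := yz; apply: (le_trans yz'); move: r0; lra.
have [_ [f fP]] := kP i.
have iV0 : 0 < (i.+1%:R)^-1 :> R by rewrite invr_gt0.
have [|h hq hx] := @approximates_quasi_isometry (k i) _ _ r f iV0 _ fP; first by rewrite r0 ri.
by exists h.
Qed.

End ultralimit_tangent.

(** An approximate coordinate whose relative error [1 / 100] is a fixed fraction, small enough for
    the linear estimates of [no_detour] and [cut_point_line_map]. *)
Definition line_map (R : realType) (X : metricType R) (x : X) (r : R) (f : X -> R) :=
  [/\ f x = 0,
    (forall p q, mdist x p <= r -> mdist x q <= r ->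
      `| `|f p - f q| - mdist p q | <= r / 100) &
    (forall s, `|s| <= r -> exists2 p, mdist x p <= r & `|f p - s| <= r / 100)].

Definition nearly_line (R : realType) (X : metricType R) (x : X) (r : R) :=
  exists f : X -> R, line_map x r f.

(** If the property failed at radii [r n] tending to [0], the spaces rescaled by [(r n)^-1] would
    have a proper ultralimit by the packing bound. It is a tangent, hence the line, and an
    approximation of its unit ball, scaled back, is a coordinate at one of the bad radii. *)
Lemma tangent_line_nearly_line (R : realType) (X : pmetricType R)
    (m : {measure set (borel X) -> \bar R}) (x : X) :
  proper_space X -> length_space X ->
  (forall p : X, exists2 O : set X, open_nbhs p O & (m O < +oo)%E) ->
  (forall O : set X, open O -> O !=set0 -> (0 < m O)%E) -> nondegenerate m ->
  tangent_is_line x ->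
  exists2 rho : R, 0 < rho & forall r, 0 < r < rho -> nearly_line x r.
Proof.
move=> pX lX fX oX nd [_ tl]; apply: contrapT => nex.
have /choice[r rP] (n : nat) : exists r : R, 0 < r < n.+1%:R^-1 /\ ~ nearly_line x r.
  apply: contrapT => nr; apply: nex; exists n.+1%:R^-1; first by rewrite invr_gt0.
  by move=> r r0; apply: contrapT => nl; apply: nr; exists r.
have r0 n : 0 < r n by have [/andP[]] := rP n.
have rV n : 0 < (r n)^-1 by rewrite invr_gt0.
pose l n : {posnum R} := PosNum (rV n).
have [U UU Uoo] := ultra_nat.
have rsmall (e : R) : 0 < e -> U [set n | r n <= e].
  move=> e0; apply: Uoo; have [N _ NP] := near_infty_natSinv_lt (PosNum e0).
  exists N => // n /= Nn; have [/andP[_ rn] _] := rP n.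
  exact: ltW (lt_trans rn (NP n Nn)).
have pack (K e : R) : 0 < K -> 0 < e -> exists N : nat,
    U [set n | forall s, pairwise (fun p q => e <= scaled l n p q) s ->
      (forall p, p \in s -> scaled l n x p <= K) -> (size s <= N)%N].
  move=> K0 e0; have [N [e1 e10 NP]] := nondegenerate_packing x pX fX oX nd K0 e0.
  exists N; apply: filterS (rsmall _ e10) => n /= rn s ss sK.
  apply: (NP (r n)); first by rewrite r0.
    by move: ss; apply: sub_pairwise => p q; rewrite /scaled /= mulrC ler_pdivlMr.
  by move=> p /sK; rewrite /scaled /= mulrC ler_pdivrMr.
have loo : (fun n => (l n)%:num : R) @ \oo --> +oo.
  apply/cvgryPge => A; have A0 : 0 < (`|A| + 1)^-1 by rewrite invr_gt0 ltr_wpDl.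
  have [N _ NP] := near_infty_natSinv_lt (PosNum A0).
  exists N => // n /= Nn; have [/andP[_ rn] _] := rP n.
  have : r n < (`|A| + 1)^-1 by apply: lt_trans rn (NP n Nn).
  move=> /ltW h; apply: (@le_trans _ _ (`|A| + 1)).
    by rewrite (le_trans (ler_norm A))// lerDl.
  by rewrite /= -[leLHS]invrK lef_pV2 ?posrE.
have [g [gd gs gy]] := tl _ _ (ulim_tangent Uoo pX lX pack loo).
(* [approximates_quasi_isometry] multiplies the error by [4], which gives [1 / 100]. *)
have e0 : 0 < 400^-1 :> R by rewrite invr_gt0 ltr0n.
have [n [f fP]] := filter_ex (ulim_approximates Uoo pack (@ltr01 R) e0).
have [|h [hb hd hs] hx] := approximates_quasi_isometry (UU := UU) (r := 1) pX lX e0 _ fP.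
  by rewrite ltr01 lexx.
have [_ []] := rP n; exists (fun p => r n * g (h p)).
have cE p : mdist x p <= r n -> @cball R (rescale (l n) X) x 1 p.
  by move=> xp; rewrite /cball /= -[mdist _ _]/((r n)^-1 * mdist x p) mulrC ler_pdivrMr// mul1r.
have cE' p : @cball R (rescale (l n) X) x 1 p -> mdist x p <= r n.
  by rewrite /cball /= -[mdist _ _]/((r n)^-1 * mdist x p) mulrC ler_pdivrMr// mul1r.
have gdE a b : `|g a - g b| = mdist a b by rewrite -gd metric_sym.
split.
- by rewrite hx gy mulr0.
- move=> p q /cE xp /cE xq; have := hd p q xp xq.
  rewrite -[@mdist R (rescale (l n) X) p q]/((r n)^-1 * mdist p q) => h0.
  rewrite -mulrBr normrM gdE (gtr0_norm (r0 n)).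
  have -> : r n * mdist (h p) (h q) - mdist p q =
      r n * (mdist (h p) (h q) - (r n)^-1 * mdist p q).
    by rewrite mulrBr mulrA mulfV ?gt_eqF// mul1r.
  rewrite normrM (gtr0_norm (r0 n)) ler_pM2l//; apply: le_trans h0 _; lra.
- move=> s sr; have [a ga] := gs (s / r n).
  have ya : cball (ubase (UU := UU) x l) 1 a.
    by rewrite /cball /= -gdE gy ga sub0r normrN normrM normfV (gtr0_norm (r0 n)) ler_pdivrMr// mul1r.
  have [p xp pa] := hs _ ya; exists p; first exact: cE'.
  have -> : s = r n * g a by rewrite ga mulrC divfK// gt_eqF.
  rewrite -mulrBr normrM gdE (gtr0_norm (r0 n)) ler_pM2l//.
  by apply: le_trans pa _; lra.
Qed.

(** * Points with a neighbourhood isometric to an interval *)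

Section geodesic_points.
Context {R : realType} (X : metricType R).
Local Notation d := (@mdist R X).

(** A geodesic is arbitrary outside [[0, L]]; composed with this retraction it is continuous on the
    whole line. *)
Let clamp (L t : R) : R := Num.max 0 (Num.min L t).

Lemma clampP (L t : R) : 0 <= L -> 0 <= clamp L t <= L.
Proof. by move=> L0; rewrite /clamp le_max lexx /= ge_max L0 ge_min lexx. Qed.

Lemma clamp_id (L t : R) : 0 <= t <= L -> clamp L t = t.
Proof. by move=> /andP[t0 tL]; rewrite /clamp (min_idPr tL) (max_idPr t0). Qed.

Lemma clamp_lipschitz (L s t : R) : `|clamp L s - clamp L t| <= `|s - t|.
Proof.
rewrite /clamp /Num.max /Num.min; do ?case: ifPn; rewrite -?leNgt => *;
  by rewrite ler_norml; case: (ler0P (s - t)) => *; apply/andP; split; lra.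
Qed.

Lemma geodesic_dist_continuous (x : X) (L : R) (g : R -> X) : 0 <= L ->
  unit_geodesic L g -> continuous (fun t => d x (g (clamp L t))).
Proof.
move=> L0 ug t; apply/cvgrPdist_lt => e e0; apply/nbhs_ballP; exists e => //= s ts.
apply: le_lt_trans (mdist_lipschitz _ _ _) _.
rewrite ug ?clampP//; apply: le_lt_trans (clamp_lipschitz _ _ _) _.
by rewrite distrC.
Qed.

Lemma geodesic_nearest (x : X) (L : R) (g : R -> X) : 0 <= L -> unit_geodesic L g ->
  exists2 s, 0 <= s <= L & forall t, 0 <= t <= L -> d x (g s) <= d x (g t).
Proof.
move=> L0 ug; have [s sL smin] := EVT_min L0
  (continuous_subspaceT (@geodesic_dist_continuous x L g L0 ug)).
exists s; first by move: sL; rewrite in_itv.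
move=> t tL; have := smin t; rewrite in_itv /= => /(_ tL).
by rewrite !clamp_id//; move: sL; rewrite in_itv.
Qed.

Lemma geodesic_hit (x : X) (L v : R) (g : R -> X) : 0 <= L -> unit_geodesic L g ->
  d x (g 0) <= v <= d x (g L) -> exists2 s, 0 <= s <= L & d x (g s) = v.
Proof.
move=> L0 ug /andP[v0 vL].
have [|s sL sv] := @IVT R _ 0 L v L0
  (continuous_subspaceT (@geodesic_dist_continuous x L g L0 ug)).
  rewrite !clamp_id ?lexx ?L0//.
  by rewrite ge_min v0 le_max vL orbT.
rewrite in_itv /= in sL; exists s => //; move: sv; rewrite clamp_id//.
Qed.

Context (pX : proper_space X) (lX : length_space X).

(** A geodesic from [v] can meet [a] only at time [d v a], and every [z] between [v] and [p] lies on
    some geodesic. *)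
Lemma cut_point_geodesics (a v p : X) :
  (forall g, unit_geodesic (d v p) g -> g 0 = v -> g (d v p) = p ->
    exists2 s, 0 <= s <= d v p & g s = a) -> cut_point a v p.
Proof.
move=> H; have [g [ug g0 g1]] := unit_geodesic_exists pX lX v p.
have L0 : 0 <= (0 : R) <= d v p by rewrite lexx mdist_ge0.
have LL : 0 <= d v p <= d v p by rewrite lexx mdist_ge0.
have at_ h : unit_geodesic (d v p) h -> h 0 = v -> h (d v p) = p ->
    d v a <= d v p /\ h (d v a) = a.
  move=> uh h0 h1; have [s sL hs] := H h uh h0 h1.
  have -> : d v a = s by rewrite -h0 -hs uh// subr0 ger0_norm//; case/andP: sL.
  by case/andP: sL.
split.
  have [vL ga] := at_ g ug g0 g1.
  have vL' : 0 <= d v a <= d v p by rewrite mdist_ge0.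
  have : d a p = d v p - d v a by rewrite -{1}ga -{1}g1 ug// ger0_norm// subr_ge0.
  by move=> ->; rewrite addrC subrK.
move=> z vzp vza; have [h [uh h0 hz h1]] := unit_geodesic_through pX lX vzp.
by have [_ ha] := at_ h uh h0 h1; rewrite -ha -vza hz.
Qed.

(* A geodesic that stays at positive distance [r] from [x] turns back there,
   which is impossible next to [x] at scale [r]. *)
Lemma no_detour (x : X) (r L s : R) (g : R -> X) : 0 < r -> nearly_line x (2 * r) ->
  unit_geodesic L g -> r <= s -> s + r <= L -> d x (g s) = r ->
  (forall t, 0 <= t <= L -> r <= d x (g t)) -> False.
Proof.
move=> r0 [f [fx fd _]] ug rs sL xs gmin.
have I1 : 0 <= s - r <= L by apply/andP; split; move: r0 rs sL; lra.
have I2 : 0 <= s <= L by apply/andP; split; move: r0 rs sL; lra.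
have I3 : 0 <= s + r <= L by apply/andP; split; move: r0 rs sL; lra.
have d12 : d (g (s - r)) (g s) = r by rewrite ug// subKr ger0_norm// ltW.
have d23 : d (g s) (g (s + r)) = r by rewrite ug// addrC addKr ger0_norm// ltW.
have d13 : d (g (s - r)) (g (s + r)) = 2 * r.
  by rewrite ug// ger0_norm; move: r0; lra.
have xA := gmin _ I1; have xB := gmin _ I3.
have xA2 : d x (g (s - r)) <= 2 * r.
  by have := metric_triangle x (g s) (g (s - r)); rewrite xs (metric_sym (g s)) d12; move: r0; lra.
have xB2 : d x (g (s + r)) <= 2 * r.
  by have := metric_triangle x (g s) (g (s + r)); rewrite xs d23; move: r0; lra.
have xC2 : d x (g s) <= 2 * r by rewrite xs; move: r0; lra.
have x0 : d x x <= 2 * r by rewrite mdistxx; move: r0; lra.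
have := fd _ _ xA2 xC2; have := fd _ _ xC2 xB2; have := fd _ _ xA2 xB2.
have := fd _ _ x0 xA2; have := fd _ _ x0 xB2; have := fd _ _ x0 xC2.
rewrite d12 d23 d13 xs fx !sub0r !normrN !(mulrC 2 r) -!mulrA.
have -> : 2 / 100 = 50^-1 :> R by field.
rewrite (distrC (f (g s)) (f (g (s + r)))).
move: xA xB; move: (f _) (f _) (f _) (d x _) (d x _) => A B C e1 e2.
(* A point at distance [r] from one with coordinate near [r] has coordinate near [0] or [2 * r]; the
   first is excluded by its distance [e3 >= r] from [x]. So both neighbours on the geodesic would be
   near [2 * r], although they are [2 * r] apart. *)
have far (a c e3 : R) : 0 <= c -> `|c - r| <= r / 50 -> r <= e3 ->
    `| `|a| - e3| <= r / 50 -> `| `|a - c| - r| <= r / 50 -> `|a - 2 * r| <= r / 25.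
  rewrite !ler_norml => c0 /andP[h1 h2] re /andP[h3 h4] /andP[h5 h6]; move: h3 h4 h5 h6.
  by case: (ler0P a); case: (ler0P (a - c)) => *; apply/andP; split; lra.
have flip (a b : R) : `|- a - - b| = `|a - b| by rewrite -opprD normrN.
move=> re1 re2 hC hB hA AB CB AC; have [C0|C0] := leP 0 C.
  rewrite (ger0_norm C0) in hC.
  have := far A C _ C0 hC re1 hA AC; have := far B C _ C0 hC re2 hB CB.
  move: AB; rewrite !ler_norml => /andP[h1 h2] /andP[h3 h4] /andP[h5 h6].
  by move: h1 h2; case: (ler0P (A - B)) => *; lra.
have C0' : 0 <= - C by rewrite oppr_ge0 ltW.
rewrite (ltr0_norm C0) in hC; rewrite -(normrN A) in hA; rewrite -(normrN B) in hB.
rewrite -(flip A C) in AC; rewrite -(flip B C) in CB; rewrite -(flip A B) in AB.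
have := far _ _ _ C0' hC re1 hA AC; have := far _ _ _ C0' hC re2 hB CB.
move: AB; rewrite !ler_norml => /andP[h1 h2] /andP[h3 h4] /andP[h5 h6].
by move: h1 h2; case: (ler0P (- A - - B)) => *; lra.
Qed.

End geodesic_points.

(** For approximate coordinates of two points at distance [t] from the centre and [2 * t] from each
    other; with equal signs they would be nearly equal. *)
Lemma antipodal_sign (R : realFieldType) (t a b : R) : 0 < t ->
  `| `|a - b| - 2 * t| <= 2 * t / 100 -> `| `|a| - t| <= 2 * t / 100 ->
  `| `|b| - t| <= 2 * t / 100 -> (a <= 0 -> 0 < b) /\ (0 <= a -> b < 0).
Proof.
move=> t0; rewrite !ler_norml => /andP[h1 h2] /andP[h3 h4] /andP[h5 h6].
split=> a0; rewrite ltNge; apply/negP => b0; move: h1 h2 h3 h4 h5 h6.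
  rewrite (ler0_norm a0) (ler0_norm b0); case: (ler0P (a - b)); lra.
rewrite (ger0_norm a0) (ger0_norm b0); case: (ler0P (a - b)); lra.
Qed.

Section line_points.
Context {R : realType} (X : metricType R).
Local Notation d := (@mdist R X).

Definition line_point (x : X) := exists2 e : R, 0 < e & exists s : R -> X,
  [/\ s 0 = x,
    (forall t u, `|t| <= e -> `|u| <= e -> d (s t) (s u) = `|u - t|) &
    (forall q, d x q <= e -> exists2 t, `|t| <= e & q = s t)].

Lemma line_map_opp (x : X) (w : R) (f : X -> R) : line_map x w f ->
  line_map x w (fun p => - f p).
Proof.
move=> [fx fd fs]; split; first by rewrite fx oppr0.
  by move=> p q xp xq; rewrite -opprD normrN; exact: fd.
move=> s sw; have [|p xp ps] := fs (- s); first by rewrite normrN.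
by exists p => //; rewrite -opprD normrN -[s in f p + s]opprK.
Qed.

Context (pX : proper_space X) (lX : length_space X).
Context (x : X) (rho1 : R) (nl : forall r, 0 < r < rho1 -> nearly_line x r).

Lemma cut_point_line_map (w : R) (f : X -> R) (v p : X) : 0 < w < rho1 ->
  line_map x w f -> w / 10 <= d x v <= w / 2 -> w / 10 <= d x p <= w / 2 ->
  f v < 0 -> 0 < f p -> cut_point x v p.
Proof.
move=> /andP[w0 w1] [fx fd _] /andP[v1 v2] /andP[p1 p2] fv fp.
apply: (cut_point_geodesics pX lX) => g ug g0 g1; set L := d v p in ug g1 *.
pose e : R := w / 100; have e0 : 0 < e by rewrite divr_gt0.
have we : w = 100 * e by rewrite /e; field.
have vw : d x v <= w by move: v2; lra.
have pw : d x p <= w by move: p2; lra.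
have xw : d x x <= w by rewrite mdistxx ltW.
have near q : d x q <= w -> `|f q| - e <= d x q <= `|f q| + e.
  move=> xq; have := fd _ _ xw xq; rewrite fx sub0r normrN distrC ler_distl; exact.
have /andP[] := near v vw; have /andP[] := near p pw; rewrite (ltr0_norm fv) (gtr0_norm fp) => b1 b2 a1 a2.
have fvp : `|f v - f p| = f p - f v.
  by rewrite distrC gtr0_norm// subr_gt0; exact: lt_trans fp.
have := fd _ _ vw pw; rewrite -/L -/e fvp ler_norml => /andP[l1 l2].
have aL : 0 <= d x v <= L by rewrite mdist_ge0; move: b1 a2 l1 v1 p1 e0; rewrite we; lra.
have L0 : 0 <= L by exact: mdist_ge0.
have I0 : 0 <= (0 : R) <= L by rewrite lexx.
have IL : 0 <= L <= L by rewrite lexx L0.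
(* Where a true line would pass through [x]: the coordinate forces [z] within [4 * e] of [x]. The
   nearest point of the geodesic is then as close, and far enough from both ends for [no_detour]. *)
pose z := g (d x v).
have vz : d v z = d x v by rewrite -{1}g0 ug// subr0 ger0_norm// mdist_ge0.
have zp : d z p = L - d x v by rewrite -{1}g1 ug// ger0_norm// subr_ge0; case/andP: aL.
have zw : d x z <= w.
  by have := metric_triangle x v z; rewrite vz; move: v2; lra.
have zsmall : d x z <= 4 * e.
  have /andP[_] := near z zw.
  have := fd _ _ vw zw; have := fd _ _ zw pw; rewrite vz zp -/e !ler_norml.
  move=> /andP[c1 c2] /andP[c3 c4]; move: c1 c2 c3 c4.
  case: (ler0P (f z - f p)); case: (ler0P (f v - f z)); case: (ler0P (f z));
    move: b1 b2 a1 a2 l1 l2 v1 p1 e0; rewrite we; lra.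
have [s sL smin] := geodesic_nearest x L0 ug.
have rs : d x (g s) <= 4 * e by apply: le_trans zsmall; exact: smin.
have /andP[s0 s1] := sL.
exists s => //; apply: contrapT => gsx.
have r0 : 0 < d x (g s).
  by rewrite lt_neqAle mdist_ge0 andbT; apply/eqP => h; apply: gsx; apply: mdist_positivity; rewrite metric_sym.
have vs : d v (g s) = s by rewrite -{1}g0 ug// subr0 ger0_norm.
have ps : d (g s) p = L - s by rewrite -{1}g1 ug// ger0_norm// subr_ge0.
apply: (@no_detour _ _ x (d x (g s)) L s g r0 _ ug) => //.
- apply: nl; rewrite mulr_gt0//=; apply: le_lt_trans w1; rewrite we.
  by move: rs e0; lra.
- have := metric_triangle x (g s) v; rewrite (metric_sym (g s) v) vs.
  by move: v1 rs e0; rewrite we; lra.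
- have := metric_triangle x (g s) p; rewrite ps.
  by move: p1 rs e0; rewrite we; lra.
Qed.

Context (rho : R) (core : forall (a v0 p1 p2 : X) (eta : R), 0 < eta ->
  (forall v, ball v0 eta v -> cut_point a v p1 /\ cut_point a v p2) ->
  eta <= d a v0 -> d v0 p1 + eta <= rho -> d v0 p2 + eta <= rho ->
  d a p1 = d a p2 -> p1 = p2).

(** [core] is the conclusion of [cut_points_unique]; taken as a hypothesis, it leaves a purely
    metric argument. The point [v0] with coordinate near [- (3 / 10 * w)] is in the middle of the
    range from [w / 10] to [w / 2], so the whole ball of radius [w / 10] around it is cut off by
    [x]. *)
Lemma side_unique (w : R) (f : X -> R) (p1 p2 : X) : 0 < w < rho1 -> w <= rho ->
  line_map x w f -> w / 10 <= d x p1 <= w / 2 -> d x p1 = d x p2 ->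
  0 < f p1 -> 0 < f p2 -> p1 = p2.
Proof.
move=> ww wr lf r1 p12 f1 f2; have /andP[w0 w1] := ww; have [fx fd fs] := lf.
have r2 : w / 10 <= d x p2 <= w / 2 by rewrite -p12.
have [|v0 xv0 fv0] := fs (- (3 / 10 * w)); first by rewrite normrN ger0_norm; move: w0; lra.
have xw : d x x <= w by rewrite mdistxx ltW.
have /andP[h1 h2] : - (w / 100) <= f v0 - - (3 / 10 * w) <= w / 100 by rewrite -ler_norml.
have fv0' : f v0 < 0 by move: h2 w0; lra.
have := fd _ _ xw xv0; rewrite fx sub0r normrN (ltr0_norm fv0') ler_norml => /andP[h3 h4].
have /andP[r11 r12] := r1; have /andP[r21 r22] := r2.
have t1 := metric_triangle v0 x p1; have t2 := metric_triangle v0 x p2.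
rewrite (metric_sym v0 x) in t1 t2.
apply: (@core x v0 p1 p2 (w / 10)) => //; first by rewrite divr_gt0.
- move=> v; rewrite ballE /= => v0v.
  have u1 := metric_triangle x v0 v; have u2 := metric_triangle x v v0.
  rewrite (metric_sym v v0) in u2.
  have vv : w / 10 <= d x v <= w / 2 by apply/andP; split; move: w0 u1 u2 v0v h1 h2 h3 h4; lra.
  have xv : d x v <= w by case/andP: vv => _; move: w0; lra.
  have fv : f v < 0.
    have := fd _ _ xv xv0; rewrite (metric_sym v v0) ler_norml => /andP[_].
    by case: (ler0P (f v - f v0)); move: w0 v0v h1 h2; lra.
  by split; apply: (@cut_point_line_map w f).
- by move: w0 h1 h2 h3 h4; lra.
- by move: w0 h1 h2 h3 h4 t1 r12 wr; lra.
- by move: w0 h1 h2 h3 h4 t2 r22 wr; lra.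
Qed.

(** A geodesic joining the two sides passes through [x] and gives [s]. A point [q] at distance [t]
    is compared at the scale [2 * t] with [s t] and [s (- t)]: these have opposite signs, and [q]
    equals the one on its own side. *)
Lemma nearly_line_line_point : 0 < rho1 -> 0 < rho -> line_point x.
Proof.
move=> rho10 rho0; pose w : R := Num.min rho1 rho / 2.
have m0 : 0 < Num.min rho1 rho by rewrite lt_min rho10.
have [m1 m2] : Num.min rho1 rho <= rho1 /\ Num.min rho1 rho <= rho.
  by rewrite !ge_min !lexx orbT.
have w0 : 0 < w by rewrite divr_gt0.
have w1 : w < rho1 by rewrite /w; move: m0 m1; lra.
have w2 : w <= rho by rewrite /w; move: m0 m2; lra.
clearbody w.
have ww : 0 < w < rho1 by rewrite w0.
have [f lf] := nl ww; have [fx fd fs] := lf.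
have xw : d x x <= w by rewrite mdistxx ltW.
have [|v0 xv0 fv0] := fs (- (3 / 10 * w)); first by rewrite normrN ger0_norm; move: w0; lra.
have [|p0 xp0 fp0] := fs (3 / 10 * w); first by rewrite ger0_norm; move: w0; lra.
have /andP[h1 h2] : - (w / 100) <= f v0 - - (3 / 10 * w) <= w / 100 by rewrite -ler_norml.
have /andP[h3 h4] : - (w / 100) <= f p0 - 3 / 10 * w <= w / 100 by rewrite -ler_norml.
have fv0' : f v0 < 0 by move: h2 w0; lra.
have fp0' : 0 < f p0 by move: h3 w0; lra.
have := fd _ _ xw xv0; rewrite fx sub0r normrN (ltr0_norm fv0') ler_norml => /andP[h7 h8].
have := fd _ _ xw xp0; rewrite fx sub0r normrN (gtr0_norm fp0') ler_norml => /andP[h5 h6].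
have [e1 _] : cut_point x v0 p0.
  by apply: (@cut_point_line_map w f) => //; apply/andP; split; move: w0 h1 h2 h3 h4 h5 h6 h7 h8; lra.
have [g [ug g0 gx g1]] := unit_geodesic_through pX lX (esym e1).
rewrite e1 (metric_sym v0 x) in ug gx g1.
have b1 : w / 10 <= d x v0 by move: w0 h1 h2 h7 h8; lra.
have b2 : w / 10 <= d x p0 by move: w0 h3 h4 h5 h6; lra.
pose s t := g (d x v0 + t).
have sd (t u : R) : `|t| <= w / 10 -> `|u| <= w / 10 -> d (s t) (s u) = `|u - t|.
  rewrite !ler_norml => /andP[t1 t2] /andP[u1 u2]; rewrite /s ug.
  - by congr `|_|; ring.
  - by apply/andP; split; move: b1 b2 t1 t2; lra.
  - by apply/andP; split; move: b1 b2 u1 u2; lra.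
have s0 : s 0 = x by rewrite /s addr0.
exists (w / 10); first by rewrite divr_gt0.
exists s; split => // q xq.
have [q0|q0] := eqVneq (d x q) 0.
  exists 0; first by rewrite normr0 divr_ge0// ltW.
  by rewrite s0; apply: mdist_positivity; rewrite metric_sym.
have {q0} t0 : 0 < d x q by rewrite lt_neqAle eq_sym q0 mdist_ge0.
set t := d x q in xq t0.
have tw : 0 < 2 * t < rho1 by apply/andP; split; move: t0 xq w1; lra.
have tr : 2 * t <= rho by move: xq w2 w0; lra.
have [h lh] := nl tw; have [hx hd _] := lh.
have nt : `|t| <= w / 10 by rewrite gtr0_norm.
have nt' : `|- t| <= w / 10 by rewrite normrN gtr0_norm.
have n0 : `|0 : R| <= w / 10 by rewrite normr0 divr_ge0// ltW.
have xs : d x (s t) = t by rewrite -{1}s0 sd// subr0 gtr0_norm.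
have xs' : d x (s (- t)) = t by rewrite -{1}s0 sd// subr0 normrN gtr0_norm.
have ss : d (s t) (s (- t)) = 2 * t.
  by rewrite sd// -opprD normrN gtr0_norm ?addr_gt0//; ring.
have x2 : d x x <= 2 * t by rewrite mdistxx; move: t0; lra.
have q2 : d x q <= 2 * t by rewrite -/t; move: t0; lra.
have st2 : d x (s t) <= 2 * t by rewrite xs; move: t0; lra.
have st2' : d x (s (- t)) <= 2 * t by rewrite xs'; move: t0; lra.
have k1 := hd _ _ st2 st2'; have k2 := hd _ _ x2 st2; have k3 := hd _ _ x2 st2'.
have k4 := hd _ _ x2 q2; rewrite ss in k1.
rewrite hx sub0r normrN xs in k2; rewrite hx sub0r normrN xs' in k3.
rewrite hx sub0r normrN -/t in k4.
have [sn sp] := antipodal_sign t0 k1 k2 k3.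
have rq p : d x p = t -> 2 * t / 10 <= d x p <= 2 * t / 2.
  move=> ->; apply/andP; split; last by rewrite mulrAC divff// mul1r.
  by rewrite ler_pdivrMr// mulrC ler_pM2l// ler_nat.
have pos p : d x p = t -> 0 < h q -> 0 < h p -> q = p.
  by move=> xp hq hp; apply: (@side_unique (2 * t) h) => //; exact: rq.
have neg p : d x p = t -> h q < 0 -> h p < 0 -> q = p.
  move=> xp hq hp; apply: (@side_unique (2 * t) (fun p => - h p)) => //; try exact: rq.
  - exact: line_map_opp.
  - by rewrite oppr_gt0.
  - by rewrite oppr_gt0.
have [hq|hq] := ltP 0 (h q).
  have [hs|hs] := ltP 0 (h (s t)); first by exists t => //; exact: pos.
  by exists (- t) => //; apply: pos => //; exact: sn.
have {}hq : h q < 0.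
  rewrite lt_neqAle hq andbT; apply/eqP => h0; move: k4; rewrite h0 normr0 sub0r normrN.
  by rewrite gtr0_norm//; move: t0; lra.
have [hs|hs] := ltP (h (s t)) 0; first by exists t => //; exact: neg.
by exists (- t) => //; apply: neg => //; exact: sp.
Qed.

End line_points.

(** * Propagation along geodesics *)

Section propagation.
Context {R : realType} (X : metricType R).
Local Notation d := (@mdist R X).

Definition ray_point (p : X) := exists2 e : R, 0 < e & exists k : X -> R,
  [/\ k p = 0,
    (forall q q', d p q < e -> d p q' < e -> `|k q - k q'| = d q q'),
    (forall t, 0 <= t < e -> exists2 q, d p q < e & k q = t) &
    (forall q, d p q < e -> 0 <= k q)].

Context (pX : proper_space X) (lX : length_space X).
Context (rho : R) (core : forall (a v0 p1 p2 : X) (eta : R), 0 < eta ->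
  (forall v, ball v0 eta v -> cut_point a v p1 /\ cut_point a v p2) ->
  eta <= d a v0 -> d v0 p1 + eta <= rho -> d v0 p2 + eta <= rho ->
  d a p1 = d a p2 -> p1 = p2).

Lemma geodesic_at (a q : X) (t : R) : 0 <= t <= d a q ->
  exists2 z, d a z = t & d z q = d a q - t.
Proof.
move=> tL; have [g [ug g0 g1]] := unit_geodesic_exists pX lX a q.
have /andP[t0 t1] := tL.
exists (g t); first by rewrite -{1}g0 ug ?subr0 ?ger0_norm ?lexx ?mdist_ge0.
by rewrite -{1}g1 ug ?ger0_norm ?subr_ge0 ?lexx ?mdist_ge0.
Qed.

(** A geodesic from [y] to [p] leaves along one of the two sides; the parametrisation is reversed if
    this is the negative one. The bound [L / 2] keeps the interval away from [p]. *)
Lemma line_point_branch (y p : X) (L : R) : line_point y -> L = d y p -> 0 < L ->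
  exists2 e : R, 0 < e <= L / 2 & exists s : R -> X,
  [/\ s 0 = y, d y p = e / 2 + d (s (e / 2)) p,
    (forall t u, `|t| <= e -> `|u| <= e -> d (s t) (s u) = `|u - t|) &
    (forall q, d y q <= e -> exists2 t, `|t| = d y q & q = s t)].
Proof.
move=> [e0 e00 [s [s0 sd son]]] LE L0.
pose e := Num.min e0 (L / 2).
have [ee eL] : e <= e0 /\ e <= L / 2 by rewrite /e !ge_min !lexx orbT.
have ep : 0 < e by rewrite lt_min e00 divr_gt0.
have e20 : 0 <= e / 2 by rewrite divr_ge0// ltW.
have [|z yz zp] := @geodesic_at y p (e / 2).
  by rewrite -LE e20 /=; move: eL ep L0; clearbody e; lra.
have n0 : `|0 : R| <= e0 by rewrite normr0 ltW.
have on_ q : d y q <= e -> exists2 t, `|t| = d y q & q = s t.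
  move=> yq; have [|t te qE] := son q; first exact: le_trans yq ee.
  by exists t => //; rewrite qE -s0 sd// subr0.
have [|t0 t0E zE] := on_ z; first by rewrite yz; move: ep; clearbody e; lra.
have d12 : d y p = e / 2 + d z p by rewrite zp addrC subrK.
rewrite yz in t0E.
have [t0p|t0n] := leP 0 t0.
  exists e; first by rewrite ep.
  exists s; split => //.
    by rewrite (_ : e / 2 = t0) -?zE// -?t0E ger0_norm in d12 *.
  by move=> t u te ue; apply: sd; [exact: le_trans te ee|exact: le_trans ue ee].
exists e; first by rewrite ep.
exists (fun t => s (- t)); split.
- by rewrite oppr0.
- by rewrite (_ : - (e / 2) = t0) -?zE// -t0E ltr0_norm// opprK.
- move=> t u te ue; rewrite sd ?normrN; [|exact: le_trans te ee|exact: le_trans ue ee].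
  by rewrite -opprD normrN.
- by move=> q /on_[t tq qE]; exists (- t); rewrite ?normrN ?opprK.
Qed.

(* Near [p] the distance to a point [a] just after [y] is an isometric
   coordinate, since geodesics from a ball before [a] all pass through [a]. *)
Lemma line_point_coordinate (y p : X) : line_point y -> 0 < d y p < rho / 2 ->
  exists2 e : R, 0 < e & exists a : X,
  [/\ e < d a p, d y p = d y a + d a p,
    (forall q q', d p q < e -> d p q' < e -> `|d a q - d a q'| = d q q') &
    (forall p2 t, d p p2 < e / 3 -> d a p - e / 3 < t <= d a p2 ->
      exists2 q, d a q = t & d p q < e)].
Proof.
move=> ly /andP[L0 Lr].
have [e /andP[e0 eL] [s [s0 pa sd son]]] := line_point_branch ly erefl L0.
(* The points come in the order [y], [v0], [a], [p], with room between them for balls of radius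
   [eta]. *)
pose a := s (e / 2); pose v0 := s (e / 4); pose eta : R := e / 20.
set L := d y p in L0 Lr eL pa.
have eta0 : 0 < eta by rewrite divr_gt0.
have eE : e = 20 * eta by rewrite /eta; field.
clearbody eta.
have n0 : `|0 : R| <= e by rewrite normr0 ltW.
have n2 : `|e / 2| <= e by rewrite ger0_norm; move: e0; lra.
have n4 : `|e / 4| <= e by rewrite ger0_norm; move: e0; lra.
have ya : d y a = e / 2 by rewrite -{1}s0 sd// subr0 ger0_norm//; move: e0; lra.
have yv0 : d y v0 = e / 4 by rewrite -{1}s0 sd// subr0 ger0_norm//; move: e0; lra.
have av0 : d a v0 = e / 4 by rewrite sd// ler0_norm; move: e0; lra.
rewrite -/a in pa.
have cut v q : ball v0 eta v -> ball p eta q -> cut_point a v q.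
  rewrite !ballE /= => v0v pq.
  have tv := metric_triangle y v0 v; have tq := metric_triangle y q p.
  rewrite (metric_sym q p) -/L in tq.
  have [|u uE vE] := son v; first by move: tv v0v yv0 eE eta0; lra.
  have ue : `|u| <= e by rewrite uE; move: tv v0v yv0 eE eta0; lra.
  have uv0 : `|u - e / 4| < eta by rewrite -sd// -vE.
  have /andP[u1 u2] : e / 4 - eta < u < e / 4 + eta by rewrite -ltr_distl.
  have u0 : 0 < u by move: u1 eE eta0; lra.
  rewrite gtr0_norm// in uE.
  apply: (cut_point_geodesics pX lX) => g ug g0 g1.
  have vqL := mdist_ge0 v q.
  (* At distance [e / 2] from [y] the geodesic is at [s (e / 2)], which is [a], or at the opposite
     point, and a way through the latter would be too long. *)
  have [|t tL yt] := @geodesic_hit _ _ y (d v q) (e / 2) g vqL ug.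
    by rewrite g0 g1 -uE; apply/andP; split; move: u2 tq pq eE eta0 eL; lra.
  exists t => //; have [|t1 t1E gE] := son (g t); first by rewrite yt; move: e0; lra.
  rewrite yt in t1E; rewrite gE.
  have [t1p|t1n] := leP 0 t1; first by rewrite -(ger0_norm t1p) t1E.
  exfalso; rewrite ltr0_norm// in t1E; have /andP[ta tb] := tL.
  have I0 : 0 <= (0 : R) <= d v q by rewrite lexx.
  have IL : 0 <= d v q <= d v q by rewrite lexx vqL.
  have vg : d v (g t) = t by rewrite -{1}g0 ug// subr0 ger0_norm.
  have gq : d (g t) q = d v q - t by rewrite -{1}g1 ug// ger0_norm// subr_ge0.
  have nt1 : `|t1| <= e by rewrite ltr0_norm// t1E; move: e0; lra.
  have vg' : t = u + e / 2.
    have t1' : t1 = - (e / 2) by rewrite -t1E opprK.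
    by rewrite -vg vE gE sd// t1' ler0_norm; move: u0 e0; lra.
  have va : d v a = e / 2 - u.
    rewrite vE sd// gtr0_norm//.
      by move: u2 eE eta0; lra.
  have h1 := metric_triangle y (g t) q; have h2 := metric_triangle v a q.
  have h3 := metric_triangle a p q.
  by rewrite yt gq in h1; move: h1 h2 h3 vg' va pa pq tq u1 eE eta0; lra.
have inj q q' : d p q < eta -> d p q' < eta -> d a q = d a q' -> q = q'.
  move=> pq pq' aqq.
  have t1 := metric_triangle v0 y q; have t2 := metric_triangle v0 y q'.
  have t3 := metric_triangle y p q; have t4 := metric_triangle y p q'.
  rewrite (metric_sym v0 y) yv0 -/L in t1 t2 t3 t4.
  apply: (@core a v0 q q' eta) => //.
  - by move=> v vb; split; apply: cut => //; rewrite ballE.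
  - by rewrite av0; move: eE eta0; lra.
  - by move: t1 t3 pq eE eta0 eL Lr; lra.
  - by move: t2 t4 pq' eE eta0 eL Lr; lra.
(* The point [z] on the way from [a] to [q'] with [d a z = d a q] is within [d q q'] of [q'], hence
   within [eta] of [p], and [inj] identifies it with [q]. *)
have iso q q' : d p q < eta / 3 -> d p q' < eta / 3 -> `|d a q - d a q'| = d q q'.
  wlog le : q q' / d a q <= d a q'.
    move=> H pq pq'; have [le|/ltW le] := leP (d a q) (d a q'); first exact: H.
    by rewrite distrC (metric_sym q q'); exact: H.
  move=> pq pq'; have [|z az zq'] := @geodesic_at a q' (d a q); first by rewrite mdist_ge0.
  have lip := metric_triangle a q q'; have t1 := metric_triangle q p q'.
  rewrite (metric_sym q p) in t1; have t2 := metric_triangle p q' z.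
  rewrite (metric_sym q' z) in t2.
  have qz : q = z.
    by apply: inj; rewrite ?az//; [move: pq eta0|move: t2 zq' lip t1 pq pq' eta0]; lra.
  by rewrite distrC ger0_norm ?subr_ge0// qz zq' az.
exists (eta / 3); first by rewrite divr_gt0.
exists a; split => //; first by move: pa eL eE eta0; lra.
  by rewrite ya -/L pa.
move=> p2 t pp2 /andP[t1 t2]; have [|q aq qp2] := @geodesic_at a p2 t.
  by rewrite t2 andbT; move: t1 pa eL eE eta0; lra.
exists q => //; have := metric_triangle p p2 q; have := metric_triangle a p p2.
by rewrite (metric_sym p2 q); move: qp2 pp2 t1; lra.
Qed.

(** If some point near [p] is farther from [a] than [p], then [d a] takes all values around [d a p]
    and [p] is an inner point; otherwise [d a p - d a q] is a coordinate with end [p]. A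
    continuation of the geodesic beyond [p] supplies such a farther point. *)
Lemma line_point_step (y p : X) : line_point y -> 0 < d y p < rho / 2 ->
  (forall p2, d y p2 = d y p + d p p2 -> p2 <> p -> line_point p) /\
  (line_point p \/ ray_point p).
Proof.
move=> ly yp; have [e e0 [a [eap yap iso betw]]] := line_point_coordinate ly yp.
have pp : d p p < e by rewrite mdistxx.
have pp3 : d p p < e / 3 by rewrite mdistxx divr_gt0.
have caseA q0 : d p q0 < e / 3 -> d a p < d a q0 -> line_point p.
  move=> pq0 apq; pose del := d a q0 - d a p.
  have del0 : 0 < del by rewrite subr_gt0.
  have pq0' : d p q0 < e by move: pq0 e0; lra.
  have dele : del < e / 3.
    have := iso _ _ pp pq0'; rewrite distrC gtr0_norm// -/del => ->.
    by [].
  have /choice[s sP] (t : R) : exists q, `|t| <= del -> d a q = d a p + t /\ d p q < e.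
    have [td|td] := pselect (`|t| <= del); last by exists p.
    move: (td); rewrite ler_norml => /andP[t1 t2].
    have [|q aq pq] := betw q0 (d a p + t) pq0; last by exists q.
    by apply/andP; split; [move: t1 dele; lra|move: t2; rewrite /del; lra].
  have sd t u : `|t| <= del -> `|u| <= del -> d (s t) (s u) = `|u - t|.
    move=> td ud; have [at_ pt] := sP t td; have [au pu] := sP u ud.
    by rewrite -iso// at_ au distrC opprD addrACA subrr add0r.
  have uniq q t : `|t| <= del -> d p q < e -> d a q = d a p + t -> q = s t.
    move=> td pq aq; have [at_ pt] := sP t td; apply: mdist_positivity.
    by rewrite -iso// aq at_ subrr normr0.
  have n0 : `|0 : R| <= del by rewrite normr0 ltW.
  exists del => //; exists s; split => //.
    by apply/esym/uniq => //; rewrite addr0.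
  move=> q pq; have pqe : d p q < e by apply: le_lt_trans pq _; move: dele e0; lra.
  exists (d a q - d a p); first by rewrite iso// metric_sym.
  apply: uniq => //; first by rewrite iso// metric_sym.
  by rewrite addrC subrK.
split.
  move=> p2 yp2 p2p.
  have pp20 : 0 < d p p2.
    rewrite lt_neqAle mdist_ge0 andbT; apply/eqP => h; apply: p2p.
    by apply: mdist_positivity; rewrite metric_sym -h.
  pose t : R := Num.min (e / 6) (d p p2).
  have t0 : 0 < t by rewrite lt_min divr_gt0.
  have [t6 t2] : t <= e / 6 /\ t <= d p p2 by rewrite /t !ge_min !lexx orbT.
  clearbody t.
  have [|q pq qp2] := @geodesic_at p p2 t; first by rewrite ltW.
  apply: (caseA q); first by rewrite pq; move: t6 e0; lra.
  have := metric_triangle y q p2; have := metric_triangle y a q.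
  by move: yp2 qp2 yap t0; lra.
have [[q0 [pq0 aq0]]|nq] := pselect (exists q0, d p q0 < e / 3 /\ d a p < d a q0).
  by left; exact: caseA pq0 aq0.
right; exists (e / 3); first by rewrite divr_gt0.
have lt3 (r : R) : r < e / 3 -> r < e by move: e0; lra.
exists (fun q => d a p - d a q); split.
- by rewrite subrr.
- move=> q q' /lt3 pq /lt3 pq'; rewrite -(iso q q')// distrC; congr `|_|; ring.
- move=> t /andP[t0 t1]; have [|q aq pq] := betw p (d a p - t) pp3.
    by apply/andP; split; [move: t1|move: t0]; lra.
  exists q; last by rewrite aq subKr.
  by rewrite -(iso p q)// aq subKr ger0_norm.
- move=> q pq; rewrite subr_ge0 leNgt; apply/negP => h; apply: nq.
  by exists q.
Qed.

End propagation.

(** * Charts and the global conclusion *)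

Section charts.
Context {R : realType} (X : metricType R).
Local Notation d := (@mdist R X).

(** Covers both kinds of points: [V] lies in the open half-line around an inner point and contains
    [0] at an end. Being isometric, the coordinate is a homeomorphism for the subspace
    topologies. *)
Lemma coordinate_chart (p : X) (e : R) (k : X -> R) (V : set R) : 0 < e -> open V ->
  (forall q q', d p q < e -> d p q' < e -> `|k q - k q'| = d q q') ->
  (forall q, d p q < e -> V (k q) /\ 0 <= k q) ->
  (forall t, V t -> 0 <= t -> exists2 q, d p q < e & k q = t) ->
  exists2 U : set X, open_nbhs p U & exists2 V : set R, open V &
    homeomorphic (set_type U) (set_type (V `&` [set r | 0 <= r])).
Proof.
move=> e0 oV iso kV Vk; exists (ball p e).
  by split; [exact: mball_open|exact: ballxx].
exists V => //; set U : set X := ball p e; set W := V `&` [set r | 0 <= r].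
have UE q : U q -> d p q < e by rewrite /U ballE.
have /choice[j jP] (r : set_type W) : exists q : set_type U, k (val q) = val r.
  have [Vr r0] := set_valP r; have [q pq kq] := Vk _ Vr r0.
  have Uq : q \in U by rewrite inE /U ballE.
  by exists (SigSub Uq).
have fP (q : set_type U) : k (val q) \in W.
  by rewrite inE; exact: kV (UE _ (set_valP q)).
pose f (q : set_type U) : set_type W := SigSub (fP q).
have isoU (q q' : set_type U) : `|k (val q) - k (val q')| = d (val q) (val q').
  by apply: iso; apply: UE; exact: set_valP.
have cf : continuous (fun q : set_type U => set_val (f q) : R).
  move=> q; have FF := nbhs_filter q; apply/cvgrPdist_lt => r r0.
  have nq : nbhs q (set_val @^-1` (ball (set_val q) r : set X)).
    by apply: initial_continuous; exact: nbhsx_ballx.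
  apply: filterS nq => q'; rewrite /preimage /= !set_valE ballE /= => qq'.
  by rewrite isoU.
have cj : continuous (fun t : set_type W => set_val (j t) : X).
  move=> t; have FF := nbhs_filter t; apply/cvg_ballP => r r0.
  have nt : nbhs t (set_val @^-1` (ball (set_val t) r : set R)).
    by apply: initial_continuous; exact: nbhsx_ballx.
  apply: filterS nt => t'; rewrite /preimage /= !set_valE ballE /=.
  by rewrite -isoU !jP /ball /=.
exists f, j; split.
- exact: (continuous_comp_initial cf).
- exact: (continuous_comp_initial cj).
- move=> q; apply: val_inj => /=; apply: mdist_positivity.
  by rewrite -isoU jP /= subrr normr0.
- by move=> t; apply: val_inj; rewrite /= jP.
Qed.

Lemma line_point_chart (p : X) : line_point p ->
  exists2 U : set X, open_nbhs p U & exists2 V : set R, open V &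
    homeomorphic (set_type U) (set_type (V `&` [set r | 0 <= r])).
Proof.
move=> [e e0 [s [s0 sd son]]].
have /choice[k kP] (q : X) : exists t, d p q <= e -> `|t| <= e /\ q = s t.
  have [/son[t te qE]|pq] := pselect (d p q <= e); first by exists t.
  by exists 0.
have n0 : `|0 : R| <= e by rewrite normr0 ltW.
(* The shift by [e] moves the interval into the open half-line. *)
apply: (@coordinate_chart p e (fun q => k q + e) `]0, (2 * e)[%classic) => //.
- move=> q q' /ltW/kP[kq qE] /ltW/kP[kq' qE'].
  by rewrite {2}qE {2}qE' sd// distrC opprD addrACA subrr addr0.
- move=> q pq; have [kq qE] := kP _ (ltW pq).
  have : `|k q| < e by move: pq; rewrite {1}qE -{1}s0 sd// subr0.
  by rewrite ltr_norml /= in_itv /= => /andP[h1 h2]; split; [apply/andP; split|]; lra.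
- move=> t /=; rewrite in_itv /= => /andP[t0 t2] _.
  have te : `|t - e| < e by rewrite ltr_norml; apply/andP; split; lra.
  have pst : d p (s (t - e)) < e by rewrite -{1}s0 sd ?subr0// ltW.
  exists (s (t - e)) => //; have [kq qE] := kP _ (ltW pst).
  have := sd _ _ (ltW te) kq; rewrite -qE mdistxx => /esym/eqP.
  by rewrite normr_eq0 subr_eq0 => /eqP->; rewrite subrK.
Qed.

Lemma ray_point_chart (p : X) : ray_point p ->
  exists2 U : set X, open_nbhs p U & exists2 V : set R, open V &
    homeomorphic (set_type U) (set_type (V `&` [set r | 0 <= r])).
Proof.
move=> [e e0 [k [kp iso on_ k0]]].
apply: (@coordinate_chart p e k `](- e), e[%classic) => //.
- move=> q pq; split; last exact: k0.
  have pp : d p p < e by rewrite mdistxx.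
  have := iso _ _ pp pq; rewrite kp sub0r normrN => kE.
  by rewrite /= in_itv /= -ltr_norml kE.
- by move=> t /=; rewrite in_itv /= => /andP[_ te] t0; apply: on_; rewrite t0.
Qed.

Context (pX : proper_space X) (lX : length_space X).
Context (rho : R) (rho0 : 0 < rho) (core : forall (a v0 p1 p2 : X) (eta : R), 0 < eta ->
  (forall v, ball v0 eta v -> cut_point a v p1 /\ cut_point a v p2) ->
  eta <= d a v0 -> d v0 p1 + eta <= rho -> d v0 p2 + eta <= rho ->
  d a p1 = d a p2 -> p1 = p2).

(** Along a geodesic from [x] to [p], every point before [p] is followed by further points, so steps
    of length [h], below [rho / 2], carry [line_point] up to within [h] of [p]. The last step, where
    no continuation is known, leaves both alternatives. *)
Lemma line_point_spreads (x p : X) : line_point x -> line_point p \/ ray_point p.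
Proof.
move=> lx; have [g [ug g0 g1]] := unit_geodesic_exists pX lX x p.
set D := d x p in ug g1.
have [D0|D0] := eqVneq D 0.
  by left; rewrite -(_ : x = p) //; apply: mdist_positivity.
have {}D0 : 0 < D by rewrite lt_neqAle eq_sym D0 mdist_ge0.
have DD : 0 <= D <= D by rewrite lexx ltW.
pose h : R := rho / 4; have h0 : 0 < h by rewrite divr_gt0.
have rh : rho / 2 = 2 * h by rewrite /h; field.
have key (n : nat) (t : R) : 0 <= t < D -> t <= n%:R * h -> line_point (g t).
  elim: n t => [|n IHn] t /andP[t0 tD] tn.
    by rewrite (_ : t = 0) ?g0//; apply/eqP; rewrite eq_le t0 andbT -(mul0r h).
  have [|nt] := leP t (n%:R * h); first by apply: IHn; rewrite t0.
  pose t1 : R := n%:R * h; rewrite -/t1 in nt.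
  have t10 : 0 <= t1 by rewrite mulr_ge0// ltW.
  have l1 : line_point (g t1) by apply: IHn => //; rewrite t10 (lt_trans nt).
  have tn' : t <= t1 + h by move: tn; rewrite -natr1 mulrDl mul1r.
  clearbody t1.
  have I1 : 0 <= t1 <= D by rewrite t10 ltW// (lt_trans nt).
  have It : 0 <= t <= D by rewrite t0 ltW.
  have dt : d (g t1) (g t) = t - t1 by rewrite ug// ger0_norm// subr_ge0 ltW.
  have [|step _] := line_point_step pX lX core l1 (p := g t).
    by rewrite dt rh; apply/andP; split; move: nt tn' h0; lra.
  apply: (step (g D)).
    rewrite dt !ug// !ger0_norm ?subr_ge0; first ring.
    - exact: ltW.
    - by case/andP: I1.
  move=> gE; have : d (g t) (g D) = 0 by rewrite gE mdistxx.
  by rewrite ug// => /eqP; rewrite normr_eq0 subr_eq0 gt_eqF.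
pose t0 : R := Num.max 0 (D - h).
have t00 : 0 <= t0 by rewrite le_max lexx.
have t0D : t0 < D by rewrite gt_max D0/=; move: h0; lra.
have t0h : D - t0 <= h by rewrite lerBlDr -lerBlDl le_max lexx orbT.
have lt0 : line_point (g t0).
  apply: (key (Num.bound (t0 / h))); first by rewrite t00.
  by rewrite -ler_pdivrMr// ltW// archi_boundP// divr_ge0// ltW.
have It0 : 0 <= t0 <= D by rewrite t00 ltW.
have dt : d (g t0) p = D - t0 by rewrite -g1 ug// ger0_norm// subr_ge0 ltW.
have [|_ //] := line_point_step pX lX core lt0 (p := p).
by rewrite dt rh subr_gt0 t0D /=; move: t0h h0; lra.
Qed.

End charts.
Theorem corollary3p11 (R : realType) (X : pmetricType R)
    (m : {measure set (borel X) -> \bar R}) :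
  metric_measure_space m ->
  (essentially_nonbranching m /\ (exists K N : R, 1 < N /\ MCP m K N)) \/
  (essentially_nonbranching m /\ qualitatively_nondegenerate m) ->
  (exists x : X, tangent_is_line x) ->
  manifold1_with_boundary R X.
Proof.
move=> [[cX lcX sX lX] [fX oX]] hyp [x tx].
have pX := hopf_rinow cX lcX lX.
have s2X := separable_second_countable sX.
have [enb nd] : essentially_nonbranching m /\ nondegenerate m.
  case: hyp => [[enb [K [N [N1 mcp]]]]|[enb qnd]]; split => //.
    exact: MCP_nondegenerate N1 pX fX mcp.
  exact: qualitatively_nondegenerate_nondegenerate.
have [rho1 rho10 nl] := tangent_line_nearly_line pX lX fX oX nd tx.
have [rho rho0 ndr] := nd.
have core := cut_points_unique pX lX s2X fX oX enb rho0 ndr.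
have lx : line_point x := nearly_line_line_point pX lX nl core rho10 rho0.
split => [|//|p]; first exact: metric_hausdorff.
have [lp|rp] := line_point_spreads pX lX rho0 core p lx.
- exact: line_point_chart.
- exact: ray_point_chart.
Qed.
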